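(* Let $\mathcal F$ be a family of graphs and let $k\ge 1$ be an integer. Suppose that $\mathrm{ex}(n,\mathcal F)=O(n)$, that $K_{k+1,\infty}$ is not $\mathcal F$-free, and that for all $n$ large enough $\mathrm{EX}^{K_{k,n-k}}(n,\mathcal F)$ contains a graph $H=H_n$ for which one of the following holds: (a) $H=K_{k,n-k}$; (b) $H=K_k+\overline{K_{n-k}}$; (c) $H=K_k+(K_2\cup\overline{K_{n-k-2}})$; (d) $H=K_k+X$, where $X=X_n$ is a graph on $n-k$ vertices with $e(X)\le Qn+O(1)$ for some constant $Q\in[0,3/4)$, and $\mathcal F$ is finite; (e) $H=K_k+X$, where $X=X_n$ is a graph on $n-k$ vertices with $e(X)\le Qn+O(1)$ for some constant $Q\in[3/4,\infty)$, and $\mathcal F$ is finite; (f) (e) holds, there is a constant $d$ such that all but a bounded number (independent of $n$) of vertices of $X$ have degree $d$ in $X$, and $K_k+(\infty\cdot K_{1,d+1})$ is not $\mathcal F$-free. Then: If (a), (b), or (c) holds, then for $n$ large enough, $\mathrm{SPEX}(n,\mathcal F)=\{H\}$. If (d) or (f) holds, then for $n$ large enough, $\mathrm{SPEX}(n,\mathcal F)\subseteq\mathrm{EX}^{K_k+\overline{K_{n-k}}}(n,\mathcal F)$. If (e) holds, then for $n$ large enough every graph in $\mathrm{SPEX}(n,\mathcal F)$ is of the form $K_k+Y$, where $Y$ is a graph on $n-k$ vertices with $e(Y)\ge e(X)-O(n^{1/2})$ and $\Delta(Y)$ is bounded by a constant depending only on $\mathcal F$.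
   Context: All graphs are simple. A graph is $\mathcal F$-free if it contains no member of $\mathcal F$ as a subgraph. $\mathrm{ex}(n,\mathcal F)$ is the maximum number of edges of an $\mathcal F$-free graph on $n$ vertices. For a graph $G$, $\mathrm{EX}^G(n,\mathcal F)$ is the set of $\mathcal F$-free graphs on $n$ vertices that contain a copy of $G$ and have the maximum number of edges among such graphs. $\mathrm{SPEX}(n,\mathcal F)$ is the set of $\mathcal F$-free graphs on $n$ vertices whose adjacency matrix has the maximum possible largest eigenvalue (spectral radius) among all $n$-vertex $\mathcal F$-free graphs; equalities of such sets with a single graph are up to isomorphism. $G+H$ denotes the join, $G\cup H$ the disjoint union, $\overline{G}$ the complement, $\Delta(G)$ the maximum degree, $e(G)$ the number of edges. $K_{m,\infty}$ is the complete bipartite graph with parts of size $m$ and countably infinite size; $\infty\cdot K_{1,d+1}$ is the disjoint union of countably many copies of $K_{1,d+1}$; an infinite graph is ''not $\mathcal F$-free'' if it contains some member of $\mathcal F$ as a subgraph. Implied constants in $O(\cdot)$ are independent of $n$. *)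

(* Defs.v *)
From HB Require Import structures.
From mathcomp Require Import all_boot all_order all_algebra.
From mathcomp Require Import all_classical all_reals all_analysis.

Set Implicit Arguments.
Unset Strict Implicit.
Unset Printing Implicit Defensive.

Import Order.TTheory GRing.Theory Num.Theory.

Local Open Scope classical_set_scope.
Local Open Scope ring_scope.

(* The vertex type is arbitrary, so that infinite graphs are covered too. *)
Record sgraph (T : Type) := SGraph {
  adj :> rel T;
  adj_sym : symmetric adj;
  adj_irr : irreflexive adj }.

Definition isog (S T : Type) (G : sgraph S) (H : sgraph T) : Prop :=
  exists2 f : S -> T, bijective f & forall x y, G x y = H (f x) (f y).

(* Subgraphs need not be induced. *)
Definition contains (S T : Type) (G : sgraph S) (H : sgraph T) : Prop :=
  exists2 f : T -> S, injective f & forall x y, H x y -> G (f x) (f y).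

(* A family is a set of finite graphs, each carried by some 'I_m. As there *)
(* are finitely many graphs on each 'I_m, [finite_set F] means the same     *)
(* whether or not F is closed under isomorphism.                            *)
Definition graph_family := set {m : nat & sgraph 'I_m}.

Definition family_free (F : graph_family) (T : Type) (G : sgraph T) : Prop :=
  forall A, F A -> ~ contains G (projT2 A).

Section FiniteGraphs.
Variables (T : finType) (G : sgraph T).

Definition edges : {set {set T}} :=
  [set e : {set T} | [exists x, exists y, G x y && (e == [set x; y]%SET)]]%SET.

Definition nb_edges : nat := #|edges|.

Definition degree (x : T) : nat := #|[set y | G x y]%SET|.

Definition max_degree : nat := \max_(x : T) degree x.

End FiniteGraphs.

Section Constructions.
Variables (S T : Type).

Definition gjoin_rel (G : sgraph S) (H : sgraph T) : rel (S + T) := fun u v =>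
  match u, v with
  | inl x, inl y => G x y
  | inr x, inr y => H x y
  | _, _ => true
  end.

Lemma gjoin_sym G H : symmetric (gjoin_rel G H).
Proof. by case=> x [] y //=; rewrite adj_sym. Qed.

Lemma gjoin_irr G H : irreflexive (gjoin_rel G H).
Proof. by case=> x /=; rewrite adj_irr. Qed.

Definition gjoin G H := SGraph (gjoin_sym G H) (gjoin_irr G H).

Definition gunion_rel (G : sgraph S) (H : sgraph T) : rel (S + T) := fun u v =>
  match u, v with
  | inl x, inl y => G x y
  | inr x, inr y => H x y
  | _, _ => false
  end.

Lemma gunion_sym G H : symmetric (gunion_rel G H).
Proof. by case=> x [] y //=; rewrite adj_sym. Qed.

Lemma gunion_irr G H : irreflexive (gunion_rel G H).
Proof. by case=> x /=; rewrite adj_irr. Qed.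

Definition gunion G H := SGraph (gunion_sym G H) (gunion_irr G H).

Definition bipartite_rel : rel (S + T) := fun u v =>
  match u, v with
  | inl _, inr _ | inr _, inl _ => true
  | _, _ => false
  end.

Lemma bipartite_sym : symmetric bipartite_rel.
Proof. by case=> x []. Qed.

Lemma bipartite_irr : irreflexive bipartite_rel.
Proof. by case. Qed.

Definition bipartite := SGraph bipartite_sym bipartite_irr.

End Constructions.

Arguments bipartite S T : clear implicits.

Section EqConstructions.
Variables (T : eqType).

Definition complete_rel : rel T := fun x y => x != y.

Lemma complete_sym : symmetric complete_rel.
Proof. by move=> x y; rewrite /complete_rel eq_sym. Qed.

Lemma complete_irr : irreflexive complete_rel.
Proof. by move=> x; rewrite /complete_rel eqxx. Qed.

Definition complete := SGraph complete_sym complete_irr.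

Definition gcompl_rel (G : sgraph T) : rel T :=
  fun x y => (x != y) && ~~ G x y.

Lemma gcompl_sym G : symmetric (gcompl_rel G).
Proof. by move=> x y; rewrite /gcompl_rel eq_sym adj_sym. Qed.

Lemma gcompl_irr G : irreflexive (gcompl_rel G).
Proof. by move=> x; rewrite /gcompl_rel eqxx. Qed.

Definition gcompl G := SGraph (gcompl_sym G) (gcompl_irr G).

End EqConstructions.

Arguments complete T : clear implicits.

(* [copies I G] is the disjoint union of copies of G indexed by I. *)
Section Copies.
Variables (I : eqType) (T : Type).

Definition copies_rel (G : sgraph T) : rel (I * T) :=
  fun u v => (u.1 == v.1) && G u.2 v.2.

Lemma copies_sym G : symmetric (copies_rel G).
Proof. by move=> u v; rewrite /copies_rel eq_sym adj_sym. Qed.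

Lemma copies_irr G : irreflexive (copies_rel G).
Proof. by move=> u; rewrite /copies_rel adj_irr andbF. Qed.

Definition copies G := SGraph (copies_sym G) (copies_irr G).

End Copies.

Arguments copies I {T} G.

(* The maximum is taken over the edge sets of F-free graphs on 'I_n. *)
Definition ex_number (n : nat) (F : graph_family) : nat :=
  \max_(E : {set {set 'I_n}} |
        `[< exists2 G : sgraph 'I_n, family_free F G & edges G = E >]) #|E|.

(* [EX A n F] is EX^A(n, F). *)
Definition EX (S : Type) (A : sgraph S) (n : nat) (F : graph_family) :
    set (sgraph 'I_n) :=
  [set G | [/\ family_free F G, contains G A &
    forall G' : sgraph 'I_n, family_free F G' -> contains G' A ->
      (nb_edges G' <= nb_edges G)%N]].

Definition adjmx (R : realType) (n : nat) (G : sgraph 'I_n) : 'M[R]_n :=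
  \matrix_(i, j) (G i j)%:R.

(* For n > 0 the set is finite and nonempty, as the matrix is symmetric, so *)
(* that the supremum is the largest eigenvalue.                             *)
Definition spectral_radius (R : realType) (n : nat) (G : sgraph 'I_n) : R :=
  sup [set l : R | eigenvalue (adjmx R G) l].

Definition SPEX (R : realType) (n : nat) (F : graph_family) :
    set (sgraph 'I_n) :=
  [set G | family_free F G /\ forall G' : sgraph 'I_n, family_free F G' ->
    spectral_radius R G' <= spectral_radius R G].

Arguments EX {S} A n F.
Arguments SPEX R n F : clear implicits.

(* In the cases below H and X are sequences of graphs, and "H n = A" is read *)
(* as "H n is isomorphic to A, for all n large enough".                      *)
Section Cases.
Variables (R : realType) (F : graph_family) (k : nat).
Variables (H : forall n, sgraph 'I_n) (X : forall n, sgraph 'I_(n - k)).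

Definition case_a : Prop :=
  \forall n \near \oo, isog (H n) (bipartite 'I_k 'I_(n - k)).

Definition case_b : Prop :=
  \forall n \near \oo,
    isog (H n) (gjoin (complete 'I_k) (gcompl (complete 'I_(n - k)))).

Definition case_c : Prop :=
  \forall n \near \oo,
    isog (H n) (gjoin (complete 'I_k)
      (gunion (complete 'I_2) (gcompl (complete 'I_(n - k - 2))))).

Definition join_bounded (Q : R) : Prop :=
  (\forall n \near \oo, isog (H n) (gjoin (complete 'I_k) (X n))) /\
  exists C : R, \forall n \near \oo, (nb_edges (X n))%:R <= Q * n%:R + C.

Definition case_d : Prop :=
  finite_set F /\ exists Q : R, [/\ 0 <= Q, Q < 3 / 4 & join_bounded Q].

Definition case_e : Prop :=
  finite_set F /\ exists Q : R, 3 / 4 <= Q /\ join_bounded Q.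

Definition case_f : Prop :=
  case_e /\ exists d : nat,
    (exists B : nat, \forall n \near \oo,
       (#|[set v | degree (X n) v != d]%SET| <= B)%N) /\
    ~ family_free F
        (gjoin (complete 'I_k) (copies nat (bipartite 'I_1 'I_d.+1))).

End Cases.

(* Main.v *)
(* Let G be F-free with spectral radius l >= l(H_n) >= sqrt(k(n-k)), and let x be its Perron
   vector, with maximum 1. As G has O(n) edges and any k+1 vertices have boundedly many common
   neighbours, reading l^2 x = A^2 x at the heavy vertices yields a set L of exactly k vertices
   with x close to 1, adjacent to almost all vertices, while x is small off L.

   Reattaching to exactly L all the vertices that miss a neighbour in L increases the
   quadratic form of x: the edges that are lost span a degenerate graph and carry small weights.
   If F is finite the new graph is still F-free, so in a spectrally extremal graph L is joined
   to everything. For arbitrary F the graph induced on L and its common neighbours contains a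
   biclique K_{k,m}, hence has at most e(H_{k+m}) edges, and comparing the quadratic forms of the
   reattached graph and of H_n settles (a), (b) and (c).

   In the other cases G = K_k + Y with Y of bounded degree: comparing with K_k + X, a missing
   edge in L would cost a constant, whereas the edges of X and of Y have nearly equal weights.
   For (d) and (f), the rows of A_X^2 and A_Y^2 almost all sum to the same constant q
   (respectively, to at most q for Y), and then the radius of the join is governed by the number
   of edges. For (f) q = d^2; for (d) F must exclude K_k joined to many copies of each of P_4,
   K_{1,3} and K_3, which have at least 3/4 edges per vertex, so that almost all components are
   stars K_{1,0}, K_{1,1} or K_{1,2}, and q is the largest available star size. *)

Require Import Defs.
From HB Require Import structures.
From mathcomp Require Import all_boot all_order all_algebra.
From mathcomp Require Import all_classical all_reals all_analysis.
From mathcomp Require Import lra zify.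

Set Implicit Arguments.
Unset Strict Implicit.
Unset Printing Implicit Defensive.

Import Order.TTheory GRing.Theory Num.Theory.
Import numFieldNormedType.Exports.

Local Open Scope ring_scope.
Local Open Scope set_scope.

(** The graph [G] is not known to be connected, so its Perron vector [x] may vanish somewhere, and a
    change of [G] that seems to gain may gain nothing. Every comparison therefore runs through one
    chain of inequalities: if the form of another graph [G'] at [x] is at least that of [G], while
    its radius is at most that of [G], then equality holds throughout and [x] is an eigenvector of
    [G'] too. In each [G'] that is used, [L] is joined to all other vertices, which makes [x]
    positive; only then does equality of the forms force equality of the graphs. The error $n^{1/2}$
    in (e) arises because the entries of [x] off [L] lie between $\sigma/l$ and $\sigma/(l-M)$,
    where $\sigma$ is the weight of [L]: the relative error is $O(1/l)$ with $l$ at least of order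
    $n^{1/2}$, over $O(n)$ edges. In (d) and (f) not a single edge may be lost, so weights off [L]
    are computed to second order, with a total error below 2 between two even numbers. *)

(** * Quadratic forms, Rayleigh quotients and Perron vectors *)

Definition adjop (R : realType) (T : finType) (G : sgraph T) (x : T -> R) (u : T) : R :=
  \sum_v (G u v)%:R * x v.

Definition qform (R : realType) (T : finType) (G : sgraph T) (x : T -> R) : R :=
  \sum_u \sum_v (G u v)%:R * (x u * x v).

Definition sqnorm (R : realType) (T : finType) (x : T -> R) : R := \sum_u x u ^+ 2.

Lemma sqnorm_ge0 (R : realType) (T : finType) (x : T -> R) : 0 <= sqnorm x.
Proof. by apply: sumr_ge0 => i _; exact: sqr_ge0. Qed.

Lemma sqnorm_eq0 (R : realType) (T : finType) (x : T -> R) :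
  sqnorm x = 0 -> forall u, x u = 0.
Proof.
move=> /eqP; rewrite psumr_eq0 => [/allP h u|i _]; last exact: sqr_ge0.
by apply/eqP; have := h u (mem_index_enum u); rewrite sqrf_eq0.
Qed.

Lemma qform_adjop (R : realType) (T : finType) (G : sgraph T) (x : T -> R) :
  qform G x = \sum_u x u * adjop G x u.
Proof.
apply: eq_bigr => u _; rewrite mulr_sumr; apply: eq_bigr => v _; lra.
Qed.

Lemma adjop_sym (R : realType) (T : finType) (G : sgraph T) (x y : T -> R) :
  \sum_u x u * adjop G y u = \sum_u y u * adjop G x u.
Proof.
under eq_bigr do rewrite mulr_sumr.
rewrite exchange_big /=; apply: eq_bigr => u _; rewrite mulr_sumr.
by apply: eq_bigr => v _; rewrite adj_sym; lra.
Qed.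

Lemma adjopD (R : realType) (T : finType) (G : sgraph T) (x y : T -> R) (t : R) u :
  adjop G (fun v => x v + t * y v) u = adjop G x u + t * adjop G y u.
Proof.
by rewrite /adjop mulr_sumr -big_split /=; apply: eq_bigr => v _; lra.
Qed.

Lemma qformD (R : realType) (T : finType) (G : sgraph T) (x y : T -> R) (t : R) :
  qform G (fun v => x v + t * y v) =
  qform G x + 2 * t * (\sum_u y u * adjop G x u) + t ^+ 2 * qform G y.
Proof.
rewrite !qform_adjop; set S := \sum_u y u * adjop G x u.
have -> : 2 * t * S = t * (\sum_u x u * adjop G y u) + t * S.
  by rewrite (adjop_sym G x y) -/S; lra.
rewrite !mulr_sumr -!big_split /=.
by apply: eq_bigr => u _; rewrite adjopD; lra.
Qed.

Lemma sqnormD (R : realType) (T : finType) (x y : T -> R) (t : R) :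
  sqnorm (fun v => x v + t * y v) =
  sqnorm x + 2 * t * (\sum_u y u * x u) + t ^+ 2 * sqnorm y.
Proof.
rewrite /sqnorm !mulr_sumr -!big_split /=; apply: eq_bigr => u _; lra.
Qed.

(* Second-order variation of the nonnegative form [l |y|^2 - q(y)] at its zero [x]. *)
Lemma rayleigh_max_eigen (R : realType) (T : finType) (G : sgraph T) (l : R) (x : T -> R) :
  (forall y : T -> R, qform G y <= l * sqnorm y) -> l * sqnorm x <= qform G x ->
  forall u, adjop G x u = l * x u.
Proof.
move=> hmax hx; pose r u := l * x u - adjop G x u.
suff r0 : sqnorm r = 0.
  by move=> u; have := sqnorm_eq0 r0 u; rewrite /r => /eqP; rewrite subr_eq0 => /eqP.
set s := sqnorm r; have s0 : 0 <= s := sqnorm_ge0 r.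
set c := l * sqnorm r - qform G r; have c0 : 0 <= c by rewrite subr_ge0.
have es : s = l * (\sum_u r u * x u) - \sum_u r u * adjop G x u.
  rewrite mulr_sumr -sumrB; apply: eq_bigr => u _; rewrite expr2 {2}/r; lra.
(* Moving along the residual [r] by this [t] changes the form by $2ts+t^2c=-t^2(c+2)$, which is
   negative unless $s=0$. The summand 1 keeps the denominator positive when $c=0$. *)
pose t := - s / (c + 1).
have := hmax (fun v => x v + t * r v); rewrite qformD sqnormD => ht.
have {}ht : 0 <= 2 * t * s + t ^+ 2 * c by rewrite es /c; nra.
have ct : t * (c + 1) = - s by rewrite /t mulfVK //; lra.
have : s = - t * (c + 1) by rewrite mulNr ct opprK.
have [//|] := eqVneq s 0.
rewrite neq_lt ltNge s0 /= => sp es'.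
have tn : t < 0 by rewrite /t mulNr oppr_lt0 divr_gt0 //; lra.
exfalso; move: ht; rewrite es'.
have -> : 2 * t * (- t * (c + 1)) + t ^+ 2 * c = - (t ^+ 2 * (c + 2)) by lra.
rewrite oppr_ge0 leNgt mulr_gt0 //; last by lra.
by rewrite expr2 nmulr_rgt0.
Qed.

(** The unit sphere is a closed subset of the box $[-1,1]^{n+1}$, hence compact, and the continuous
    form attains its maximum there; homogeneity extends the bound to all vectors. Row vectors serve
    here for their topology. *)
Lemma rayleigh_max_exists (R : realType) (n : nat) (G : sgraph 'I_n.+1) :
  exists l : R, exists x : 'I_n.+1 -> R,
    [/\ sqnorm x = 1, qform G x = l & forall y : 'I_n.+1 -> R, qform G y <= l * sqnorm y].
Proof.
pose f (v : 'rV[R]_n.+1) : R := qform G (v ord0).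
pose g (v : 'rV[R]_n.+1) : R := sqnorm (v ord0).
have cc i : continuous (fun v : 'rV[R]_n.+1 => v ord0 i) by exact: coord_continuous.
have addc : continuous (fun z : R * R => z.1 + z.2) by exact: add_continuous.
have csum (I : finType) (h : I -> 'rV[R]_n.+1 -> R) :
    (forall i, continuous (h i)) -> continuous (fun v => \sum_i h i v).
  move=> hc; have := @continuous_big _ _ (@GRing.add R) 0 xpredT addc _ (index_enum I) h.
  by apply=> i _; exact: hc.
have cf : continuous f.
  apply: (csum _ (fun i v => _)) => i.
  apply: (csum _ (fun j v => _)) => j.
  by move=> v; exact: (cvgM (cvg_cst (_ : R)) (cvgM (cc i v) (cc j v))).
have cg : continuous g.
  apply: (csum _ (fun i v => _)) => i.
  by move=> v; exact: (cvgM (cc i v) (cc i v)).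
pose A := (g @^-1` [set 1])%classic.
have clA : closed A by apply: preimage_closed => [v _|]; [exact: cg | exact: closed_eq].
have coA : compact A.
  have cbox := (@rV_compact R n.+1 (fun=> `[(-1), 1]%classic)
    (fun=> @segment_compact R (-1) 1)).
  apply: subclosed_compact clA cbox _ => v; rewrite /A /= => gv i.
  have hi : v ord0 i ^+ 2 <= 1.
    rewrite -gv /g /sqnorm (bigD1 i) //= lerDl; apply: sumr_ge0 => j _; exact: sqr_ge0.
  rewrite /= in_itv /= -ler_norml.
  by rewrite -(real_normK (num_real _)) in hi; rewrite -(@ler_sqr _ _ 1) ?nnegrE ?expr1n.
have A0 : (A !=set0)%classic.
  exists (\row_j (j == ord0)%:R); rewrite /A /= /g /sqnorm (bigD1 ord0) //= big1 => [|j /negbTE j0].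
    by rewrite mxE expr1n addr0.
  by rewrite mxE j0 expr0n.
have [c cA maxc] := EVT_max_rV A0 coA (continuous_subspaceT cf).
exists (f c), (c ord0); split=> //.
  by move: cA; rewrite inE.
move=> y; have := sqnorm_ge0 y; rewrite le_eqVlt => /predU1P[y0|y0].
  have yz := sqnorm_eq0 (esym y0); rewrite -y0 mulr0 /qform big1 // => u _.
  by rewrite big1 // => v _; rewrite yz mul0r mulr0.
pose s := Num.sqrt (sqnorm y); have s0 : 0 < s by rewrite sqrtr_gt0.
have s2 : s ^+ 2 = sqnorm y by rewrite sqr_sqrtr ?ltW.
pose w : 'rV[R]_n.+1 := \row_j (y j / s).
have wA : w \in A.
  rewrite inE /A /= /g /sqnorm; under eq_bigr do rewrite mxE expr_div_n.
  by rewrite -mulr_suml -/(sqnorm y) -s2 divff // expf_eq0 /= gt_eqF.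
have := maxc w wA; rewrite {1}/f -s2 -ler_pdivrMr ?exprn_gt0 //; congr (_ <= _).
rewrite /qform mulr_suml; apply: eq_bigr => u _; rewrite mulr_suml.
apply: eq_bigr => v _; rewrite !mxE expr2 invfM; lra.
Qed.

Lemma qform_abs (R : realType) (T : finType) (G : sgraph T) (x : T -> R) :
  qform G x <= qform G (fun u => `|x u|).
Proof.
apply: ler_sum => u _; apply: ler_sum => v _; rewrite -normrM.
by apply: ler_wpM2l => //; exact: ler_norm.
Qed.

Lemma sqnorm_abs (R : realType) (T : finType) (x : T -> R) :
  sqnorm (fun u => `|x u|) = sqnorm x.
Proof. by apply: eq_bigr => u _; rewrite real_normK ?num_real. Qed.

(** A Rayleigh bound [l] dominates every eigenvalue, and the eigenvector [x] shows that [l] is one,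
    so the supremum in the definition is [l]. *)
Lemma spectral_radiusE (R : realType) (n : nat) (G : sgraph 'I_n) (l : R) (x : 'I_n -> R) :
  (forall y : 'I_n -> R, qform G y <= l * sqnorm y) -> sqnorm x != 0 ->
  (forall u, adjop G x u = l * x u) -> spectral_radius R G = l.
Proof.
move=> hmax x0 hx; rewrite /spectral_radius.
have hl : eigenvalue (adjmx R G) l.
  apply/eigenvalueP; exists (\row_j x j).
    apply/rowP => j; rewrite !mxE -hx /adjop; apply: eq_bigr => i _.
    by rewrite !mxE mulrC adj_sym.
  apply: contra_neq x0 => /rowP h; rewrite /sqnorm big1 // => i _.
  by have := h i; rewrite !mxE => ->; rewrite expr0n.
have hub m : eigenvalue (adjmx R G) m -> m <= l.
  move=> /eigenvalueP[v hv v0]; pose y := v ord0.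
  have ay u : adjop G y u = m * y u.
    have /rowP/(_ u) := hv; rewrite !mxE => <-; apply: eq_bigr => i _.
    by rewrite !mxE mulrC adj_sym.
  have qy : qform G y = m * sqnorm y.
    by rewrite qform_adjop /sqnorm mulr_sumr; apply: eq_bigr => u _; rewrite ay; lra.
  have y0 : 0 < sqnorm y.
    rewrite lt_neqAle sqnorm_ge0 andbT eq_sym; apply: contra_neq v0 => /sqnorm_eq0 h.
    by apply/rowP => j; rewrite [RHS]mxE; exact: h.
  by have := hmax y; rewrite qy ler_pM2r.
apply/eqP; rewrite eq_le; apply/andP; split.
  by apply: ge_sup; [exists l | move=> m /= /hub].
by apply: ub_le_sup => //; exists l => m /= /hub.
Qed.

Lemma rayleigh (R : realType) (n : nat) (G : sgraph 'I_n) (y : 'I_n -> R) :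
  qform G y <= spectral_radius R G * sqnorm y.
Proof.
case: n G y => [|n] G y; first by rewrite /qform /sqnorm !big_ord0 mulr0.
have [l [x [nx qx hmax]]] := rayleigh_max_exists R G.
have ex u : adjop G x u = l * x u.
  by apply: rayleigh_max_eigen => //; rewrite nx mulr1 qx.
by rewrite (spectral_radiusE hmax _ ex) // nx oner_eq0.
Qed.

(** Absolute values keep the norm of a maximiser and do not lower the form, so they give a maximiser
    again, which is then divided by its largest entry. The entries are only nonnegative, since [G]
    may be disconnected. *)
Lemma perron (R : realType) (n : nat) (G : sgraph 'I_n) : (0 < n)%N ->
  exists x : 'I_n -> R, [/\ forall u, 0 <= x u <= 1, exists u, x u = 1 &
    forall u, adjop G x u = spectral_radius R G * x u].
Proof.
case: n G => // n G _.
have [l [x [nx qx hmax]]] := rayleigh_max_exists R G.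
pose a u := `|x u|.
have na : sqnorm a = 1 by rewrite sqnorm_abs.
have ea u : adjop G a u = l * a u.
  by apply: rayleigh_max_eigen => //; rewrite na mulr1 -qx qform_abs.
have -> : spectral_radius R G = l by rewrite (spectral_radiusE hmax _ ea) // na oner_eq0.
have [z _ hz] := Order.TotalTheory.arg_maxP a (isT : xpredT (ord0 : 'I_n.+1)).
have az : 0 < a z.
  rewrite lt_neqAle normr_ge0 andbT eq_sym; apply/eqP => az0.
  suff : sqnorm a = 0 by rewrite na => /eqP; rewrite oner_eq0.
  rewrite /sqnorm big1 // => u _; suff -> : a u = 0 by rewrite expr0n.
  by apply/eqP; rewrite eq_le normr_ge0 andbT -az0; exact: hz.
exists (fun u => a u / a z); split.
- by move=> u; rewrite divr_ge0 ?normr_ge0 //= ler_pdivrMr // mul1r; exact: hz.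
- by exists z; rewrite divff // gt_eqF.
- move=> u; rewrite mulrA -ea /adjop mulr_suml; apply: eq_bigr => v _; lra.
Qed.

(** * Subgraphs, isomorphisms and counts of adjacent pairs *)

Lemma pullback_sym (S T : Type) (f : S -> T) (G : sgraph T) :
  symmetric (fun x y => G (f x) (f y)).
Proof. by move=> x y; rewrite adj_sym. Qed.

Lemma pullback_irr (S T : Type) (f : S -> T) (G : sgraph T) :
  irreflexive (fun x y => G (f x) (f y)).
Proof. by move=> x; rewrite adj_irr. Qed.

Definition pullback (S T : Type) (f : S -> T) (G : sgraph T) : sgraph S :=
  SGraph (pullback_sym f G) (pullback_irr f G).

Lemma contains_trans (S T U : Type) (G : sgraph S) (H : sgraph T) (K : sgraph U) :
  contains G H -> contains H K -> contains G K.
Proof.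
move=> [f fi fh] [g gi gh]; exists (f \o g); first exact: inj_comp.
by move=> x y /gh /fh.
Qed.

Lemma contains_pullback (S T : Type) (f : S -> T) (G : sgraph T) :
  injective f -> contains G (pullback f G).
Proof. by move=> fi; exists f. Qed.

Lemma isog_contains (S T : Type) (G : sgraph S) (H : sgraph T) :
  isog G H -> contains H G.
Proof. by move=> [f /bij_inj fi fh]; exists f => // x y; rewrite fh. Qed.

Lemma isog_sym (S T : Type) (G : sgraph S) (H : sgraph T) : isog G H -> isog H G.
Proof.
move=> [f [g fK gK] fh]; exists g; first by exists f.
by move=> x y; rewrite fh !gK.
Qed.

Lemma isog_trans (S T U : Type) (G : sgraph S) (H : sgraph T) (K : sgraph U) :
  isog G H -> isog H K -> isog G K.
Proof.
move=> [f fb fh] [g gb gh]; exists (g \o f); first exact: bij_comp.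
by move=> x y; rewrite fh gh.
Qed.

Lemma isog_pullback (S T : Type) (f : S -> T) (G : sgraph T) :
  bijective f -> isog (pullback f G) G.
Proof. by move=> fb; exists f. Qed.

Lemma family_free_sub (F : graph_family) (S T : Type) (G : sgraph S) (H : sgraph T) :
  contains G H -> family_free F G -> family_free F H.
Proof. by move=> GH fG A FA HA; apply: (fG A FA); exact: contains_trans HA. Qed.

(** Counts ordered pairs, so an edge inside both sets counts twice. This makes the count additive in
    each argument and equal to the value of the quadratic form on indicator vectors. *)
Definition vol (T : finType) (G : sgraph T) (S S' : {set T}) : nat :=
  (\sum_(u in S) \sum_(v in S') G u v)%N.

Lemma vol_set1l (T : finType) (G : sgraph T) (u : T) (S : {set T}) :
  vol G [set u] S = (\sum_(v in S) G u v)%N.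
Proof. by rewrite /vol big_set1. Qed.

Lemma volC (T : finType) (G : sgraph T) (S S' : {set T}) : vol G S S' = vol G S' S.
Proof.
rewrite /vol exchange_big /=; apply: eq_bigr => u _; apply: eq_bigr => v _.
by rewrite adj_sym.
Qed.

Lemma volUl (T : finType) (G : sgraph T) (S1 S2 S' : {set T}) :
  [disjoint S1 & S2] -> vol G (S1 :|: S2) S' = (vol G S1 S' + vol G S2 S')%N.
Proof.
move=> d; rewrite /vol (eq_bigl [predU S1 & S2]) ?bigU //=.
by move=> u; rewrite !inE.
Qed.

Lemma volUr (T : finType) (G : sgraph T) (S1 S2 S' : {set T}) :
  [disjoint S1 & S2] -> vol G S' (S1 :|: S2) = (vol G S' S1 + vol G S' S2)%N.
Proof. by move=> d; rewrite volC volUl // !(volC _ S'). Qed.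

Lemma volS (T : finType) (G : sgraph T) (S1 S2 S1' S2' : {set T}) :
  S1 \subset S2 -> S1' \subset S2' -> (vol G S1 S1' <= vol G S2 S2')%N.
Proof.
move=> s s'; rewrite /vol.
apply: (@leq_trans (\sum_(u in S2) \sum_(v in S1') G u v)).
  by rewrite [leqRHS](big_setID S1) /= (finset.setIidPr s) leq_addr.
by apply: leq_sum => u _; rewrite [leqRHS](big_setID S1') /= (finset.setIidPr s') leq_addr.
Qed.

Lemma vol_le_card (T : finType) (G : sgraph T) (S S' : {set T}) :
  (vol G S S' <= #|S| * #|S'|)%N.
Proof.
rewrite /vol -sum_nat_const; apply: leq_sum => u _.
by rewrite -sum1_card; apply: leq_sum => v _; case: (G u v).
Qed.

Lemma degreeE (T : finType) (G : sgraph T) (u : T) : degree G u = (\sum_v G u v)%N.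
Proof.
rewrite /degree -sum1_card [RHS]big_mkcond [LHS]big_mkcond; apply: eq_bigr => v _.
by rewrite inE; case: (G u v).
Qed.

Lemma volT_degree (T : finType) (G : sgraph T) :
  vol G [set: T] [set: T] = (\sum_u degree G u)%N.
Proof.
rewrite /vol; apply: eq_big => [u|u _]; first by rewrite inE.
by rewrite degreeE; apply: eq_bigl => v; rewrite inE.
Qed.

(** Ordered adjacent pairs are grouped by their underlying set; the fibre over the edge $\{a,b\}$
    consists of [(a, b)] and [(b, a)]. *)
Lemma handshake (T : finType) (G : sgraph T) :
  vol G [set: T] [set: T] = (2 * nb_edges G)%N.
Proof.
rewrite /vol; under eq_bigr do under eq_bigl do rewrite inE.
under eq_bigl do rewrite inE.
rewrite pair_bigA /= (eq_bigr (fun p => if G p.1 p.2 then 1%N else 0%N)); last first.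
  by move=> p _; case: (G _ _).
rewrite -big_mkcond /= (partition_big (fun p : T * T => [set p.1; p.2]) (mem (edges G))) /=; last first.
  move=> p Gp; rewrite inE; apply/existsP; exists p.1; apply/existsP; exists p.2.
  by rewrite Gp eqxx.
rewrite /nb_edges mulnC -sum_nat_const; apply: eq_bigr => e; rewrite inE.
move=> /existsP[a /existsP[b /andP[Gab /eqP ->]]].
have ab : a != b by apply: contraTneq Gab => ->; rewrite adj_irr.
rewrite (bigD1 (a, b)) /=; last by rewrite Gab eqxx.
rewrite (bigD1 (b, a)) /=; last first.
  by rewrite adj_sym Gab finset.setUC eqxx /=; apply: contra ab => /eqP[->].
rewrite big1 // => -[c d] /= /andP[/andP[/andP[Gcd /eqP E] n1] n2].
have cd : c != d by apply: contraTneq Gcd => ->; rewrite adj_irr.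
have: c \in [set a; b] by rewrite -E !inE eqxx.
have: d \in [set a; b] by rewrite -E !inE eqxx orbT.
rewrite !inE => /orP[]/eqP ed /orP[]/eqP ec; subst c d.
- by rewrite eqxx in cd.
- by rewrite eqxx in n2.
- by rewrite eqxx in n1.
- by rewrite eqxx in cd.
Qed.

Lemma vol_pullback (S T : finType) (f : S -> T) (G : sgraph T) (A B : {set S}) :
  injective f -> vol (pullback f G) A B = vol G (f @: A) (f @: B).
Proof.
move=> fi; rewrite /vol big_imset /=; last by move=> ? ? _ _; exact: fi.
apply: eq_bigr => u _; rewrite big_imset //=; by move=> ? ? _ _; exact: fi.
Qed.

Lemma imset_bij_setT (S T : finType) (f : S -> T) : bijective f -> f @: [set: S] = [set: T].
Proof.
move=> [g fK gK]; apply/finset.setP => y; rewrite finset.inE; apply/imsetP.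
by exists (g y); rewrite ?finset.inE ?gK.
Qed.

Lemma isog_vol (S T : finType) (G : sgraph S) (H : sgraph T) :
  isog G H -> vol G [set: S] [set: S] = vol H [set: T] [set: T].
Proof.
move=> [f fb fh]; rewrite -(imset_bij_setT fb) -(vol_pullback _ _ _ (bij_inj fb)).
by apply: eq_bigr => u _; apply: eq_bigr => v _; rewrite fh.
Qed.

Lemma isog_spectral_radius (R : realType) (n : nat) (G H : sgraph 'I_n) :
  isog G H -> spectral_radius R G = spectral_radius R H.
Proof.
have le (G' H' : sgraph 'I_n) :
    isog G' H' -> spectral_radius R G' <= spectral_radius R H'.
  move=> [f [g fK gK] fh]; have gb : bijective g by exists f.
  have [n0|n0] := posnP n.
    rewrite /spectral_radius; have -> // : adjmx R G' = adjmx R H'.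
    by subst n; apply/matrixP => -[].
  have [x [x01 [z xz] hx]] := perron R G' n0.
  have x0 : 0 < sqnorm x.
    rewrite lt_neqAle sqnorm_ge0 andbT eq_sym; apply/eqP => /sqnorm_eq0 /(_ z) /eqP.
    by rewrite xz oner_eq0.
  have <- : spectral_radius R G' * sqnorm x / sqnorm x = spectral_radius R G'.
    by rewrite mulfK // gt_eqF.
  rewrite ler_pdivrMr //.
  have -> : spectral_radius R G' * sqnorm x = qform G' x.
    rewrite qform_adjop /sqnorm mulr_sumr; apply: eq_bigr => u _; rewrite hx; lra.
  have <- : sqnorm (x \o g) = sqnorm x.
    by rewrite /sqnorm [RHS](reindex g) //; exact: onW_bij.
  have <- : qform H' (x \o g) = qform G' x.
    rewrite /qform [RHS](reindex g) /=; last exact: onW_bij.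
    apply: eq_bigr => u _; rewrite [RHS](reindex g) /=; last exact: onW_bij.
    by apply: eq_bigr => v _; rewrite fh !gK.
  exact: rayleigh.
by move=> GH; apply/eqP; rewrite eq_le !le //; exact: isog_sym.
Qed.

(** * Sparsity and few common neighbours, from the hypotheses on the family *)

Lemma leq_ex_number (F : graph_family) (n : nat) (G : sgraph 'I_n) :
  family_free F G -> (nb_edges G <= ex_number n F)%N.
Proof.
move=> fG; rewrite /ex_number /nb_edges; apply: (leq_bigmax_cond (edges G)).
by apply/asboolP; exists G.
Qed.

Lemma vol_induced_le (F : graph_family) (T : finType) (G : sgraph T) (S : {set T}) :
  family_free F G -> (vol G S S <= 2 * ex_number #|S| F)%N.
Proof.
move=> fG; pose f (i : 'I_#|S|) := enum_val i.
have fi : injective f by exact: enum_val_inj.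
have -> : vol G S S = vol (pullback f G) [set: _] [set: _].
  rewrite vol_pullback //; suff -> : f @: [set: 'I_#|S|] = S by [].
  apply/finset.setP => v; apply/imsetP/idP => [[i _ ->]|vS]; first exact: enum_valP.
  by exists (enum_rank_in vS v); rewrite ?finset.inE // /f enum_rankK_in.
rewrite handshake leq_pmul2l //; apply: leq_ex_number.
exact: family_free_sub (contains_pullback _ fi) fG.
Qed.

(** The linear bound is applied to every induced subgraph. It is available only from some order [N]
    on; a smaller set [S] spans at most $|S|^2\le N|S|$ ordered pairs, whence the summand [N] in the
    constant. *)
Lemma sparse_of_ex (R : realType) (F : graph_family) :
  ((fun n : nat => (ex_number n F)%:R : R^o) =O_\oo (fun n : nat => n%:R : R^o))%classic ->
  exists C : nat, forall (T : finType) (G : sgraph T), family_free F G ->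
    forall S : {set T}, (vol G S S <= C * #|S|)%N.
Proof.
move=> /eqO_exP[c c0 [N _ hN]].
have [c' hc'] : exists c' : nat, c <= c'%:R.
  by exists (Num.bound c); apply/ltW/archi_boundP/ltW.
exists (2 * c' + N)%N => T G fG S.
have [ltN|geN] := ltnP #|S| N.
  apply: leq_trans (vol_le_card _ _ _) _; rewrite leq_mul2r; apply/orP; right; lia.
have := hN #|S| geN; rewrite /= !normr_nat => h.
have h2 : (ex_number #|S| F <= c' * #|S|)%N.
  rewrite -(ler_nat R) natrM; apply: le_trans h _; exact: ler_wpM2r.
have := vol_induced_le S fG; nia.
Qed.

Definition common_nbrs (T : finType) (G : sgraph T) (S : {set T}) : {set T} :=
  [set v | [forall u in S, G u v]].

Lemma common_nbrsP (T : finType) (G : sgraph T) (S : {set T}) (v : T) :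
  reflect (forall u, u \in S -> G u v) (v \in common_nbrs G S).
Proof. by rewrite inE; apply: (iffP forall_inP). Qed.

Lemma common_nbrs_disjoint (T : finType) (G : sgraph T) (S : {set T}) :
  [disjoint S & common_nbrs G S].
Proof.
apply/pred0P => v /=; apply/negP => /andP[vS /common_nbrsP/(_ v vS)].
by rewrite adj_irr.
Qed.

(* The excluded graph sits inside some [K_(k0+1,oo)] with [k0] minimal, so that the bound
   does not depend on [k]. *)
Lemma few_common_nbrs (F : graph_family) :
  exists M : nat, forall k : nat, ~ family_free F (bipartite 'I_k.+1 nat) ->
    forall (T : finType) (G : sgraph T), family_free F G ->
    forall S : {set T}, (k < #|S|)%N -> (#|common_nbrs G S| < M)%N.
Proof.
pose P (k : nat) := `[< ~ family_free F (bipartite 'I_k.+1 nat) >].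
have [[k1 hk1]|noP] := pselect (exists k, P k); last first.
  by exists 0%N => k hk; case: noP; exists k; apply/asboolP.
have [k0 /asboolP hk0 mink0] := ex_minnP (ex_intro _ k1 hk1).
have [A [FA [f fi fh]]] : exists A, F A /\ contains (bipartite 'I_k0.+1 nat) (projT2 A).
  by apply: contrapT => h; apply: hk0 => A FA cA; apply: h; exists A.
exists (projT1 A) => k hk T G fG S ltkS; rewrite ltnNge; apply/negP => leAW.
have lek : (k0 <= k)%N by apply: mink0; apply/asboolP.
have [s0 s0S] : exists s0, s0 \in S by apply/card_gt0P; exact: leq_ltn_trans ltkS.
pose W := common_nbrs G S.
(* A vertex sent to the finite side keeps its position there. One sent to the infinite side goes to
   the common neighbour numbered by its own index, which is injective because [W] has at least as
   many elements as the excluded graph has vertices. *)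
pose g (i : 'I_(projT1 A)) : T :=
  match f i with inl a => nth s0 (enum S) a | inr _ => nth s0 (enum W) i end.
have gS i a : f i = inl a -> g i \in S.
  move=> fia; rewrite /g fia -mem_enum mem_nth // -cardE.
  by apply: leq_trans ltkS; apply: leq_trans (ltn_ord a) _; rewrite ltnS.
have gW i b : f i = inr b -> g i \in W.
  move=> fib; rewrite /g fib -mem_enum mem_nth // -cardE.
  exact: leq_trans (ltn_ord i) leAW.
have SW u : u \in S -> u \in W -> False.
  by move=> uS uW; have /pred0P/(_ u) := common_nbrs_disjoint G S; rewrite /= uS uW.
apply: (fG A FA); exists g.
  move=> i j; case fiE: (f i) => [a|b]; case fjE: (f j) => [a'|b'].
  - rewrite /g fiE fjE => /eqP; rewrite nth_uniq ?enum_uniq -?cardE //; first last.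
    + by apply: leq_trans ltkS; apply: leq_trans (ltn_ord _) _; rewrite ltnS.
    + by apply: leq_trans ltkS; apply: leq_trans (ltn_ord _) _; rewrite ltnS.
    by move=> /eqP aa; apply: fi; rewrite fiE fjE; congr inl; exact: val_inj.
  - by move=> E; have := gS _ _ fiE; rewrite E => /SW; case/(_ (gW _ _ fjE)).
  - by move=> E; have := gS _ _ fjE; rewrite -E => /SW; case/(_ (gW _ _ fiE)).
  - rewrite /g fiE fjE => /eqP; rewrite nth_uniq ?enum_uniq -?cardE //.
    + by move=> /eqP; exact: val_inj.
    + exact: leq_trans (ltn_ord i) leAW.
    + exact: leq_trans (ltn_ord j) leAW.
move=> i j /fh; case fiE: (f i) => [a|b]; case fjE: (f j) => [a'|b'] //= _.
  by have /common_nbrsP := gW _ _ fjE; apply; exact: gS fiE.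
by rewrite adj_sym; have /common_nbrsP := gW _ _ fiE; apply; exact: gS fjE.
Qed.

(** * Vertices of large weight in an eigenvector of a sparse graph *)

Lemma natr_sum_adj (R : realType) (T : finType) (G : sgraph T) (S S' : {set T}) :
  \sum_(u in S) \sum_(v in S') (G u v)%:R = (vol G S S')%:R :> R.
Proof. by rewrite natr_sum; apply: eq_bigr => u _; rewrite natr_sum. Qed.

Lemma natr_degree (R : realType) (T : finType) (G : sgraph T) (u : T) :
  \sum_v (G u v)%:R = (degree G u)%:R :> R.
Proof. by rewrite degreeE natr_sum. Qed.

Lemma natr_card (R : realType) (T : finType) (S : {set T}) :
  \sum_(u in S) 1 = #|S|%:R :> R.
Proof. by rewrite sumr_const. Qed.

Definition sparse (C : nat) (T : finType) (G : sgraph T) :=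
  forall S : {set T}, (vol G S S <= C * #|S|)%N.

Lemma sparse_degree_sum (R : realType) (C : nat) (T : finType) (G : sgraph T) :
  sparse C G -> \sum_u (degree G u)%:R <= C%:R * #|T|%:R :> R.
Proof.
move=> /(_ [set: T]); rewrite volT_degree cardsT => h.
by rewrite -natr_sum -natrM ler_nat.
Qed.

Definition heavy (R : realType) (T : finType) (x : T -> R) (a : R) : {set T} :=
  [set v | a <= x v].

Definition eigvec01 (R : realType) (T : finType) (G : sgraph T) (x : T -> R) (l : R) :=
  (forall u, 0 <= x u <= 1) /\ (forall u, adjop G x u = l * x u).

(** All entries are at most 1, so $l x_v\le\deg v$; summing over the heavy vertices leaves at most
    the total degree. *)
Lemma heavy_card_le (R : realType) (C : nat) (T : finType) (G : sgraph T) (x : T -> R)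
    (l a : R) :
  sparse C G -> eigvec01 G x l -> 0 <= l ->
  l * a * #|heavy x a|%:R <= C%:R * #|T|%:R.
Proof.
move=> sp [x01 ex] l0; apply: le_trans (sparse_degree_sum R sp).
rewrite -natr_card mulr_sumr [leRHS](bigID (mem (heavy x a))) /=.
rewrite ler_wpDr //; first by apply: sumr_ge0.
apply: ler_sum => v; rewrite inE mulr1 => av.
apply: le_trans (_ : l * x v <= _); first exact: ler_wpM2l.
rewrite -ex -natr_degree; apply: ler_sum => w _.
by rewrite ler_piMr //; have /andP[] := x01 w.
Qed.

(** In $l^2x=A^2x$, endpoints lighter than [b] contribute at most [b] for each ordered adjacent pair
    of the whole graph, hence $bC|T|$ in all. *)
Lemma two_step_le (R : realType) (C : nat) (T : finType) (G : sgraph T) (x : T -> R)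
    (l b : R) (v : T) :
  sparse C G -> eigvec01 G x l -> 0 <= b ->
  l ^+ 2 * x v <= b * C%:R * #|T|%:R +
    \sum_u (G v u)%:R * (\sum_(w in heavy x b) (G u w)%:R * x w).
Proof.
move=> sp [x01 ex] b0.
have -> : l ^+ 2 * x v =
    \sum_u (G v u)%:R * (\sum_(w in heavy x b) (G u w)%:R * x w) +
    \sum_u (G v u)%:R * (\sum_(w in ~: heavy x b) (G u w)%:R * x w).
  rewrite expr2 -mulrA -ex mulr_sumr -big_split /=; apply: eq_bigr => u _.
  rewrite mulrCA -ex -mulrDr; congr (_ * _).
  rewrite /adjop (bigID (mem (heavy x b))) /=; congr (_ + _).
  by apply: eq_bigl => w; rewrite !inE.
rewrite addrC lerD2r -mulrA.
apply: le_trans (_ : b * (\sum_u (degree G u)%:R) <= _); last first.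
  by rewrite ler_wpM2l // sparse_degree_sum.
rewrite mulr_sumr; apply: ler_sum => u _.
apply: le_trans (_ : \sum_(w in ~: heavy x b) (G u w)%:R * x w <= _).
  apply: ler_piMl; last by case: (G v u).
  by apply: sumr_ge0 => w _; rewrite mulr_ge0 //; have /andP[] := x01 w.
rewrite -natr_degree mulr_sumr [leRHS](bigID (mem (~: heavy x b))) /= ler_wpDr //.
  by apply: sumr_ge0 => w _; rewrite mulr_ge0.
by apply: ler_sum => w; rewrite !inE -ltNge => /ltW xw; rewrite mulrC ler_wpM2r.
Qed.

(** Two-step walks from [v] to heavy vertices correspond to adjacent pairs between the neighbourhood
    of [v] and the heavy set, and sparsity applies to the union of these two sets. *)
Lemma two_step_degree (R : realType) (C : nat) (T : finType) (G : sgraph T) (x : T -> R)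
    (l b : R) (v : T) :
  sparse C G -> eigvec01 G x l -> 0 <= b ->
  l ^+ 2 * x v <=
    C%:R * (b * #|T|%:R + (degree G v)%:R + #|heavy x b|%:R).
Proof.
move=> sp ev b0; apply: le_trans (two_step_le v sp ev b0) _.
rewrite -addrA mulrDr mulrCA mulrA lerD2l.
set N := [set u | G v u]; set H := heavy x b.
have hN : degree G v = #|N| by [].
apply: le_trans (_ : (vol G N H)%:R <= _).
  rewrite -natr_sum_adj [leRHS]big_mkcond; apply: ler_sum => u _.
  rewrite inE; case: (G v u); rewrite ?mul0r // mul1r; apply: ler_sum => w _.
  by apply: ler_piMr => //; have /andP[] := ev.1 w.
rewrite hN -natrD -natrM ler_nat.
apply: leq_trans (_ : vol G (N :|: H) (N :|: H) <= _)%N.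
  by apply: volS; rewrite ?finset.subsetUl ?finset.subsetUr.
by apply: leq_trans (sp _) _; rewrite leq_mul2l cardsU leq_subr orbT.
Qed.

(** Two thresholds are used. As [l] is large, only a small fraction of the vertices exceed the tiny
    weight [b], so the two-step bound forces each vertex of weight at least [a] to have degree
    linear in the order. With linearly many edges there are boundedly many such vertices. *)
Lemma heavy_bounded (R : realType) (C k : nat) (a : R) : (0 < k)%N -> 0 < a ->
  exists n0 : nat, exists b : nat,
  forall (T : finType) (G : sgraph T) (x : T -> R) (l : R), (n0 <= #|T|)%N ->
    sparse C G -> eigvec01 G x l -> 0 <= l -> k%:R * (#|T|%:R - k%:R) <= l ^+ 2 ->
    (#|heavy x a| <= b)%N.
Proof.
move=> k0 a0; pose c : R := C%:R + 1; have c0 : 1 <= c by rewrite lerDr.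
(* For a vertex of weight at least [a] the left side of the two-step bound is at least $an/2$. This
   [b] lets the light endpoints cost $an/8$, and [L] lets the vertices above [b] cost another
   $an/8$; the degree accounts for the remaining $an/4$. *)
pose b := a / (8 * c); have b0 : 0 < b by rewrite divr_gt0 //; lra.
pose L := 8 * c ^+ 2 / (a * b).
have cp : 0 < c by lra.
have Lp : 0 < L by rewrite /L divr_gt0 // mulr_gt0 // exprn_gt0.
exists (maxn (2 * k) (Num.bound (2 * L ^+ 2))).+1.
exists (Num.bound (4 * c ^+ 2 / a)) => T G x l; rewrite gtn_max => /andP[n2k nL] sp ev l0 hl.
set n : R := #|T|%:R.
have kn : 2 * k%:R <= n by rewrite -natrM ler_nat ltnW.
have Ln : 2 * L ^+ 2 <= n.
  apply: ltW; apply: lt_le_trans (archi_boundP _) _; first by rewrite mulr_ge0 ?sqr_ge0.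
  by rewrite ler_nat ltnW.
have k1 : 1 <= k%:R :> R by rewrite ler1n.
have n0 : 0 < n by lra.
have hl2 : n / 2 <= l ^+ 2.
  apply: le_trans hl; nra.
have lL : L <= l.
  rewrite -ler_sqr ?nnegrE ?(ltW Lp) //; lra.
have lp : 0 < l by exact: lt_le_trans lL.
have hb : c * #|heavy x b|%:R <= a * n / 8.
  have h1 := heavy_card_le b sp ev l0.
  have h2 : 8 * c ^+ 2 = L * (a * b) by rewrite /L mulfVK // mulf_neq0 // gt_eqF.
  rewrite -/n in h1.
  have h3 : l * b * #|heavy x b|%:R <= c * n by apply: le_trans h1 _; rewrite ler_pM2r // lerDl.
  have h4 : L * b * #|heavy x b|%:R <= c * n.
    by apply: le_trans h3; rewrite ler_wpM2r // ler_pM2r.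
  have h5 : 8 * c ^+ 2 * #|heavy x b|%:R <= a * (c * n).
    rewrite h2; have -> : L * (a * b) * #|heavy x b|%:R = a * (L * b * #|heavy x b|%:R) by lra.
    by rewrite ler_pM2l.
  have : c * (8 * (c * #|heavy x b|%:R)) <= c * (a * n) by lra.
  rewrite ler_pM2l; lra.
have hd v : v \in heavy x a -> a * n / 4 <= c * (degree G v)%:R.
  rewrite inE => av.
  have h1 := two_step_degree v sp ev (ltW b0).
  have h2 : a * (n / 2) <= l ^+ 2 * x v.
    rewrite mulrC; apply: ler_pM => //; lra.
  have h3 : l ^+ 2 * x v <= c * (b * n + (degree G v)%:R + #|heavy x b|%:R).
    apply: le_trans h1 _; rewrite ler_wpM2r ?lerDl // !addr_ge0 //.
    by rewrite mulr_ge0 // ltW.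
  have h4 : c * (b * n) = a * n / 8.
    have cb : c * b = a / 8 by rewrite /b invfM mulrCA (mulrCA c) mulfV ?mulr1 // gt_eqF.
    by rewrite mulrA cb; lra.
  lra.
have : #|heavy x a|%:R * (a * n / 4) <= c * (c * n).
  apply: le_trans (_ : \sum_(v in heavy x a) c * (degree G v)%:R <= _).
    by rewrite -natr_card mulr_suml; apply: ler_sum => v /hd; rewrite mul1r.
  rewrite -mulr_sumr ler_pM2l; last by lra.
  apply: le_trans (_ : \sum_v (degree G v)%:R <= _).
    rewrite [leRHS](bigID (mem (heavy x a))) /= lerDl; exact: sumr_ge0.
  by apply: le_trans (sparse_degree_sum R sp) _; rewrite ler_pM2r // lerDl.
move=> h; rewrite -(ler_nat R); apply: ltW.
apply: le_lt_trans (archi_boundP _); last by rewrite divr_ge0 ?mulr_ge0 ?sqr_ge0 // ltW.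
rewrite ler_pdivlMr //.
have : n * (#|heavy x a|%:R * a) <= n * (4 * c ^+ 2) by lra.
by rewrite ler_pM2l.
Qed.

(** A vertex with more than [k] neighbours in [H] is a common neighbour of some subset of [H] of
    that size; there are at most $2^{|H|}$ subsets, each with fewer than [M] common neighbours. *)
Lemma crowded_card (M k : nat) (T : finType) (G : sgraph T) (H : {set T}) :
  (forall S : {set T}, (k < #|S|)%N -> (#|common_nbrs G S| < M)%N) ->
  (#|[set u | (k < #|[set w in H | G u w]|)%N]| <= 2 ^ #|H| * M)%N.
Proof.
move=> hM; pose P := [set S in powerset H | (k < #|S|)%N].
apply: (@leq_trans #|\bigcup_(S in P) common_nbrs G S|).
  apply/subset_leq_card/fintype.subsetP => u; rewrite inE => hu.
  apply/bigcupP; exists [set w in H | G u w].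
    rewrite !inE hu andbT; apply/fintype.subsetP => w; by rewrite inE => /andP[].
  by apply/common_nbrsP => w; rewrite inE adj_sym => /andP[].
apply: (@leq_trans (\sum_(S in P) #|common_nbrs G S|)).
  elim/big_rec2: _ => [|S a B _ le]; first by rewrite cards0.
  by apply: leq_trans (leq_card_setU _ _) _; rewrite leq_add2l.
apply: (@leq_trans (\sum_(S in P) M)).
  by apply: leq_sum => S; rewrite inE => /andP[_ /hM /ltnW].
rewrite sum_nat_const leq_mul2r -card_powerset; apply/orP; right.
by apply/subset_leq_card/fintype.subsetP => S; rewrite inE => /andP[].
Qed.

Lemma common_nbrs_card (T : finType) (G : sgraph T) (S : {set T}) :
  (#|T| <= #|common_nbrs G S| + \sum_(u in S) (#|T| - degree G u))%N.
Proof.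
rewrite -(cardsC (common_nbrs G S)) leq_add2l.
apply: (@leq_trans #|\bigcup_(u in S) ~: [set v | G u v]|).
  apply/subset_leq_card/fintype.subsetP => v; rewrite !inE negb_forall_in.
  by move=> /exists_inP[u uS nG]; apply/bigcupP; exists u => //; rewrite !inE.
rewrite cardsC; elim/big_rec2: _ => [|u a B _ le]; first by rewrite cards0.
apply: leq_trans (leq_card_setU _ _) _; apply: leq_add => //.
by rewrite /degree -(cardsC [set v | G u v]) addKn.
Qed.

Definition weight_in (R : realType) (T : finType) (G : sgraph T) (x : T -> R)
    (H : {set T}) (u : T) : R := \sum_(w in H) (G u w)%:R * x w.

Lemma weight_in_card (R : realType) (T : finType) (G : sgraph T) (x : T -> R)
    (H : {set T}) (u : T) :
  weight_in G x H u = \sum_(w in [set w in H | G u w]) x w.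
Proof.
rewrite /weight_in big_mkcond [RHS]big_mkcond; apply: eq_bigr => w _; rewrite inE.
by case: (w \in H) => //=; case: (G u w); rewrite ?mul1r ?mul0r.
Qed.

Lemma weight_in_le (R : realType) (T : finType) (G : sgraph T) (x : T -> R)
    (H : {set T}) (u : T) :
  (forall u, 0 <= x u <= 1) -> weight_in G x H u <= #|[set w in H | G u w]|%:R.
Proof.
move=> x01; rewrite weight_in_card -natr_card; apply: ler_sum => w _.
by have /andP[] := x01 w.
Qed.

(** Intermediate vertices with more than [k] heavy neighbours are bounded in number and cost only a
    constant. Each remaining one carries weight at most [k], which is what makes $l^2\approx kn$
    nearly tight. *)
Lemma two_step_crowded (R : realType) (C M k b : nat) (T : finType) (G : sgraph T)
    (x : T -> R) (l a : R) (v : T) :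
  sparse C G -> (forall S : {set T}, (k < #|S|)%N -> (#|common_nbrs G S| < M)%N) ->
  eigvec01 G x l -> 0 <= a -> (#|heavy x a| <= b)%N ->
  l ^+ 2 * x v <= a * C%:R * #|T|%:R + (2 ^ b * M * b)%:R +
    \sum_(u | G v u && (#|[set w in heavy x a | G u w]| <= k)%N) weight_in G x (heavy x a) u.
Proof.
move=> sp hM ev a0 hb; apply: le_trans (two_step_le v sp ev a0) _.
rewrite -addrA lerD2l; set H := heavy x a.
pose bad := [set u | (k < #|[set w in H | G u w]|)%N].
rewrite (bigID (mem bad)) /=; apply: lerD.
  apply: le_trans (_ : \sum_(u in bad) b%:R <= _).
    apply: ler_sum => u _; rewrite -/(weight_in G x H u).
    have h1 := weight_in_le G H u ev.1.
    have h2 : #|[set w in H | G u w]|%:R <= b%:R :> R.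
      rewrite ler_nat; apply: leq_trans hb; apply/subset_leq_card/fintype.subsetP => w.
      by rewrite inE => /andP[].
    by case: (G v u); rewrite ?mul0r // mul1r; lra.
  rewrite -natr_sum ler_nat sum_nat_const leq_mul2r; apply/orP; right.
  apply: leq_trans (crowded_card H hM) _.
  by rewrite leq_mul2r leq_exp2l // hb orbT.
rewrite le_eqVlt; apply/orP; left; apply/eqP.
rewrite big_mkcond [RHS]big_mkcond; apply: eq_bigr => u _; rewrite inE -leqNgt.
rewrite -/(weight_in G x H u).
by case: (G v u) => /=; case: ifP => //; rewrite ?mul1r ?mul0r.
Qed.

(* [L] consists of the [k] vertices of large degree; everything else follows from the
   equation [l^2 x = A^2 x] read at the vertices of weight close to [1]. *)
Lemma structure (R : realType) (C M k : nat) (eta : R) :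
  (0 < k)%N -> 0 < eta -> eta * (4 * k.+1%:R) <= 1 ->
  exists n0 : nat, forall (T : finType) (G : sgraph T) (x : T -> R) (l : R),
    (n0 <= #|T|)%N -> sparse C G ->
    (forall S : {set T}, (k < #|S|)%N -> (#|common_nbrs G S| < M)%N) ->
    eigvec01 G x l -> 0 <= l -> k%:R * (#|T|%:R - k%:R) <= l ^+ 2 ->
    (exists z, x z = 1) ->
  exists L : {set T}, [/\ #|L| = k, forall u, u \in L -> 1 - eta <= x u,
    forall u, u \notin L -> x u <= 7 * k%:R * eta &
    #|T|%:R * (1 - 2 * k%:R * eta) <= #|common_nbrs G L|%:R].
Proof.
(* With this [a] the light endpoints cost at most $\eta n/8$. All additive constants are collected
   in [E], which is also at most $\eta n/8$ once the order is large. *)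
move=> k0 e0 ek; pose a : R := eta / (8 * (C%:R + 1)).
have c0 : 0 < C%:R + 1 :> R by rewrite ltr_wpDl.
have a0 : 0 < a by rewrite divr_gt0 // mulr_gt0.
have aC : a * C%:R <= eta / 8.
  have : a * (C%:R + 1) = eta / 8 by rewrite /a invfM mulrA mulfVK // gt_eqF.
  lra.
have [n1 [b hb]] := heavy_bounded C k0 a0.
pose K : nat := (2 ^ b * M * b)%N.
pose E : nat := (K + k ^ 2 + k * M + M + k + 1)%N.
exists (maxn n1 (Num.bound (8 * E%:R / eta))).
move=> T G x l; rewrite geq_max => /andP[nn1 nnE] sp hM ev l0 hl [z xz].
have {}hb := hb T G x l nn1 sp ev l0 hl.
have x01 := ev.1.
set n : R := #|T|%:R in hl *.
have En : 8 * E%:R <= eta * n.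
  rewrite [leRHS]mulrC -ler_pdivrMr //; apply: ltW; apply: lt_le_trans (archi_boundP _) _.
    by apply: divr_ge0; [rewrite mulr_ge0 | exact: ltW].
  by rewrite ler_nat.
have ER : E%:R = K%:R + k%:R ^+ 2 + k%:R * M%:R + M%:R + k%:R + 1 :> R.
  by rewrite /E !natrD natrX natrM.
have k1 : 1 <= k%:R :> R by rewrite ler1n.
have kS : k.+1%:R = k%:R + 1 :> R by rewrite -natr1.
rewrite kS in ek.
have M0 : 0 <= M%:R :> R by [].
have K0 : 0 <= K%:R :> R by [].
have kM0 : 0 <= k%:R * M%:R :> R by [].
have k2 : 0 <= k%:R ^+ 2 :> R by exact: sqr_ge0.
have ke : k%:R * eta <= 1 / 4 by lra.
have e1 : eta <= 1 / 8 by nra.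
have n0 : 0 < n.
  by have : 0 < eta * n by [lra]; rewrite pmulr_rgt0.
set H := heavy x a in hb.
pose good u := (#|[set w in H | G u w]| <= k)%N.
have key v : l ^+ 2 * x v <= eta / 8 * n + K%:R + \sum_(u | G v u && good u) weight_in G x H u.
  apply: le_trans (two_step_crowded v sp hM ev (ltW a0) hb) _.
  by rewrite !lerD2r ler_pM2r.
have wk u : good u -> weight_in G x H u <= k%:R.
  by move=> gu; apply: le_trans (weight_in_le G H u x01) _; rewrite ler_nat.
have cardN v : \sum_(u | G v u && good u) (1 : R) <= (degree G v)%:R.
  rewrite -natr_degree [leRHS](bigID (fun u => G v u && good u)) /=.
  rewrite ler_wpDr //; first exact: sumr_ge0.
  by apply: ler_sum => u /andP[-> _].
have keyd v : l ^+ 2 * x v <= eta / 8 * n + K%:R + k%:R * (degree G v)%:R.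
  apply: le_trans (key v) _; rewrite lerD2l.
  apply: le_trans (_ : k%:R * \sum_(u | G v u && good u) (1 : R) <= _).
    by rewrite mulr_sumr; apply: ler_sum => u /andP[_ /wk]; rewrite mulr1.
  by rewrite ler_wpM2l.
have dn v : (degree G v)%:R <= n.
  by rewrite ler_nat; apply: leq_trans (max_card _) _.
pose L := heavy x (1 - eta).
have dL v : v \in L -> (1 - 2 * eta) * n <= (degree G v)%:R.
  rewrite inE => xv.
  have h1 : (1 - eta) * (k%:R * n - k%:R ^+ 2) <= l ^+ 2 * x v.
    rewrite mulrC; apply: ler_pM => //; [|lra|lra].
    have : 0 <= k%:R * (n - k%:R) by rewrite mulr_ge0 //; nra.
    lra.
  have h2 := keyd v.
  have : k%:R * ((1 - 2 * eta) * n) <= k%:R * (degree G v)%:R.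
    have h3 : eta * n <= k%:R * (eta * n) by rewrite ler_peMl // mulr_ge0 // ltW.
    have h4 : 0 <= eta * k%:R ^+ 2 by rewrite mulr_ge0 // ltW.
    lra.
  rewrite ler_pM2l //; lra.
(* As $x_z=1$ and $l^2$ is nearly $kn$, averaging over the good neighbours of [z] gives one whose
   heavy neighbours weigh more than $k-\eta$. There are at most [k] of them, each of weight at most
   1, so there are exactly [k] and each exceeds $1-\eta$. *)
have leL : (k <= #|L|)%N.
  have [u /andP[/andP[zu gu] wu]] : exists u, (G z u && good u) && (k%:R - eta < weight_in G x H u).
    apply/existsP; apply: contraT; rewrite negb_exists => /forallP hno.
    have h1 := key z; rewrite xz mulr1 in h1.
    have h2 : \sum_(u | G z u && good u) weight_in G x H u <= (k%:R - eta) * n.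
      apply: le_trans (_ : (k%:R - eta) * \sum_(u | G z u && good u) (1 : R) <= _).
        rewrite mulr_sumr; apply: ler_sum => u hu; have := hno u; rewrite hu mulr1 /=.
        by rewrite -leNgt.
      rewrite ler_wpM2l //; first lra.
      exact: le_trans (cardN z) (dn z).
    lra.
  pose N := [set w in H | G u w].
  have kN : (k <= #|N|)%N.
    have h1 := weight_in_le G H u x01.
    have : k%:R < #|N|%:R + 1 :> R by rewrite -/N in h1; lra.
    by rewrite natr1 ltr_nat ltnS.
  apply: leq_trans kN _; apply/subset_leq_card/fintype.subsetP => w wN.
  rewrite inE; have : weight_in G x H u <= x w + (k%:R - 1).
    rewrite weight_in_card -/N (bigD1 w) //= lerD2l.
    apply: le_trans (_ : \sum_(i in N :\ w) (1 : R) <= _).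
      rewrite [leLHS](eq_bigl (mem (N :\ w))); last by move=> i; rewrite !inE andbC.
      by apply: ler_sum => i _; have /andP[] := x01 i.
    rewrite natr_card lerBrDr natr1 ler_nat.
    by apply: leq_trans gu; rewrite -/N (cardsD1 w N) wN.
  lra.
have common (S : {set T}) : S \subset L ->
    n * (1 - 2 * #|S|%:R * eta) <= #|common_nbrs G S|%:R.
  move=> SL; have := common_nbrs_card G S; rewrite -(ler_nat R) natrD natr_sum -/n.
  have : \sum_(u in S) (#|T| - degree G u)%:R <= #|S|%:R * (2 * eta * n).
    rewrite -natr_card mulr_suml; apply: ler_sum => u uS.
    rewrite natrB ?mul1r; last exact: max_card.
    by have := dL u (fintype.subsetP SL u uS); rewrite -/n; lra.
  lra.
(* Any $k+1$ vertices of [L] would share at least $n(1-2(k+1)\eta)\ge n/2$ common neighbours, more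
   than [M] allows. *)
have cardL : #|L| = k.
  apply/eqP; rewrite eqn_leq leL andbT leqNgt; apply/negP => ltkL.
  have [S SL cS] : exists2 S : {set T}, S \subset L & #|S| = k.+1.
    exists [set u in take k.+1 (enum L)].
      by apply/fintype.subsetP => u; rewrite inE => /mem_take; rewrite mem_enum.
    rewrite cardsE (card_uniqP _) ?take_uniq ?enum_uniq //.
    by rewrite size_takel // -cardE.
  have := hM S; rewrite cS ltnSn => /(_ isT); rewrite -(ltr_nat R).
  have := common S SL; rewrite cS kS => h1.
  have h2 : n * (1 - 2 * (k%:R + 1) * eta) = n - 2 * n * ((k%:R + 1) * eta) by lra.
  have h3 : n * (eta * (4 * (k%:R + 1))) <= n * 1 by rewrite ler_pM2l.
  have h4 : eta * n <= 1 / 8 * n by rewrite ler_pM2r.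
  lra.
exists L; split=> //.
- by move=> u; rewrite inE.
(* Together with [L], the vertex [v] has fewer than [M] common neighbours, so nearly all its
   neighbours avoid [W]. Its degree is thus at most $M+2k\eta n$, and the two-step bound turns this
   into a small weight. *)
- move=> v vL; set W := common_nbrs G L.
  have hW : n * (1 - 2 * k%:R * eta) <= #|W|%:R by rewrite -{1}cardL; exact: common.
  have hd : (degree G v)%:R <= M%:R + (n - #|W|%:R).
    have hv : (#|[set u | G v u] :&: W| <= M)%N.
      apply: ltnW; apply: leq_ltn_trans (hM (v |: L) _); last by rewrite cardsU1 vL cardL add1n.
      apply/subset_leq_card/fintype.subsetP => u; rewrite inE => /andP[vu uW].
      apply/common_nbrsP => w; rewrite !inE => /orP[/eqP ->|wL]; first by move: vu; rewrite inE.
      by move: uW => /common_nbrsP; apply; rewrite inE.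
    have : (degree G v + #|W| <= M + #|T|)%N.
      have := cardsUI [set u | G v u] W; rewrite -/(degree G v) => <-.
      by rewrite addnC; apply: leq_add => //; exact: max_card.
    by rewrite -(ler_nat R) !natrD -/n; lra.
  have h1 := keyd v.
  have h2 : k%:R * (degree G v)%:R <= k%:R * M%:R + 2 * (k%:R * (k%:R * eta * n)).
    have h := ler_wpM2l (ler0n R k) hd; apply: le_trans h _; nra.
  have h3 : k%:R / 2 * n <= l ^+ 2.
    apply: le_trans hl.
    have : eta * n <= 1 / 8 * n by rewrite ler_pM2r.
    have : n <= k%:R * n by rewrite ler_peMl // ltW.
    lra.
  have h4 : k%:R / 2 * n * x v <= l ^+ 2 * x v by apply: ler_wpM2r => //; have /andP[] := x01 v.
  have h5 : eta * n <= k%:R * (k%:R * eta * n).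
    rewrite -mulrA mulrA ler_peMl ?mulr_ge0 ?(ltW n0) ?(ltW e0) //; nra.
  have : (k%:R * n) * x v <= (k%:R * n) * (7 * k%:R * eta) by lra.
  rewrite ler_pM2l // mulr_gt0 //; lra.
- by rewrite -{1}cardL; exact: common.
Qed.

(** * Weighted sums over pairs of sets, and the reattachment to [L] *)

Definition qsum (R : realType) (T : finType) (G : sgraph T) (x : T -> R) (S S' : {set T}) : R :=
  \sum_(u in S) \sum_(v in S') (G u v)%:R * (x u * x v).

Lemma qsumC (R : realType) (T : finType) (G : sgraph T) (x : T -> R) (S S' : {set T}) :
  qsum G x S S' = qsum G x S' S.
Proof.
rewrite /qsum exchange_big /=; apply: eq_bigr => u _; apply: eq_bigr => v _.
by rewrite adj_sym (mulrC (x u)).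
Qed.

Lemma qsumUl (R : realType) (T : finType) (G : sgraph T) (x : T -> R) (S1 S2 S' : {set T}) :
  [disjoint S1 & S2] -> qsum G x (S1 :|: S2) S' = qsum G x S1 S' + qsum G x S2 S'.
Proof.
move=> d; rewrite /qsum (eq_bigl [predU S1 & S2]) ?bigU //=.
by move=> u; rewrite !inE.
Qed.

Lemma qsumUU (R : realType) (T : finType) (G : sgraph T) (x : T -> R) (S1 S2 : {set T}) :
  [disjoint S1 & S2] -> qsum G x (S1 :|: S2) (S1 :|: S2) =
  qsum G x S1 S1 + 2 * qsum G x S1 S2 + qsum G x S2 S2.
Proof.
move=> d; rewrite qsumUl // (qsumC _ _ S1) (qsumC _ _ S2) !qsumUl // (qsumC _ _ S2 S1).
lra.
Qed.

Lemma qformE (R : realType) (T : finType) (G : sgraph T) (x : T -> R) :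
  qform G x = qsum G x [set: T] [set: T].
Proof.
apply: eq_big => [u|u _]; first by rewrite inE.
by apply: eq_bigl => v; rewrite inE.
Qed.

Lemma eq_qsum (R : realType) (T : finType) (G G' : sgraph T) (x : T -> R) (S S' : {set T}) :
  (forall u v, u \in S -> v \in S' -> G u v = G' u v) -> qsum G x S S' = qsum G' x S S'.
Proof. by move=> h; apply: eq_bigr => u uS; apply: eq_bigr => v vS; rewrite h. Qed.

Lemma qsum_eq0 (R : realType) (T : finType) (G : sgraph T) (x : T -> R) (S S' : {set T}) :
  (forall u v, u \in S -> v \in S' -> G u v = false) -> qsum G x S S' = 0.
Proof.
by move=> h; rewrite /qsum big1 // => u uS; rewrite big1 // => v vS; rewrite h // mul0r.
Qed.

(* A sparse graph is degenerate: peel off a vertex of degree at most [C] in [S]. *)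
Lemma sparse_qsum_le (R : realType) (C : nat) (T : finType) (G : sgraph T) (x : T -> R)
    (m : R) (S : {set T}) :
  sparse C G -> (forall u, u \in S -> 0 <= x u <= m) ->
  qsum G x S S <= 2 * C%:R * m * \sum_(u in S) x u.
Proof.
move=> sp; have [s] := ubnP #|S|; elim: s S => // s IHs S ltS hx.
have [->|S0] := finset.set_0Vmem S; first by rewrite /qsum !finset.big_set0 mulr0.
have [u uS du] : exists2 u, u \in S & (vol G [set u] S <= C)%N.
  apply/exists_inP; apply: contraT; rewrite negb_exists_in => /forall_inP h.
  have := sp S; rewrite leqNgt => /negP[].
  have [v vS] := S0; rewrite mulnC -sum_nat_const /vol (bigD1 v) //= [ltnRHS](bigD1 v) //=.
  rewrite -addSn; apply: leq_add.
    by have := h v vS; rewrite -ltnNge vol_set1l.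
  by apply: leq_sum => w /andP[wS _]; have := h w wS; rewrite -ltnNge vol_set1l => /ltnW.
have eS : S = [set u] :|: (S :\ u) by rewrite finset.setD1K.
have d : [disjoint [set u] & S :\ u] by rewrite disjoints1 !inE eqxx.
have hu := hx u uS.
have m0 : 0 <= m by lra.
have hS' : qsum G x (S :\ u) (S :\ u) <= 2 * C%:R * m * \sum_(v in S :\ u) x v.
  apply: IHs; first by move: ltS; rewrite (cardsD1 u) uS.
  by move=> v; rewrite inE => /andP[_ /hx].
have -> : \sum_(v in S) x v = x u + \sum_(v in S :\ u) x v by rewrite (big_setD1 u).
rewrite {1 2}eS qsumUU //.
have -> : qsum G x [set u] [set u] = 0.
  by apply: qsum_eq0 => v w; rewrite !inE => /eqP-> /eqP->; rewrite adj_irr.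
have : qsum G x [set u] (S :\ u) <= x u * (C%:R * m).
  rewrite /qsum finset.big_set1.
  apply: le_trans (_ : x u * (\sum_(v in S :\ u) (G u v)%:R * m) <= _).
    rewrite mulr_sumr; apply: ler_sum => v; rewrite inE => /andP[_ /hx hv].
    rewrite mulrCA; apply: ler_wpM2l; first by lra.
    by apply: ler_wpM2l => //; lra.
  apply: ler_wpM2l; first by lra.
  rewrite -mulr_suml -natr_sum; apply: ler_wpM2r => //; rewrite ler_nat.
  apply: leq_trans du; rewrite vol_set1l [leqRHS](big_setD1 u) //=; exact: leq_addl.
lra.
Qed.

Definition deficient (T : finType) (G : sgraph T) (L : {set T}) : {set T} :=
  ~: (L :|: common_nbrs G L).

Lemma deficientN (T : finType) (G : sgraph T) (L : {set T}) u :
  u \in deficient G L -> u \notin L.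
Proof. by rewrite !inE negb_or => /andP[]. Qed.

Definition swap_rel (T : finType) (G : sgraph T) (L : {set T}) : rel T := fun u v =>
  if u \in deficient G L then v \in L
  else if v \in deficient G L then u \in L else G u v.

Lemma swap_sym (T : finType) (G : sgraph T) (L : {set T}) : symmetric (swap_rel G L).
Proof.
move=> u v; rewrite /swap_rel adj_sym.
case uB: (u \in deficient G L); case vB: (v \in deficient G L) => //.
by rewrite (negbTE (deficientN uB)) (negbTE (deficientN vB)).
Qed.

Lemma swap_irr (T : finType) (G : sgraph T) (L : {set T}) : irreflexive (swap_rel G L).
Proof.
move=> u; rewrite /swap_rel adj_irr; case uB: (u \in deficient G L) => //.
exact/negbTE/(deficientN uB).
Qed.

Definition swap (T : finType) (G : sgraph T) (L : {set T}) : sgraph T :=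
  SGraph (swap_sym G L) (swap_irr G L).

Lemma swap_off (T : finType) (G : sgraph T) (L : {set T}) u v :
  u \notin deficient G L -> v \notin deficient G L -> swap G L u v = G u v.
Proof. by rewrite /= /swap_rel => /negbTE-> /negbTE->. Qed.

Lemma swap_joined (T : finType) (G : sgraph T) (L : {set T}) u v :
  u \in L -> v \notin L -> swap G L u v.
Proof.
move=> uL vL; rewrite adj_sym /= /swap_rel; case: ifP => // vB.
have uB : u \in deficient G L = false by apply/negP => /deficientN; rewrite uL.
rewrite uB adj_sym; move: vB; rewrite !inE (negbTE vL) /=.
by move=> /negbFE /forall_inP; apply.
Qed.

(** Each deficient [u] gains a neighbour of weight at least 3/4 in [L], worth $\frac32x_u$ in the
    form. The lost edges cost at most $2Mm\,x_u$ towards the common neighbours and, by degeneracy,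
    $2Cm$ times the weight of the deficient set inside it. Since $(M+C)m\le\frac14$, a coefficient
    $\frac32-\frac12=1$ remains. *)
Lemma swap_gain (R : realType) (C M : nat) (m : R) (T : finType) (G : sgraph T) (x : T -> R)
    (L : {set T}) :
  sparse C G -> (forall u, 0 <= x u) -> (forall u, u \in L -> 3 / 4 <= x u) ->
  (forall u, u \notin L -> x u <= m) -> (M + C)%:R * m <= 1 / 4 ->
  (forall u, u \notin L -> (vol G [set u] (common_nbrs G L) <= M)%N) ->
  qform G x + \sum_(u in deficient G L) x u <= qform (swap G L) x.
Proof.
move=> sp x0 xL xm hm hM.
set W := common_nbrs G L; set B := deficient G L.
have dLW : [disjoint L & W] := common_nbrs_disjoint G L.
have dB : [disjoint L :|: W & B] by rewrite -finset.setI_eq0 /B /deficient finset.setICr.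
have eT : [set: T] = (L :|: W) :|: B by rewrite /B /deficient finset.setUCr.
have WB u : u \in W -> u \notin B by rewrite !inE => ->; rewrite orbT.
have LB u : u \in L -> u \notin B by rewrite !inE => ->.
have WL u : u \in W -> u \notin L.
  by move=> uW; apply/negP => uL; have /pred0P/(_ u) := dLW; rewrite /= uL uW.
rewrite !qformE eT !(qsumUU _ _ dB) !(qsumUU _ _ dLW) !(qsumUl _ _ _ dLW).
have -> : qsum (swap G L) x L L = qsum G x L L.
  by apply: eq_qsum => u v uL vL; apply: swap_off; exact: LB.
have -> : qsum (swap G L) x W W = qsum G x W W.
  by apply: eq_qsum => u v uL vL; apply: swap_off; exact: WB.
have -> : qsum (swap G L) x L W = qsum G x L W.
  by apply: eq_qsum => u v uL vL; apply: swap_off; [exact: LB | exact: WB].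
have -> : qsum (swap G L) x W B = 0.
  apply: qsum_eq0 => u v uW vB; rewrite /= /swap_rel -/B (negbTE (WB _ uW)) vB.
  exact/negbTE/WL.
have -> : qsum (swap G L) x B B = 0.
  apply: qsum_eq0 => u v uB vB; rewrite /= /swap_rel -/B uB; exact/negbTE/(deficientN vB).
have hLB : qsum G x L B + 3 / 4 * (\sum_(u in B) x u) <= qsum (swap G L) x L B.
  rewrite 2!(qsumC _ _ L) mulr_sumr -big_split /=; apply: ler_sum => u uB.
  have [w wL nw] : exists2 w, w \in L & ~~ G w u.
    move: (uB); rewrite !inE negb_or => /andP[_]; rewrite negb_forall_in => /exists_inP[w wL nw].
    by exists w.
  rewrite (bigD1 w) //= [leRHS](bigD1 w) //= adj_sym (negbTE nw) mul0r add0r.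
  rewrite addrC /= /swap_rel -/B uB wL mul1r; apply: lerD.
    by rewrite mulrC; apply: ler_wpM2l => //; exact: xL.
  apply: ler_sum => v /andP[vL _]; rewrite vL mul1r.
  by apply: ler_piMl; [rewrite mulr_ge0 | case: (G u v)].
have hBB : qsum G x B B <= 2 * C%:R * m * \sum_(u in B) x u.
  by apply: sparse_qsum_le => // u uB; rewrite x0 xm // (deficientN uB).
have hWB : qsum G x W B <= M%:R * m * \sum_(u in B) x u.
  rewrite qsumC mulr_sumr; apply: ler_sum => u uB.
  have uL := deficientN uB.
  have m0 : 0 <= m by apply: le_trans (xm u uL).
  apply: le_trans (_ : (\sum_(v in W) (G u v)%:R) * (m * x u) <= _).
    rewrite mulr_suml; apply: ler_sum => v vW; apply: ler_wpM2l => //.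
    by rewrite mulrC; apply: ler_wpM2r => //; apply: xm; exact: WL.
  rewrite -mulrA; apply: ler_wpM2r; first by rewrite mulr_ge0.
  by rewrite -natr_sum ler_nat -vol_set1l; exact: hM.
have sB : 0 <= \sum_(u in B) x u by apply: sumr_ge0.
rewrite natrD in hm.
have := ler_wpM2r sB hm; lra.
Qed.

(* In a copy of an excluded graph, the reattached vertices can be traded for unused common
   neighbours of [L]. *)
Lemma swap_free (F : graph_family) (m : nat) (T : finType) (G : sgraph T) (L : {set T}) :
  (forall A, F A -> (projT1 A <= m)%N) -> (2 * m <= #|common_nbrs G L|)%N ->
  (0 < #|L|)%N -> family_free F G -> family_free F (swap G L).
Proof.
move=> hF hW /card_gt0P[x0 _] fG A FA [f fi fh]; apply: (fG A FA).
set W := common_nbrs G L in hW *; set B := deficient G L.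
have WL u : u \in W -> u \notin L.
  move=> uW; apply/negP => uL; have /pred0P/(_ u) := common_nbrs_disjoint G L.
  by rewrite /= uL uW.
pose I := f @: [set: 'I_(projT1 A)]; pose U := W :\: I.
have cU : (projT1 A <= #|U|)%N.
  have cI : (#|I| <= projT1 A)%N by rewrite card_imset // cardsT card_ord.
  have := cardsD W I; have := subset_leq_card (finset.subsetIr W I); have := hF A FA.
  rewrite -/U; lia.
pose g i := if f i \in B then nth x0 (enum U) i else f i.
have gU i : f i \in B -> g i \in U.
  move=> h; rewrite /g h -mem_enum mem_nth // -cardE; exact: leq_trans (ltn_ord i) cU.
have gI i : f i \notin B -> g i \in I.
  by move=> h; rewrite /g (negbTE h); apply: imset_f; rewrite inE.
have UI u : u \in U -> u \notin I by rewrite inE => /andP[].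
exists g.
  move=> i j; have [iB|iB] := boolP (f i \in B); have [jB|jB] := boolP (f j \in B).
  - rewrite /g iB jB => /eqP; rewrite nth_uniq ?enum_uniq -?cardE //.
    + by move=> /eqP; exact: val_inj.
    + exact: leq_trans (ltn_ord i) cU.
    + exact: leq_trans (ltn_ord j) cU.
  - by move=> E; have := UI _ (gU _ iB); rewrite E gI.
  - by move=> E; have := UI _ (gU _ jB); rewrite -E gI.
  - by rewrite /g (negbTE iB) (negbTE jB) => /fi.
have adjB i j : f i \in B -> swap G L (f i) (f j) -> G (g i) (g j).
  move=> iB; rewrite /= /swap_rel -/B iB => jL.
  have -> : g j = f j by rewrite /g ifN //; apply/negP => /deficientN; rewrite jL.
  have : g i \in W by have := gU i iB; rewrite inE => /andP[].
  by move=> /common_nbrsP h; rewrite adj_sym; exact: h.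
move=> i j /fh; have [iB|iB] := boolP (f i \in B); first exact: adjB.
have [jB|jB] := boolP (f j \in B); first by rewrite adj_sym => /(adjB _ _ jB); rewrite adj_sym.
by rewrite swap_off // /g (negbTE iB) (negbTE jB).
Qed.

Lemma finite_family_bound (F : graph_family) :
  finite_set F -> exists m : nat, forall A, F A -> (projT1 A <= m)%N.
Proof.
move=> /(finite_image (fun A : {m : nat & sgraph 'I_m} => projT1 A)) /finite_seqP[s hs].
exists (\max_(i <- s) i)%N => A FA; apply: leq_bigmax_seq => //.
by have : [set` s]%classic (projT1 A) by rewrite -hs; exists A.
Qed.

(** * Two graphs compared at one eigenvector *)

(** With $\lambda$ the spectral radius, $\lambda(G)|x|^2=q_G(x)\le
    q_{G'}(x)\le\lambda(G')|x|^2\le\lambda(G)|x|^2$, so all are equal and [x] attains the Rayleigh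
    bound of [G']. *)
Lemma eigen_transfer (R : realType) (n : nat) (G G' : sgraph 'I_n) (x : 'I_n -> R) :
  (forall u, adjop G x u = spectral_radius R G * x u) -> qform G x <= qform G' x ->
  spectral_radius R G' <= spectral_radius R G ->
  qform G' x = qform G x /\ (forall u, adjop G' x u = spectral_radius R G' * x u).
Proof.
move=> ex hq hl.
have qG : qform G x = spectral_radius R G * sqnorm x.
  by rewrite qform_adjop /sqnorm mulr_sumr; apply: eq_bigr => u _; rewrite ex; lra.
have h1 : spectral_radius R G' * sqnorm x <= spectral_radius R G * sqnorm x.
  by apply: ler_wpM2r => //; exact: sqnorm_ge0.
have h2 := rayleigh G' x.
split; first by apply/eqP; rewrite eq_le hq andbT; lra.
by apply: rayleigh_max_eigen; [exact: rayleigh | lra].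
Qed.

Lemma eigen_gt0 (R : realType) (T : finType) (G : sgraph T) (x : T -> R) (l : R) (u w : T) :
  (forall u, 0 <= x u) -> (forall u, adjop G x u = l * x u) -> G u w -> 0 < x w -> 0 < x u.
Proof.
move=> x0 ex uw xw; rewrite lt_neqAle x0 andbT eq_sym; apply/negP => /eqP xu.
have := ex u; rewrite xu mulr0 /adjop (bigD1 w) //= uw mul1r => /eqP.
rewrite gt_eqF // ltr_wpDr //; apply: sumr_ge0 => v _; exact: mulr_ge0.
Qed.

Lemma qform_pullback (R : realType) (S T : finType) (f : S -> T) (G : sgraph T) (x : T -> R) :
  bijective f -> qform (pullback f G) (x \o f) = qform G x.
Proof.
move=> fb; rewrite /qform [RHS](reindex f) /=; last exact: onW_bij.
by apply: eq_bigr => u _; rewrite [RHS](reindex f) //=; exact: onW_bij.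
Qed.

Lemma sqnorm_comp (R : realType) (S T : finType) (f : S -> T) (x : T -> R) :
  bijective f -> sqnorm (x \o f) = sqnorm x.
Proof. by move=> fb; rewrite /sqnorm [RHS](reindex f) //; exact: onW_bij. Qed.

Lemma qform_le (R : realType) (T : finType) (G H : sgraph T) (x : T -> R) :
  (forall u, 0 <= x u) -> (forall u v, G u v -> H u v) -> qform G x <= qform H x.
Proof.
move=> x0 GH; apply: ler_sum => u _; apply: ler_sum => v _.
apply: ler_wpM2r; first exact: mulr_ge0.
by case E: (G u v) => //; rewrite (GH _ _ E).
Qed.

(** At a positive vector every pair adjacent in [H] but not in [G] strictly raises the form. *)
Lemma qform_le_eq (R : realType) (T : finType) (G H : sgraph T) (x : T -> R) :
  (forall u, 0 < x u) -> (forall u v, G u v -> H u v) -> qform H x <= qform G x ->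
  forall u v, G u v = H u v.
Proof.
move=> x0 GH le u v.
have ge w t : 0 <= ((H w t)%:R - (G w t)%:R) * (x w * x t).
  apply: mulr_ge0; last by rewrite mulr_ge0 ?ltW.
  by case E: (G w t); rewrite ?(GH _ _ E) ?subrr ?subr0.
have : \sum_w \sum_t ((H w t)%:R - (G w t)%:R) * (x w * x t) = 0 :> R.
  apply/eqP; rewrite eq_le sumr_ge0 ?andbT; last by move=> w _; exact: sumr_ge0.
  move: le; rewrite -subr_le0; congr (_ <= _); rewrite /qform -sumrB.
  by apply: eq_bigr => w _; rewrite -sumrB; apply: eq_bigr => t _; rewrite mulrBl.
move=> /eqP; rewrite psumr_eq0; last by move=> w _; exact: sumr_ge0.
move=> /allP/(_ u (mem_index_enum _)); rewrite implyTb psumr_eq0 //.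
move=> /allP/(_ v (mem_index_enum _)); rewrite implyTb mulf_eq0.
rewrite [X in _ || X]gt_eqF ?mulr_gt0 // orbF.
case E: (G u v); first by rewrite (GH _ _ E).
by case: (H u v); rewrite ?subr0 ?oner_eq0.
Qed.

(** The test vector is the Perron vector of $K_{k,n-k}$: it equals $\sqrt{n-k}$ on the side of size
    [k] and $\sqrt k$ on the other. *)
Lemma biclique_radius (R : realType) (k n : nat) (G : sgraph 'I_n) :
  (0 < k < n)%N -> contains G (bipartite 'I_k 'I_(n - k)) ->
  0 <= spectral_radius R G /\ k%:R * (n%:R - k%:R) <= spectral_radius R G ^+ 2.
Proof.
move=> /andP[k0 kn] [f fi fh].
have fb : bijective f by apply: inj_card_bij => //; rewrite card_sum !card_ord subnKC // ltnW.
have [g fK gK] := fb.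
pose a : R := Num.sqrt (n - k)%:R; pose b : R := Num.sqrt k%:R.
pose w (s : 'I_k + 'I_(n - k)) : R := if s is inl _ then a else b.
have a2 : a ^+ 2 = (n - k)%:R by rewrite sqr_sqrtr.
have b2 : b ^+ 2 = k%:R by rewrite sqr_sqrtr.
have a0 : 0 < a by rewrite sqrtr_gt0 ltr0n subn_gt0.
have b0 : 0 < b by rewrite sqrtr_gt0 ltr0n.
have wE : (w \o g) \o f =1 w by move=> s /=; rewrite fK.
have := rayleigh G (w \o g).
rewrite -(qform_pullback _ _ fb) -(sqnorm_comp _ fb) => h.
have {h} : qform (bipartite 'I_k 'I_(n - k)) w <= spectral_radius R G * sqnorm w.
  apply: le_trans (_ : qform (pullback f G) w <= _).
    by apply: qform_le => [[]|u v /fh//]; rewrite /= ltW.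
  move: h; congr (_ <= _ * _).
    by apply: eq_bigr => u _; apply: eq_bigr => v _; rewrite /= !fK.
  by apply: eq_bigr => u _; rewrite /= !fK.
have sc (I : finType) (c : R) : \sum_(i : I) c = #|I|%:R * c.
  by rewrite sumr_const mulr_natl.
have -> : sqnorm w = 2 * (k%:R * (n - k)%:R).
  by rewrite /sqnorm big_sumType /= !sc !card_ord a2 b2; lra.
have -> : qform (bipartite 'I_k 'I_(n - k)) w = a * b * (2 * (k%:R * (n - k)%:R)).
  have -> : qform (bipartite 'I_k 'I_(n - k)) w =
      \sum_(i < k) \sum_(j < n - k) a * b + \sum_(j < n - k) \sum_(i < k) a * b.
    rewrite /qform big_sumType /=; congr (_ + _); apply: eq_bigr => i _; rewrite big_sumType /=.
      rewrite [X in X + _]big1 ?add0r; last by move=> j _; rewrite mul0r.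
      by apply: eq_bigr => j _; rewrite mul1r.
    rewrite [X in _ + X]big1 ?addr0; last by move=> j _; rewrite mul0r.
    by apply: eq_bigr => j _; rewrite mul1r mulrC.
  by under eq_bigr do rewrite sc; under [X in _ + X]eq_bigr do rewrite sc; rewrite !sc !card_ord; lra.
have p0 : 0 < 2 * (k%:R * (n - k)%:R) :> R by rewrite !mulr_gt0 ?ltr0n ?subn_gt0.
rewrite ler_pM2r // => h; have l0 : 0 <= spectral_radius R G by apply: le_trans h; rewrite mulr_ge0 ?ltW.
split=> //; rewrite -natrB ?(ltnW kn) // -a2 -b2 -exprMn ler_sqr ?nnegrE ?mulr_ge0 ?(ltW a0) ?(ltW b0) //.
by rewrite mulrC.
Qed.

Lemma split_bij (T : finType) (n k : nat) (L : {set T}) : #|T| = n -> #|L| = k ->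
  exists f : 'I_k + 'I_(n - k) -> T,
    [/\ bijective f, forall a, f (inl a) \in L & forall b, f (inr b) \notin L].
Proof.
move=> cT cL; have cC : #|~: L| = (n - k)%N by rewrite cardsCs finset.setCK cT cL.
pose f (s : 'I_k + 'I_(n - k)) : T := match s with
  inl a => enum_val (cast_ord (esym cL) a) | inr b => enum_val (cast_ord (esym cC) b) end.
have fl a : f (inl a) \in L by exact: enum_valP.
have fr b : f (inr b) \notin L by have := enum_valP (cast_ord (esym cC) b); rewrite inE.
have kn : (k <= n)%N by rewrite -cL -cT max_card.
exists f; split=> //; apply: inj_card_bij; last by rewrite card_sum !card_ord subnKC // cT.
move=> [a|b] [a'|b'].
- by move=> /enum_val_inj /cast_ord_inj ->.
- by move=> E; have := fr b'; rewrite -E fl.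
- by move=> E; have := fr b; rewrite E fl.
- by move=> /enum_val_inj /cast_ord_inj ->.
Qed.

Lemma contains_biclique (T : finType) (n k : nat) (G : sgraph T) (L : {set T}) :
  #|T| = n -> #|L| = k -> (forall u v, u \in L -> v \notin L -> G u v) ->
  contains G (bipartite 'I_k 'I_(n - k)).
Proof.
move=> cT cL GL; have [f [fb fl fr]] := split_bij cT cL.
exists f; first exact: bij_inj.
by move=> [a|b] [a'|b'] //= _; [|rewrite adj_sym]; exact: GL.
Qed.

Lemma core (R : realType) (F : graph_family) (C M k : nat) : (0 < k)%N ->
  (forall (T : finType) (G : sgraph T), family_free F G -> sparse C G) ->
  (forall (T : finType) (G : sgraph T), family_free F G ->
    forall S : {set T}, (k < #|S|)%N -> (#|common_nbrs G S| < M)%N) ->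
  exists n0 : nat, forall (n : nat) (G : sgraph 'I_n), (n0 <= n)%N -> family_free F G ->
    0 <= spectral_radius R G -> k%:R * (n%:R - k%:R) <= spectral_radius R G ^+ 2 ->
  exists x : 'I_n -> R, exists L : {set 'I_n},
    [/\ eigvec01 G x (spectral_radius R G), #|L| = k /\ (n <= 2 * #|common_nbrs G L|)%N,
        forall u, u \in L -> 3 / 4 <= x u, forall u, u \notin L -> x u <= 1 / 4 &
        qform G x + \sum_(u in deficient G L) x u <= qform (swap G L) x].
Proof.
move=> k0 hC hM; pose p : R := M%:R + C%:R + 1.
have p1 : 1 <= p by rewrite lerDr addr_ge0.
have k1 : 1 <= k%:R :> R by rewrite ler1n.
(* The weights off [L] are then at most $7k\eta=1/(4p)$. As $p=M+C+1$, this meets both the bound 1/4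
   on these weights and the requirement $(M+C)m\le\frac14$ of [swap_gain]. *)
pose eta : R := (28 * (k%:R * p))^-1.
have kp : 1 <= k%:R * p by nra.
have ke : 28 * (k%:R * p) * eta = 1 by rewrite mulfV //; lra.
have e0 : 0 < eta by rewrite invr_gt0; lra.
have e0' := ltW e0.
have ke1 : 28 * (k%:R * eta) <= 1.
  have : 0 <= k%:R * eta * (p - 1) by apply: mulr_ge0; [exact: mulr_ge0 | rewrite subr_ge0].
  lra.
have e1 : 28 * eta <= 1.
  have : 0 <= eta * (k%:R - 1) by apply: mulr_ge0; rewrite ?subr_ge0.
  lra.
have ek : eta * (4 * k.+1%:R) <= 1 by rewrite -natr1; lra.
have [n0 hn0] := structure C M k0 e0 ek.
exists (maxn n0 1) => n G; rewrite geq_max => /andP[nn0 n1] fG l0 hl.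
have [x [x01 xz ex]] := perron R G n1.
have := hn0 _ G x (spectral_radius R G); rewrite card_ord => /(_ nn0 (hC _ _ fG) (hM _ _ fG)).
move=> /(_ (conj x01 ex) l0 hl xz)[L [cL xL xnL hW]].
have x0 u : 0 <= x u by have /andP[] := x01 u.
exists x, L; split=> //.
- split=> //; rewrite -(ler_nat R) natrM.
  have : 0 <= n%:R * (1 - 4 * k%:R * eta) :> R by rewrite mulr_ge0 //; lra.
  lra.
- by move=> u uL; apply: le_trans (xL u uL); lra.
- by move=> u uL; apply: le_trans (xnL u uL) _; lra.
- apply: (@swap_gain _ C M (7 * k%:R * eta)) => //.
  + exact: hC.
  + by move=> u uL; apply: le_trans (xL u uL); lra.
  + have : 0 <= k%:R * eta by rewrite mulr_ge0.
    rewrite natrD; move: ke; rewrite /p; lra.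
  + move=> u uL; apply: ltnW; apply: leq_ltn_trans (hM _ _ fG (u |: L) _); last first.
      by rewrite cardsU1 uL cL add1n.
    rewrite vol_set1l -sum1_card big_mkcond [leqRHS]big_mkcond; apply: leq_sum => v _.
    case: ifP => // /common_nbrsP hv; case: ifP => [_|]; first by case: (G u v).
    move=> /common_nbrsP nv; case E: (G u v) => //; case: nv => w.
    by rewrite !inE => /orP[/eqP->//|]; exact: hv.
Qed.

(** * Edge counts of cliques, bicliques, joins and unions *)

Lemma volTE (T : finType) (G : sgraph T) :
  vol G [set: T] [set: T] = (\sum_u \sum_v G u v)%N.
Proof.
rewrite /vol; apply: eq_big => [u|u _]; first by rewrite inE.
by apply: eq_bigl => v; rewrite inE.
Qed.

Lemma vol_clique (T : finType) (G : sgraph T) (L : {set T}) :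
  (forall u v, u \in L -> v \in L -> u != v -> G u v) -> vol G L L = (#|L| * #|L|.-1)%N.
Proof.
move=> GL; rewrite -sum_nat_const /vol; apply: eq_bigr => u uL.
rewrite (big_setD1 u) //= adj_irr add0n (cardsD1 u) uL /= -sum1_card.
by apply: eq_bigr => v; rewrite !inE => /andP[vu vL]; rewrite GL // eq_sym.
Qed.

Lemma vol_biclique (T : finType) (G : sgraph T) (S S' : {set T}) :
  (forall u v, u \in S -> v \in S' -> G u v) -> vol G S S' = (#|S| * #|S'|)%N.
Proof.
move=> GS; rewrite -sum_nat_const /vol; apply: eq_bigr => u uS.
by rewrite -sum1_card; apply: eq_bigr => v vS; rewrite GS.
Qed.

Lemma vol_complete (T : finType) : vol (complete T) [set: T] [set: T] = (#|T| * #|T|.-1)%N.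
Proof. by rewrite vol_clique ?cardsT. Qed.

Lemma vol_gcompl_complete (T : finType) : vol (gcompl (complete T)) [set: T] [set: T] = 0%N.
Proof.
rewrite volTE big1 // => u _; rewrite big1 // => v _.
by rewrite /= /gcompl_rel /= /complete_rel andbN.
Qed.

Lemma sum_nat_constT (I : finType) (c : nat) : (\sum_(i : I) c = #|I| * c)%N.
Proof. exact: sum_nat_const. Qed.

Lemma vol_bipartite (S T : finType) :
  vol (bipartite S T) [set: S + T] [set: S + T] = (2 * (#|S| * #|T|))%N.
Proof.
rewrite volTE big_sumType /=.
under eq_bigr do rewrite big_sumType /= sum_nat_constT muln0 add0n sum_nat_constT muln1.
under [X in (_ + X)%N]eq_bigr do rewrite big_sumType /= !sum_nat_constT muln0 muln1 addn0.
rewrite !sum_nat_constT; transitivity (#|S| * #|T| + #|T| * #|S|)%N; first reflexivity.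
by rewrite (mulnC #|T|); set c := (_ * _)%N; lia.
Qed.

Lemma vol_gjoin (S T : finType) (G : sgraph S) (H : sgraph T) :
  vol (gjoin G H) [set: S + T] [set: S + T] =
  (vol G [set: S] [set: S] + vol H [set: T] [set: T] + 2 * (#|S| * #|T|))%N.
Proof.
rewrite !volTE big_sumType /=.
under eq_bigr do rewrite big_sumType /= sum_nat_constT muln1.
under [X in (_ + X)%N]eq_bigr do rewrite big_sumType /= !sum_nat_constT muln1.
rewrite !big_split /= !sum_nat_constT; set a := bigop _ _ _; set b := bigop _ _ _.
transitivity (a + #|S| * #|T| + (#|T| * #|S| + b))%N; first reflexivity.
by rewrite (mulnC #|T|); set c := (#|S| * _)%N; lia.
Qed.

Lemma vol_gunion (S T : finType) (G : sgraph S) (H : sgraph T) :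
  vol (gunion G H) [set: S + T] [set: S + T] =
  (vol G [set: S] [set: S] + vol H [set: T] [set: T])%N.
Proof.
rewrite !volTE big_sumType /=.
under eq_bigr do rewrite big_sumType /= sum_nat_constT muln0 addn0.
by under [X in (_ + X)%N]eq_bigr do rewrite big_sumType /= !sum_nat_constT muln0.
Qed.

(* The induced graph on [L] and its common neighbours contains a spanning biclique, so it
   has at most as many edges as the extremal graph of that order. *)
Lemma core_excess (F : graph_family) (k n n' : nat) (H : forall n, sgraph 'I_n)
    (G : sgraph 'I_n) (L : {set 'I_n}) :
  let W := common_nbrs G L in n' = (k + #|W|)%N ->
  family_free F G -> #|L| = k -> EX (bipartite 'I_k 'I_(n' - k)) n' F (H n') ->
  (vol G L L + vol G W W + 2 * (k * #|W|) <= vol (H n') [set: _] [set: _])%N.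
Proof.
move=> W en' fG cL.
have d : [disjoint L & W] := common_nbrs_disjoint G L.
have {}en' : n' = #|L :|: W| by rewrite cardsU disjoint_setI0 // cards0 subn0 cL.
subst n'.
move=> [_ _ hmax].
pose f (i : 'I_#|L :|: W|) := enum_val i.
have fi : injective f by exact: enum_val_inj.
have imf : f @: [set: 'I_#|L :|: W|] = L :|: W.
  apply/finset.setP => v; apply/imsetP/idP => [[i _ ->]|vS]; first exact: enum_valP.
  by exists (enum_rank_in vS v); rewrite ?finset.inE // /f enum_rankK_in.
have : (nb_edges (pullback f G) <= nb_edges (H #|L :|: W|))%N.
  apply: hmax; first exact: family_free_sub (contains_pullback _ fi) fG.
  apply: (@contains_biclique _ _ _ _ [set i | f i \in L]); first exact: card_ord.
    rewrite -cL -(card_imset _ fi); apply: eq_card => v; apply/imsetP/idP.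
      by move=> [i]; rewrite inE => iL ->.
    move=> vL; have : v \in f @: [set: 'I_#|L :|: W|] by rewrite imf inE vL.
    by move=> /imsetP[i _ vi]; exists i => //; rewrite inE -vi.
  move=> u v; rewrite !inE => uL vL.
  have : f v \in L :|: W by exact: enum_valP.
  by rewrite inE (negbTE vL) /= => /common_nbrsP; exact.
rewrite -(leq_pmul2l (isT : (0 < 2)%N)) -!handshake vol_pullback // imf.
rewrite volUl // !volUr // (volC _ W L).
have -> : vol G L W = (k * #|W|)%N.
  by rewrite vol_biclique ?cL // => u v uL /common_nbrsP; exact.
by rewrite mul2n -addnn addnACA [X in (_ -> _ + X <= _)%N]addnC.
Qed.

(** * Comparison graphs in which [L] is joined to everything *)

(** A vertex off [L] has a neighbour in [L], whose weight is at least 3/4. The lemma is applied to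
    the comparison graph after [eigen_transfer], not to the original [G]. *)
Lemma joined_gt0 (R : realType) (T : finType) (G : sgraph T) (x : T -> R) (l : R) (L : {set T}) :
  (0 < #|L|)%N -> (forall u, 0 <= x u) -> (forall u, u \in L -> 3 / 4 <= x u) ->
  (forall u, adjop G x u = l * x u) -> (forall u v, u \in L -> v \notin L -> G u v) ->
  forall u, 0 < x u.
Proof.
move=> /card_gt0P[w wL] x0 xL ex GL u.
have [uL|uL] := boolP (u \in L); first by have := xL u uL; lra.
apply: (@eigen_gt0 _ _ _ _ _ u w x0 ex); first by rewrite adj_sym; exact: GL.
by have := xL w wL; lra.
Qed.

Lemma deficient_eq0 (R : realType) (T : finType) (G : sgraph T) (x : T -> R) (L : {set T}) :
  (forall u, 0 < x u) -> \sum_(u in deficient G L) x u <= 0 -> deficient G L = finset.set0.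
Proof.
move=> x0 s0; apply/eqP; apply: contraT => /finset.set0Pn[v vB].
move: s0; rewrite (bigD1 v) //= leNgt => /negP[]; apply: ltr_pwDl => //.
by apply: sumr_ge0 => u _; exact: ltW.
Qed.

Lemma qsum_split (R : realType) (T : finType) (G : sgraph T) (x : T -> R) (L : {set T}) :
  qform G x = qsum G x L L + 2 * qsum G x L (~: L) + qsum G x (~: L) (~: L).
Proof. by rewrite qformE -(finset.setUCr L) qsumUU // -finset.setI_eq0 finset.setICr. Qed.

(** After the swap the deficient vertices have neighbours in [L] only, so off [L] just the pairs of
    common neighbours remain, and these are unchanged. *)
Lemma swap_qsum_out (R : realType) (T : finType) (G : sgraph T) (x : T -> R) (L : {set T}) :
  qsum (swap G L) x (~: L) (~: L) = qsum G x (common_nbrs G L) (common_nbrs G L).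
Proof.
set W := common_nbrs G L.
have WL u : u \in W -> u \notin L.
  move=> uW; apply/negP => uL; have /pred0P/(_ u) := common_nbrs_disjoint G L.
  by rewrite /= uL uW.
have eC : ~: L = W :|: deficient G L.
  apply/finset.setP => u; rewrite /deficient -/W !(finset.in_setC, finset.in_setU).
  by have := WL u; case: (u \in W); case: (u \in L) => //= /(_ isT).
have d : [disjoint W & deficient G L].
  apply/pred0P => u /=; apply/negP => /andP[uW]; rewrite inE => /negP[].
  by rewrite inE uW orbT.
have WB u : u \in W -> u \notin deficient G L.
  by move=> uW; have /pred0P/(_ u) := d; rewrite /= uW /= => ->.
rewrite eC qsumUU //.
rewrite [X in _ + X]qsum_eq0 ?[X in 2 * X]qsum_eq0 ?mulr0 ?addr0.
- by apply: eq_qsum => u v uW vW; apply: swap_off; exact: WB.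
- by move=> u v uW vB; rewrite adj_sym /= /swap_rel vB; exact/negbTE/WL.
- by move=> u v uB vB; rewrite /= /swap_rel uB; exact/negbTE/(deficientN vB).
Qed.

Lemma qsum_deficit_ge (R : realType) (T : finType) (G H : sgraph T) (x : T -> R)
    (c : R) (S S' : {set T}) :
  (forall u v, u \in S -> v \in S' -> G u v -> H u v) ->
  (forall u v, u \in S -> v \in S' -> c <= x u * x v) ->
  qsum G x S S' + c * ((vol H S S')%:R - (vol G S S')%:R) <= qsum H x S S'.
Proof.
move=> GH hc; rewrite -!natr_sum_adj -sumrB mulr_sumr -big_split /=.
apply: ler_sum => u uS; rewrite -sumrB mulr_sumr -big_split /=.
apply: ler_sum => v vS; have := hc u v uS vS; case E: (G u v).
  by rewrite (GH _ _ uS vS E) /=; lra.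
by case: (H u v) => /=; lra.
Qed.

Lemma qsum_excess_le (R : realType) (T : finType) (G H : sgraph T) (x : T -> R)
    (c : R) (S S' : {set T}) :
  (forall u v, u \in S -> v \in S' -> H u v -> G u v) ->
  (forall u v, u \in S -> v \in S' -> x u * x v <= c) ->
  qsum G x S S' <= qsum H x S S' + c * ((vol G S S')%:R - (vol H S S')%:R).
Proof.
move=> HG hc; rewrite -!natr_sum_adj -sumrB mulr_sumr -big_split /=.
apply: ler_sum => u uS; rewrite -sumrB mulr_sumr -big_split /=.
apply: ler_sum => v vS; have := hc u v uS vS; case E: (H u v).
  by rewrite (HG _ _ uS vS E) /=; lra.
by case: (G u v) => /=; lra.
Qed.

Lemma qsum_subset (R : realType) (T : finType) (G : sgraph T) (x : T -> R) (S S' : {set T}) :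
  (forall u, 0 <= x u) -> S \subset S' -> qsum G x S S <= qsum G x S' S'.
Proof.
move=> x0 sS; rewrite /qsum.
apply: (@le_trans _ _ (\sum_(u in S) \sum_(v in S') (G u v)%:R * (x u * x v))).
  apply: ler_sum => u _; rewrite [leRHS](big_setID S) /= (finset.setIidPr sS) lerDl.
  by apply: sumr_ge0 => v _; rewrite !mulr_ge0.
rewrite [leRHS](big_setID S) /= (finset.setIidPr sS) lerDl.
by apply: sumr_ge0 => u _; apply: sumr_ge0 => v _; rewrite !mulr_ge0.
Qed.

(* A pair missing in [L] weighs at least 9/16, an edge outside [L] at most 1/16. *)
Lemma clique_join_wins (R : realType) (n k : nat) (G H : sgraph 'I_n) (x : 'I_n -> R)
    (L : {set 'I_n}) :
  let W := common_nbrs G L in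
  (0 < k)%N -> eigvec01 G x (spectral_radius R G) -> #|L| = k ->
  (forall u, u \in L -> 3 / 4 <= x u) ->
  qform G x + \sum_(u in deficient G L) x u <= qform (swap G L) x ->
  (forall u v, u \in L -> u != v -> H u v) ->
  qsum G x W W <= qsum H x (~: L) (~: L) + 1 / 16 * ((k * k.-1)%:R - (vol G L L)%:R) ->
  spectral_radius R H <= spectral_radius R G ->
  [/\ deficient G L = finset.set0, (k * k.-1 <= vol G L L)%N, forall u, 0 < x u &
      qform H x = qform G x].
Proof.
move=> W k0 [x01 ex] cL xL gain HL hW le.
have x0 u : 0 <= x u by have /andP[] := x01 u.
have LC u v : u \in L -> v \notin L -> H u v.
  by move=> uL vL; apply: HL => //; apply: contraNneq vL => <-.
have GH : forall u v, u \in L -> v \in L -> G u v -> H u v.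
  by move=> u v uL _ uv; apply: HL => //; apply: contraTneq uv => ->; rewrite adj_irr.
have vH : vol H L L = (k * k.-1)%N by rewrite vol_clique ?cL // => u v uL _; exact: HL.
have vGH : (vol G L L <= k * k.-1)%N.
  rewrite -vH; apply: leq_sum => u uL; apply: leq_sum => v vL.
  by case E: (G u v) => //; rewrite (GH _ _ uL vL E).
have sB : 0 <= \sum_(u in deficient G L) x u by apply: sumr_ge0.
have hL : qsum G x L L + 9 / 16 * ((k * k.-1)%:R - (vol G L L)%:R) <= qsum H x L L.
  rewrite -vH; apply: qsum_deficit_ge => // u v uL vL.
  by have := xL u uL; have := xL v vL; nra.
have hq : qform (swap G L) x + 1 / 2 * ((k * k.-1)%:R - (vol G L L)%:R) <= qform H x.
  rewrite !(qsum_split _ _ L) swap_qsum_out.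
  have -> : qsum (swap G L) x L (~: L) = qsum H x L (~: L).
    apply: eq_qsum => u v uL; rewrite inE => vL.
    by rewrite (LC _ _ uL vL) (swap_joined _ uL vL).
  have -> : qsum (swap G L) x L L = qsum G x L L.
    by apply: eq_qsum => u v uL vL; apply: swap_off; rewrite !inE ?uL ?vL.
  by rewrite -/W; lra.
have m0 : 0 <= (k * k.-1)%:R - (vol G L L)%:R :> R by rewrite subr_ge0 ler_nat.
have [|eq exH] := @eigen_transfer _ _ G H x ex _ le; first by lra.
have xp : forall u, 0 < x u by apply: (@joined_gt0 _ _ H x _ L) => //; rewrite cL.
split=> //.
- by apply: (deficient_eq0 xp); lra.
- by rewrite -(ler_nat R); lra.
Qed.

Lemma near_natP (P : nat -> Prop) :
  ((\forall n \near \oo, P n)%classic) <-> exists N : nat, forall n, (N <= n)%N -> P n.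
Proof.
split; first by move=> [N _ hN]; exists N => n; exact: hN.
by move=> [N hN]; exists N => // n /= le; exact: hN.
Qed.

Lemma vol_eq0 (T : finType) (G : sgraph T) (S S' : {set T}) :
  vol G S S' = 0%N -> forall u v, u \in S -> v \in S' -> G u v = false.
Proof.
move=> /eqP; rewrite sum_nat_eq0 => /forall_inP h u v uS vS.
have := h u uS; rewrite sum_nat_eq0 => /forall_inP/(_ v vS).
by case: (G u v).
Qed.

Lemma vol_le (T : finType) (G H : sgraph T) (S S' : {set T}) :
  (forall u v, u \in S -> v \in S' -> G u v -> H u v) -> (vol G S S' <= vol H S S')%N.
Proof.
move=> GH; apply: leq_sum => u uS; apply: leq_sum => v vS.
by case E: (G u v) => //; rewrite (GH _ _ uS vS E).
Qed.

Lemma vol_lt (T : finType) (G H : sgraph T) (S S' : {set T}) (u v : T) :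
  (forall u v, u \in S -> v \in S' -> G u v -> H u v) ->
  u \in S -> v \in S' -> H u v -> ~~ G u v -> (vol G S S' < vol H S S')%N.
Proof.
move=> GH uS vS Huv /negbTE nG; rewrite /vol (bigD1 u) //= [ltnRHS](bigD1 u) //=.
rewrite (bigD1 v) //= [in ltnRHS](bigD1 v) //= nG Huv -!addnA !addSn !add0n ltnS.
apply: leq_add.
  by apply: leq_sum => w /andP[wS _]; case E: (G u w) => //; rewrite (GH _ _ uS wS E).
apply: leq_sum => t /andP[tS _]; apply: leq_sum => w wS.
by case E: (G t w) => //; rewrite (GH _ _ tS wS E).
Qed.

Lemma isog_gjoin (S T S' T' : Type) (G : sgraph S) (H : sgraph T) (G' : sgraph S')
    (H' : sgraph T') : isog G G' -> isog H H' -> isog (gjoin G H) (gjoin G' H').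
Proof.
move=> [f [f' fK f'K] fh] [g [g' gK g'K] gh].
exists (fun s => match s with inl a => inl (f a) | inr b => inr (g b) end).
  exists (fun s => match s with inl a => inl (f' a) | inr b => inr (g' b) end).
    by case=> a; rewrite ?fK ?gK.
  by case=> a; rewrite ?f'K ?g'K.
by move=> [a|b] [a'|b'] //=.
Qed.

Lemma isog_refl (T : Type) (G : sgraph T) : isog G G.
Proof. by exists id => //; exists id. Qed.

Lemma isog_eq (T : Type) (G H : sgraph T) : (forall u v, G u v = H u v) -> isog G H.
Proof. by move=> GH; exists id => //; exists id. Qed.

Lemma split_proj (T : finType) (n k : nat) (L : {set T}) : #|T| = n -> #|L| = k ->
  exists f : 'I_k + 'I_(n - k) -> T, exists g : T -> 'I_k + 'I_(n - k),
    [/\ cancel f g, cancel g f, forall a, f (inl a) \in L & forall b, f (inr b) \notin L].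
Proof.
by move=> cT cL; have [f [[g fK gK] fl fr]] := split_bij cT cL; exists f, g.
Qed.

(** Places a copy of $K_k+Z$ on the vertex set of [G] with its clique on [L], so that both forms can
    be evaluated at the same vector. The numbering [h] of the outer vertices does not depend on
    [Z]. *)
Lemma join_model (T : finType) (n k : nat) (L : {set T}) : #|T| = n -> #|L| = k ->
  exists h : 'I_(n - k) -> T,
    [/\ injective h, forall j, h j \notin L, forall u, u \notin L -> exists j, u = h j &
     forall Z : sgraph 'I_(n - k), exists J : sgraph T,
      [/\ isog J (gjoin (complete 'I_k) Z), forall u v, u \in L -> u != v -> J u v &
          forall i j, J (h i) (h j) = Z i j]].
Proof.
move=> cT cL; have [f [g [fK gK fl fr]]] := split_proj cT cL.
exists (fun j => f (inr j)); split=> //.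
- by move=> i j /(can_inj fK) [].
- move=> u uL; case E: (g u) => [a|b]; last by exists b; rewrite -E gK.
  by move: (fl a) uL; rewrite -E gK => ->.
- move=> Z; exists (pullback g (gjoin (complete 'I_k) Z)); split.
  + by apply: isog_pullback; exists f.
  + move=> u v uL uv /=; case gu: (g u) => [a|b]; last first.
      by move: (fr b); rewrite -gu gK uL.
    case gv: (g v) => [a'|//]; rewrite /= /complete_rel; apply: contraNneq uv => aa.
    by rewrite -(gK u) -(gK v) gu gv aa.
  + by move=> i j /=; rewrite !fK.
Qed.

(** The edge budget lets pairs missing in [L] be traded for edges among common neighbours, but a
    trade loses weight, so [clique_join_wins] applies and leaves [G] inside [J]. The disjunction
    reflects how the edge of (c) is placed: on an edge of [G] among the common neighbours if there
    is one, and anywhere otherwise. *)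
Lemma clique_join_unique (R : realType) (n k e : nat) (G J : sgraph 'I_n) (x : 'I_n -> R)
    (L : {set 'I_n}) :
  let W := common_nbrs G L in
  (0 < k)%N -> eigvec01 G x (spectral_radius R G) -> #|L| = k ->
  (forall u, u \in L -> 3 / 4 <= x u) -> (forall u, u \notin L -> x u <= 1 / 4) ->
  qform G x + \sum_(u in deficient G L) x u <= qform (swap G L) x ->
  (forall u v, u \in L -> u != v -> J u v) ->
  vol G W W = 0%N \/
    (forall u v, u \in W -> v \in W -> J u v -> G u v) /\ (e <= vol J W W)%N ->
  (vol G L L + vol G W W <= k * k.-1 + e)%N ->
  spectral_radius R J <= spectral_radius R G -> isog G J.
Proof.
move=> W k0 ev cL xL xnL gain JL hJ hvol le.
have x0 u : 0 <= x u by have /andP[] := ev.1 u.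
have WL u : u \in W -> u \notin L.
  move=> uW; apply/negP => uL; have /pred0P/(_ u) := common_nbrs_disjoint G L.
  by rewrite /= uL uW.
have sW : W \subset ~: L by apply/fintype.subsetP => u uW; rewrite inE WL.
have vLL : (vol G L L <= k * k.-1)%N.
  rewrite -cL -(@vol_clique _ J); last by move=> u v uL _; exact: JL.
  by apply: vol_le => u v uL _ uv; apply: JL => //; apply: contraTneq uv => ->; rewrite adj_irr.
have hQ : qsum G x W W <= qsum J x (~: L) (~: L) + 1 / 16 * ((k * k.-1)%:R - (vol G L L)%:R).
  apply: le_trans (_ : qsum J x W W + 1 / 16 * ((k * k.-1)%:R - (vol G L L)%:R) <= _); last first.
    by rewrite lerD2r qsum_subset.
  case: hJ => [v0|[JG eJ]].
    rewrite qsum_eq0; last exact: vol_eq0.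
    apply: addr_ge0; last by rewrite mulr_ge0 // subr_ge0 ler_nat.
    by apply: sumr_ge0 => u _; apply: sumr_ge0 => v _; rewrite !mulr_ge0.
  apply: le_trans (_ : qsum J x W W + 1 / 16 * ((vol G W W)%:R - (vol J W W)%:R) <= _).
    apply: qsum_excess_le => // u v uW vW.
    by have := xnL u (WL u uW); have := xnL v (WL v vW); have := x0 u; have := x0 v; nra.
  rewrite lerD2l ler_pM2l // lerBlDr addrAC lerBrDr -!natrD ler_nat.
  by rewrite addnC; apply: leq_trans hvol _; rewrite leq_add2l.
have [B0 vk xp eq] := clique_join_wins k0 ev cL xL gain JL hQ le.
have inW u : u \notin L -> u \in W.
  move=> uL; have : u \notin deficient G L by rewrite B0 finset.in_set0.
  by rewrite /deficient finset.in_setC finset.in_setU (negbTE uL) negbK.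
have vW : (vol G W W <= e)%N by lia.
have GJ u v : G u v -> J u v.
  move=> uv; have nuv : u != v by apply: contraTneq uv => ->; rewrite adj_irr.
  have [uL|uL] := boolP (u \in L); first exact: JL.
  have [vL|vL] := boolP (v \in L); first by rewrite adj_sym; apply: JL; rewrite // eq_sym.
  case: hJ => [v0|[JG eJ]].
    by move: uv; rewrite (vol_eq0 v0) // inW.
  apply: contraT => nJ.
  by have := vol_lt JG (inW u uL) (inW v vL) uv nJ; lia.
by apply: isog_eq; apply: (qform_le_eq xp GJ); rewrite eq.
Qed.

Lemma edge_model (n : nat) (S : {set 'I_n}) : #|S| = 2 ->
  exists Z : sgraph 'I_n, isog Z (gunion (complete 'I_2) (gcompl (complete 'I_(n - 2)))) /\
    forall i j, Z i j = [&& i != j, i \in S & j \in S].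
Proof.
move=> cS; have [f [g [fK gK fl fr]]] := split_proj (card_ord n) cS.
have gi := can_inj gK.
exists (pullback g (gunion (complete 'I_2) (gcompl (complete 'I_(n - 2))))); split.
  by apply: isog_pullback; exists f.
have mem i : (i \in S) = (if g i is inl _ then true else false).
  by rewrite -{1}(gK i); case: (g i) => a; rewrite ?fl ?(negbTE (fr _)).
move=> i j /=; rewrite -(inj_eq gi) !mem.
case: (g i) (g j) => [a|a] [b|b] //=; rewrite ?andbF //.
  by rewrite !andbT.
by rewrite /gcompl_rel /= /complete_rel andbN.
Qed.

(** * Uniqueness of the extremal graph in cases (a), (b) and (c) *)

Definition core_spec (R : realType) (n k : nat) (G : sgraph 'I_n) (x : 'I_n -> R)
    (L : {set 'I_n}) : Prop :=
  [/\ eigvec01 G x (spectral_radius R G), #|L| = k /\ (n <= 2 * #|common_nbrs G L|)%N,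
      forall u, u \in L -> 3 / 4 <= x u, forall u, u \notin L -> x u <= 1 / 4 &
      qform G x + \sum_(u in deficient G L) x u <= qform (swap G L) x].

Definition few_common (F : graph_family) (k M : nat) : Prop :=
  forall (T : finType) (G : sgraph T), family_free F G ->
  forall S : {set T}, (k < #|S|)%N -> (#|common_nbrs G S| < M)%N.

Lemma core_eventually (R : realType) (F : graph_family) (M k : nat) (H : forall n, sgraph 'I_n) :
  (0 < k)%N -> few_common F k M ->
  ((fun n : nat => (ex_number n F)%:R : R^o) =O_\oo (fun n : nat => n%:R : R^o))%classic ->
  ((\forall n \near \oo, EX (bipartite 'I_k 'I_(n - k)) n F (H n)))%classic ->
  exists N : nat, forall n, (N <= n)%N ->
    [/\ EX (bipartite 'I_k 'I_(n - k)) n F (H n), (k.+2 <= n)%N,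
        k%:R * (n%:R - k%:R) <= spectral_radius R (H n) ^+ 2 &
        0 <= spectral_radius R (H n) /\
        forall G : sgraph 'I_n, family_free F G ->
          spectral_radius R (H n) <= spectral_radius R G ->
          exists x : 'I_n -> R, exists L : {set 'I_n}, core_spec k G x L].
Proof.
move=> k0 hM hO /near_natP[N1 hEX].
have [C hC] := sparse_of_ex hO.
have [n0 hcore] := core R k0 hC hM.
exists (N1 + n0 + k.+2)%N => n leN.
have EXn := hEX n ltac:(lia).
have [_ cH _] := EXn.
have [l0 l2] : 0 <= spectral_radius R (H n) /\
    k%:R * (n%:R - k%:R) <= spectral_radius R (H n) ^+ 2.
  by apply: biclique_radius => //; apply/andP; split=> //; lia.
split=> //; first by lia.
split=> // G fG le; apply: hcore => //; first by lia.
  exact: le_trans le.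
apply: le_trans l2 _; rewrite ler_sqr ?nnegrE //; exact: le_trans le.
Qed.

(** Treats every free graph whose radius is at least that of [H n], not only extremal ones; this is
    what also shows that [H n] itself is extremal. *)
Lemma case_abc_unique (R : realType) (F : graph_family) (M k : nat) (H : forall n, sgraph 'I_n) :
  (0 < k)%N -> few_common F k M ->
  ((fun n : nat => (ex_number n F)%:R : R^o) =O_\oo (fun n : nat => n%:R : R^o))%classic ->
  ((\forall n \near \oo, EX (bipartite 'I_k 'I_(n - k)) n F (H n)))%classic ->
  case_a k H \/ case_b k H \/ case_c k H ->
  exists N : nat, forall n, (N <= n)%N -> forall G : sgraph 'I_n, family_free F G ->
    spectral_radius R (H n) <= spectral_radius R G -> isog G (H n).
Proof.
move=> k0 hM hO hEX.
have [N0 hN0] := core_eventually k0 hM hO hEX.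
(* The biclique spans only [L] and its common neighbours, so the edge bound comes from the extremal
   graph of order [n']. Since $n\le 2n'$, that order is large as well. *)
have excess n (G : sgraph 'I_n) x L : (2 * N0 <= n)%N -> family_free F G ->
    core_spec k G (x : 'I_n -> R) L ->
    let n' := (k + #|common_nbrs G L|)%N in
    (N0 <= n')%N /\ (n <= 2 * n')%N /\ (vol G L L + vol G (common_nbrs G L) (common_nbrs G L) +
      2 * (k * (n' - k)) <= vol (H n') [set: _] [set: _])%N.
  move=> len fG [ev [cL hW] _ _ _] n'.
  have len' : (N0 <= n')%N by lia.
  split=> //; split; first by lia.
  have [EXn' _ _ _] := hN0 n' len'.
  have := core_excess (erefl n') fG cL EXn'.
  by rewrite /n' addKn.
have subW n (G : sgraph 'I_n) (L : {set 'I_n}) u :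
    deficient G L = finset.set0 -> u \notin L -> u \in common_nbrs G L.
  move=> B0 uL; have : u \notin deficient G L by rewrite B0 finset.in_set0.
  by rewrite /deficient finset.in_setC finset.in_setU (negbTE uL) negbK.
(* Shared by (b) and (c). The graph outside the clique has the same number [e] of ordered adjacent
   pairs at every large order, so the bound obtained at order [n'] can be used at order [n]. *)
have finish e (V : nat -> finType) (Z : forall n, sgraph (V n)) N1 :
  (forall n, (k.+2 <= n)%N -> #|V n| = (n - k)%N) ->
  (forall n, (N1 <= n)%N -> isog (H n) (gjoin (complete 'I_k) (Z n))) ->
  (forall n, (N1 <= n)%N -> (k.+2 <= n)%N -> vol (Z n) [set: _] [set: _] = e) ->
  (forall n (G : sgraph 'I_n) (L : {set 'I_n}) (h : 'I_(n - k) -> 'I_n), (N1 <= n)%N ->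
     (k.+2 <= n)%N -> #|L| = k -> injective h -> (forall u, u \notin L -> exists j, u = h j) ->
     (forall j, h j \notin L) ->
     exists Z' : sgraph 'I_(n - k), isog Z' (Z n) /\
      let W := common_nbrs G L in
      (vol G W W = 0%N \/
       [/\ forall i j, h i \in W -> h j \in W -> Z' i j -> G (h i) (h j) &
        forall J : sgraph 'I_n, (forall i j, J (h i) (h j) = Z' i j) ->
          (e <= vol J W W)%N])) ->
  exists N : nat, forall n, (N <= n)%N -> forall G : sgraph 'I_n, family_free F G ->
    spectral_radius R (H n) <= spectral_radius R G -> isog G (H n).
  move=> cV hZ vZ cZ; exists (2 * N0 + 2 * N1)%N => n len G fG le.
  have [_ kn _ [_ hc]] := hN0 n ltac:(lia).
  have [x [L cs]] := hc G fG le.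
  have [len' [nn' ex]] := excess n G x L ltac:(lia) fG cs.
  move: (cs) => [ev [cL hW] xL xnL gain].
  have [h [hi hL hs hJ]] := join_model (card_ord n) cL.
  have [Z' [ZZ' hW']] := cZ n G L h ltac:(lia) kn cL hi hs hL.
  have [J [JZ JL Jh]] := hJ Z'.
  have JH : isog J (H n).
    apply: isog_trans JZ _; apply: isog_trans (isog_gjoin (isog_refl _) ZZ') _.
    by apply: isog_sym; apply: hZ; lia.
  apply: (isog_trans _ JH).
  set n' := (k + _)%N in len' nn' ex.
  have [_ kn' _ _] := hN0 n' len'.
  have vol' : (vol G L L + vol G (common_nbrs G L) (common_nbrs G L) <= k * k.-1 + e)%N.
    move: ex; rewrite (isog_vol (hZ n' _)) ?vol_gjoin ?vol_complete ?card_ord; last by lia.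
    by rewrite vZ ?cV; lia.
  apply: (clique_join_unique k0 ev cL xL xnL gain JL _ vol').
    case: hW' => [|[h1 h2]]; [by left | right; split; last exact: h2].
    move=> u v uW vW.
    have WL w : w \in common_nbrs G L -> w \notin L.
      move=> wW; apply/negP => wL; have /pred0P/(_ w) := common_nbrs_disjoint G L.
      by rewrite /= wL wW.
    have [i ui] := hs u (WL u uW); have [j vj] := hs v (WL v vW).
    by subst u v; rewrite Jh; exact: h1.
  by rewrite (isog_spectral_radius R JH).
case=> [/near_natP[N1 ha]|[/near_natP[N1 hb]|/near_natP[N1 hc]]].
(* In (a) the edge bound leaves no edge inside [L] or among its common neighbours, so the swapped
   graph is already a subgraph of the biclique with side [L], and no trade of weights occurs. *)
- exists (2 * N0 + 2 * N1)%N => n len G fG le.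
  have [_ kn _ [_ hc]] := hN0 n ltac:(lia).
  have [x [L cs]] := hc G fG le.
  have [len' [nn' ex]] := excess n G x L ltac:(lia) fG cs.
  move: (cs) => [[x01 exv] [cL hW] xL xnL gain].
  have x0 u : 0 <= x u by have /andP[] := x01 u.
  set n' := (k + _)%N in len' nn' ex.
  have vol0 : (vol G L L + vol G (common_nbrs G L) (common_nbrs G L))%N = 0%N.
    move: ex; rewrite (isog_vol (ha n' _)) ?vol_bipartite ?card_ord; last by lia.
    by rewrite -[leqRHS]add0n leq_add2r leqn0 => /eqP.
  have vL : vol G L L = 0%N by lia.
  have vW : vol G (common_nbrs G L) (common_nbrs G L) = 0%N by lia.
  have [f [g [fK gK fl fr]]] := split_proj (card_ord n) cL.
  pose J := pullback g (bipartite 'I_k 'I_(n - k)).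
  have JH : isog J (H n).
    apply: isog_trans (isog_sym (ha n _)); last by lia.
    by apply: isog_pullback; exists f.
  have mem u : (u \in L) = (if g u is inl _ then true else false).
    by rewrite -{1}(gK u); case: (g u) => a; rewrite ?fl ?(negbTE (fr _)).
  have JE u v : J u v = (u \in L) (+) (v \in L).
    by rewrite !mem /=; case: (g u) (g v) => [a|a] [b|b].
  apply: (isog_trans _ JH).
  have JLC u v : u \in L -> v \notin L -> J u v by move=> uL nvL; rewrite JE uL (negbTE nvL).
  have swJ u v : swap G L u v -> J u v.
    have LB w : w \in L -> w \notin deficient G L.
      by move=> wL; apply/negP => /deficientN; rewrite wL.
    rewrite JE; have [uL|uL] := boolP (u \in L); have [vL'|vL'] := boolP (v \in L) => //.
      by rewrite swap_off ?LB // (vol_eq0 vL).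
    move=> sw; have [uB|uB] := boolP (u \in deficient G L).
      by move: sw; rewrite /= /swap_rel uB (negbTE vL').
    have [vB|vB] := boolP (v \in deficient G L).
      by move: sw; rewrite adj_sym /= /swap_rel vB (negbTE uL).
    move: sw; rewrite swap_off //.
    have inW w : w \notin L -> w \notin deficient G L -> w \in common_nbrs G L.
      by move=> wL; rewrite /deficient finset.in_setC finset.in_setU (negbTE wL) negbK.
    by rewrite (vol_eq0 vW) // inW.
  have qJ : qform (swap G L) x <= qform J x by apply: qform_le.
  have sB : 0 <= \sum_(u in deficient G L) x u by apply: sumr_ge0.
  have [||eq exJ] := @eigen_transfer _ _ G J x exv; first by lra.
    by rewrite (isog_spectral_radius R JH).
  have xp : forall u, 0 < x u by apply: (@joined_gt0 _ _ J x _ L) => //; rewrite cL.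
  have B0 : deficient G L = finset.set0 by apply: (deficient_eq0 xp); lra.
  have GJ u v : G u v -> J u v.
    rewrite JE; have [uL|uL] := boolP (u \in L); have [vL'|vL'] := boolP (v \in L) => //.
      by rewrite (vol_eq0 vL).
    by rewrite (vol_eq0 vW) // subW.
  by apply: isog_eq; apply: (qform_le_eq xp GJ); rewrite eq.
- apply: (finish 0%N (fun n => 'I_(n - k)) (fun n => gcompl (complete 'I_(n - k))) N1 _ hb).
    by move=> n _; exact: card_ord.
    by move=> n _ _; exact: vol_gcompl_complete.
  move=> n G L h _ _ _ _ _ _; exists (gcompl (complete 'I_(n - k))); split; first exact: isog_refl.
  right; split=> // i j _ _; by rewrite /= /gcompl_rel /= /complete_rel andbN.
- apply: (finish 2 (fun n => ('I_2 + 'I_(n - k - 2))%type) _  N1 _ hc).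
    by move=> n kn; rewrite card_sum !card_ord; lia.
    by move=> n _ _; rewrite vol_gunion vol_complete vol_gcompl_complete card_ord.
  move=> n G L h _ kn cL hi hs hL; set W := common_nbrs G L.
  have WL w : w \in W -> w \notin L.
    move=> wW; apply/negP => wL; have /pred0P/(_ w) := common_nbrs_disjoint G L.
    by rewrite /= wL wW.
  (* Position of the single edge of (c): an edge of [G] among the common neighbours when one exists,
     otherwise an arbitrary pair. *)
  have [i [j [ij hij]]] : exists i j : 'I_(n - k), i != j /\
      (vol G W W = 0%N \/ [/\ h i \in W, h j \in W & G (h i) (h j)]).
    have [v0|] := eqVneq (vol G W W) 0%N.
      have n2 : (1 < n - k)%N by lia.
      by exists (Ordinal (ltnW n2)), (Ordinal n2); split=> //; left.
    rewrite sum_nat_eq0 negb_forall_in => /exists_inP[u uW].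
    rewrite sum_nat_eq0 negb_forall_in => /exists_inP[v vW]; rewrite eqb0 negbK => uv.
    have [i ui] := hs u (WL u uW); have [j vj] := hs v (WL v vW); subst u v.
    exists i, j; split; last by right.
    by apply: contraTneq uv => ->; rewrite adj_irr.
  have cS : #|[set i; j]| = 2 by rewrite cards2 ij.
  have [Z' [ZZ ZE]] := edge_model cS.
  exists Z'; split=> //; case: hij => [v0|[iW jW Gij]]; [by left | right; split].
    move=> a b _ _; rewrite ZE !finset.in_set2 => /and3P[ab /orP[]/eqP ea /orP[]/eqP eb]; subst a b => //.
    - by rewrite eqxx in ab.
    - by rewrite adj_sym.
    - by rewrite eqxx in ab.
  move=> J JE; apply: leq_trans (_ : vol J [set h i; h j] [set h i; h j] <= _)%N; last first.
    by apply: volS; apply/fintype.subsetP => u; rewrite finset.in_set2 => /orP[]/eqP->.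
  have Jij : J (h i) (h j) by rewrite JE ZE ij !finset.in_set2 !eqxx orbT.
  rewrite vol_clique; first by rewrite cards2 (inj_eq hi) ij.
  move=> u v; rewrite !finset.in_set2 => /orP[]/eqP-> /orP[]/eqP-> //; rewrite ?eqxx //.
  by rewrite adj_sym.
Qed.

Lemma isog_family_free (F : graph_family) (S T : Type) (G : sgraph S) (H : sgraph T) :
  isog G H -> family_free F H -> family_free F G.
Proof. by move=> /isog_contains; exact: family_free_sub. Qed.

Lemma case_abc_SPEX (R : realType) (F : graph_family) (M k : nat) (H : forall n, sgraph 'I_n) :
  (0 < k)%N -> few_common F k M ->
  ((fun n : nat => (ex_number n F)%:R : R^o) =O_\oo (fun n : nat => n%:R : R^o))%classic ->
  ((\forall n \near \oo, EX (bipartite 'I_k 'I_(n - k)) n F (H n)))%classic ->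
  case_a k H \/ case_b k H \/ case_c k H ->
  (\forall n \near \oo, forall G : sgraph 'I_n, SPEX R n F G <-> isog G (H n))%classic.
Proof.
move=> k0 hM hO hEX cases.
have [N1 h1] := case_abc_unique k0 hM hO hEX cases.
have [N2 h2] := (near_natP _).1 hEX.
apply/near_natP; exists (N1 + N2)%N => n len G.
have [fH _ _] := h2 n ltac:(lia).
split=> [[fG hmax]|GH]; first by apply: (h1 n ltac:(lia) G fG); exact: hmax.
split=> [|G' fG']; first exact: isog_family_free fH.
rewrite (isog_spectral_radius R GH).
have [le|/ltW //] := leP (spectral_radius R (H n)) (spectral_radius R G').
by rewrite (isog_spectral_radius R (h1 n ltac:(lia) G' fG' le)).
Qed.

(** * Finite families: extremal graphs are joins with a clique *)

(** The neighbours of [v] off [L] are common neighbours of the $k+1$ vertices in $L\cup\{v\}$. *)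
Lemma outer_degree (F : graph_family) (M k : nat) (T : finType) (G : sgraph T) (L : {set T}) :
  few_common F k M -> family_free F G -> #|L| = k ->
  (forall u v, u \in L -> v \notin L -> G u v) ->
  forall v, v \notin L -> (vol G [set v] (~: L) <= M)%N.
Proof.
move=> hM fG cL GL v vL; apply: ltnW; apply: leq_ltn_trans (hM _ _ fG (v |: L) _); last first.
  by rewrite cardsU1 vL cL add1n.
rewrite vol_set1l -sum1_card big_mkcond [leqRHS]big_mkcond; apply: leq_sum => w _.
case: ifP => //; rewrite inE => wL; case: ifP => [_|]; first by case: (G v w).
move=> /common_nbrsP nw; case E: (G v w) => //; case: nw => u.
by rewrite !inE => /orP[/eqP->//|uL]; exact: GL.
Qed.

(** The swapped graph is free and cannot have a larger radius, so [eigen_transfer] makes the gain of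
    the swap vanish. As [x] is positive, the deficient set is empty. *)
Lemma SPEX_joined (R : realType) (F : graph_family) (M k : nat) (H : forall n, sgraph 'I_n) :
  (0 < k)%N -> finite_set F -> few_common F k M ->
  ((fun n : nat => (ex_number n F)%:R : R^o) =O_\oo (fun n : nat => n%:R : R^o))%classic ->
  ((\forall n \near \oo, EX (bipartite 'I_k 'I_(n - k)) n F (H n)))%classic ->
  exists N : nat, forall n, (N <= n)%N -> forall G : sgraph 'I_n, SPEX R n F G ->
    exists x : 'I_n -> R, exists L : {set 'I_n},
      core_spec k G x L /\ (forall u v, u \in L -> v \notin L -> G u v).
Proof.
move=> k0 fF hM hO hEX.
have [m hm] := finite_family_bound fF.
have [N0 hN0] := core_eventually k0 hM hO hEX.
exists (N0 + 4 * m)%N => n len G [fG hmax].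
have [[fH _ _] _ _ [_ hc]] := hN0 n ltac:(lia).
have [x [L cs]] := hc G fG (hmax _ fH).
exists x, L; split=> //; move: (cs) => [[x01 ex] [cL hW] xL xnL gain].
have x0 u : 0 <= x u by have /andP[] := x01 u.
have fS : family_free F (swap G L) by apply: (swap_free hm) => //; rewrite ?cL //; lia.
have sB : 0 <= \sum_(u in deficient G L) x u by apply: sumr_ge0.
have [||eq exS] := @eigen_transfer _ _ G (swap G L) x ex; [by lra | exact: hmax |].
have xp : forall u, 0 < x u.
  by apply: (@joined_gt0 _ _ (swap G L) x _ L) => //; rewrite ?cL //; exact: swap_joined.
have B0 : deficient G L = finset.set0 by apply: (deficient_eq0 xp); lra.
move=> u v uL vL.
have : v \notin deficient G L by rewrite B0 finset.in_set0.
rewrite /deficient finset.in_setC finset.in_setU (negbTE vL) negbK => /common_nbrsP; exact.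
Qed.

Lemma adjop_split (R : realType) (T : finType) (G : sgraph T) (x : T -> R) (L : {set T}) v :
  v \notin L -> (forall u, u \in L -> G u v) ->
  adjop G x v = \sum_(u in L) x u + \sum_(w in ~: L) (G v w)%:R * x w.
Proof.
move=> vL GL; rewrite /adjop (bigID (mem L)) /=; congr (_ + _).
  by apply: eq_bigr => u uL; rewrite adj_sym GL // mul1r.
by apply: eq_bigl => w; rewrite inE.
Qed.

(** Off [L] the eigenvalue equation reads $l x_v=\sum_{u\in L}x_u$ plus at most [M] outer entries.
    Dropping these gives one bound; at the largest outer entry each of them is at most that entry,
    which gives the other. *)
Lemma outer_weight_bounds (R : realType) (M : nat) (T : finType) (G : sgraph T) (x : T -> R)
    (l : R) (L : {set T}) :
  eigvec01 G x l -> (forall u v, u \in L -> v \notin L -> G u v) ->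
  (forall v, v \notin L -> (vol G [set v] (~: L) <= M)%N) ->
  forall v, v \notin L ->
    \sum_(u in L) x u <= l * x v /\ (l - M%:R) * x v <= \sum_(u in L) x u \/ l <= M%:R.
Proof.
move=> [x01 ex] GL hM v vL.
have x0 u : 0 <= x u by have /andP[] := x01 u.
have [|lM] := leP l M%:R; [by right | left]; split.
  rewrite -ex (adjop_split x vL) => [|u uL]; last exact: GL.
  by rewrite lerDl; apply: sumr_ge0 => w _; exact: mulr_ge0.
pose P := [pred u | u \notin L].
have [z zL hz] := Order.TotalTheory.arg_maxP x (vL : P v).
apply: le_trans (_ : (l - M%:R) * x z <= _).
  by apply: ler_wpM2l; [rewrite subr_ge0 ltW | exact: hz].
rewrite mulrBl -ex (adjop_split x zL) => [|u uL]; last exact: GL.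
rewrite lerBlDr lerD2l.
apply: le_trans (_ : (vol G [set z] (~: L))%:R * x z <= _); last first.
  by apply: ler_wpM2r => //; rewrite ler_nat; exact: hM.
rewrite vol_set1l natr_sum mulr_suml; apply: ler_sum => w; rewrite inE => wL.
by apply: ler_wpM2l => //; exact: hz.
Qed.

Lemma vol_join_bound (M : nat) (T : finType) (G : sgraph T) (S : {set T}) :
  (forall v, v \in S -> (vol G [set v] S <= M)%N) -> (vol G S S <= M * #|T|)%N.
Proof.
move=> hM; apply: (@leq_trans (\sum_(v in S) M)).
  by apply: leq_sum => v vS; have := hM v vS; rewrite vol_set1l.
by rewrite sum_nat_const mulnC leq_mul2l max_card orbT.
Qed.

(* With [s] the number of missing pairs in [L], [a <= x <= b] off [L] and [b - a = O(a/l)]: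
   comparing with [K_k + X] gives [9/16 s + vX a^2 <= vY b^2], while [vY <= vX + s]. *)
Lemma join_compare_arith (R : realType) (M k n s l a b sg vX vY : R) :
  0 <= M -> 1 <= k -> 48 * M ^+ 2 * k ^+ 2 + 2 * M + 2 * k + 1 <= l -> 0 < n ->
  n <= 2 * l ^+ 2 -> 0 <= s -> 0 <= sg <= k -> l * a = sg -> (l - M) * b = sg ->
  9 / 16 * s + vX * a ^+ 2 <= vY * b ^+ 2 -> 0 <= vY <= M * n -> vY <= vX + s ->
  0 < sg ->
  s < 1 /\ (s = 0 -> (vX - vY) * l <= 6 * M ^+ 2 * n).
Proof.
move=> M0 k1 hl n0 nl s0 sgk la lb main vYM vYs sg0.
have k2 : 0 <= k ^+ 2 by exact: sqr_ge0.
have M2 : 0 <= M ^+ 2 by exact: sqr_ge0.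
have Mk : 0 <= M ^+ 2 * k ^+ 2 by exact: mulr_ge0.
have l0 : 0 < l by lra.
have lM : 0 < l - M by lra.
have a0 : 0 < a by rewrite -(pmulr_rgt0 _ l0) la.
have b0 : 0 < b by rewrite -(pmulr_rgt0 _ lM) lb.
have b2a : b <= 2 * a.
  have : l * b <= l * (2 * a).
    have : 0 <= (l - 2 * M) * b by rewrite mulr_ge0 ?ltW //; lra.
    lra.
  by rewrite ler_pM2l.
(* Since $l(b-a)=Mb$, the left side equals $Mb(b+a)$, and $b\le 2a$ bounds it. *)
have hba : l * (b ^+ 2 - a ^+ 2) <= 6 * M * a ^+ 2.
  have -> : l * (b ^+ 2 - a ^+ 2) = (l * b - l * a) * (b + a) by lra.
  have -> : l * b - l * a = M * b by lra.
  have : 0 <= M * ((2 * a - b) * (b + 3 * a)) by apply: mulr_ge0 => //; apply: mulr_ge0; lra.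
  lra.
have h1 : l * (vY * (b ^+ 2 - a ^+ 2)) <= 6 * M ^+ 2 * n * a ^+ 2.
  apply: le_trans (_ : vY * (6 * M * a ^+ 2) <= _).
    by rewrite mulrCA; apply: ler_wpM2l => //; lra.
  have : 0 <= (M * n - vY) * (M * a ^+ 2).
    by apply: mulr_ge0; [lra | apply: mulr_ge0 => //; exact: sqr_ge0].
  lra.
have h2 : l * (9 / 16 * s) + l * ((vX - vY) * a ^+ 2) <= 6 * M ^+ 2 * n * a ^+ 2.
  have := ler_wpM2l (ltW l0) main; lra.
have la2 : l ^+ 2 * a ^+ 2 <= k ^+ 2 by rewrite -exprMn la; nra.
have na2 : n * a ^+ 2 <= 2 * k ^+ 2.
  have : 0 <= (2 * l ^+ 2 - n) * a ^+ 2 by apply: mulr_ge0; [lra | exact: sqr_ge0].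
  lra.
split.
  have h3 : l * ((vY - vX) * a ^+ 2) <= l * (s * a ^+ 2).
    by rewrite ler_pM2l //; apply: ler_wpM2r; [exact: sqr_ge0 | lra].
  have h4 : a ^+ 2 <= 1 / 4.
    have : l ^+ 2 * a ^+ 2 <= l ^+ 2 * (1 / 4).
      apply: le_trans la2 _; nra.
    by rewrite ler_pM2l // exprn_gt0.
  have h5 : l * (s * a ^+ 2) <= l * (s * (1 / 4)) by rewrite ler_pM2l //; exact: ler_wpM2l.
  have h6 : 6 * M ^+ 2 * n * a ^+ 2 <= 12 * (M ^+ 2 * k ^+ 2).
    have := ler_wpM2l M2 na2; lra.
  have h7 : l * (5 / 16 * s) <= l * (1 / 4) by lra.
  rewrite ler_pM2l // in h7; lra.
move=> s00; rewrite s00 in h2.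
have : ((vX - vY) * l) * a ^+ 2 <= (6 * M ^+ 2 * n) * a ^+ 2 by lra.
by rewrite ler_pM2r // exprn_gt0.
Qed.

Lemma SPEX_join (R : realType) (F : graph_family) (M k : nat) (H : forall n, sgraph 'I_n)
    (X : forall n, sgraph 'I_(n - k)) :
  (0 < k)%N -> finite_set F -> few_common F k M ->
  ((fun n : nat => (ex_number n F)%:R : R^o) =O_\oo (fun n : nat => n%:R : R^o))%classic ->
  ((\forall n \near \oo, EX (bipartite 'I_k 'I_(n - k)) n F (H n)))%classic ->
  ((\forall n \near \oo, isog (H n) (gjoin (complete 'I_k) (X n))))%classic ->
  exists N : nat, forall n, (N <= n)%N -> forall G : sgraph 'I_n, SPEX R n F G ->
    exists Y : sgraph 'I_(n - k),
      [/\ isog G (gjoin (complete 'I_k) Y), (max_degree Y <= M)%N &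
          (vol (X n) [set: _] [set: _])%:R - 12 * M%:R ^+ 2 * Num.sqrt n%:R
            <= (vol Y [set: _] [set: _])%:R :> R].
Proof.
move=> k0 fF hM hO hEX /near_natP[N2 hX].
have [N0 hN0] := core_eventually k0 hM hO hEX.
have [N1 hN1] := SPEX_joined k0 fF hM hO hEX.
have [K eK] : exists K : nat, K = (48 * M ^ 2 * k ^ 2 + 2 * M + 2 * k + 1)%N by eexists.
exists (N0 + N1 + N2 + 2 * k + 2 * K ^ 2)%N => n len G GS.
have [x [L [[ev [cL hW] xL xnL gain] GL]]] := hN1 n ltac:(lia) G GS.
have [[fH cH maxH] kn l2H [l0H _]] := hN0 n ltac:(lia).
have [fG hmax] := GS.
have hXn := hX n ltac:(lia).
have le := hmax _ fH; set l := spectral_radius R G in le ev.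
have l0 : 0 <= l by exact: le_trans le.
have l2 : k%:R * (n%:R - k%:R) <= l ^+ 2.
  by apply: le_trans l2H _; rewrite ler_sqr ?nnegrE.
have k1 : 1 <= k%:R :> R by rewrite ler1n.
have k2n : 2 * k%:R <= n%:R :> R by rewrite -natrM ler_nat; lia.
have n0 : 0 < n%:R :> R by rewrite ltr0n; lia.
have nl : n%:R <= 2 * l ^+ 2 by nra.
have Kl : K%:R <= l.
  rewrite -ler_sqr ?nnegrE //.
  have : (2 * K ^ 2)%:R <= n%:R :> R by rewrite ler_nat; lia.
  rewrite natrM natrX; lra.
have KE : K%:R = 48 * M%:R ^+ 2 * k%:R ^+ 2 + 2 * M%:R + 2 * k%:R + 1 :> R.
  by rewrite eK !natrD !natrM; lra.
have [h [hi hL hs hJ]] := join_model (card_ord n) cL.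
have imh : h @: [set: 'I_(n - k)] = ~: L.
  apply/finset.setP => u; rewrite finset.in_setC; apply/imsetP/idP => [[j _ ->]//|uL].
  by have [j ->] := hs u uL; exists j.
pose Y := pullback h G.
have volE (Z : sgraph 'I_(n - k)) (J : sgraph 'I_n) : (forall i j, J (h i) (h j) = Z i j) ->
    vol J (~: L) (~: L) = vol Z [set: _] [set: _].
  move=> JZ; rewrite -imh -(vol_pullback J) //.
  by apply: eq_bigr => i _; apply: eq_bigr => j _; rewrite -JZ.
have odeg := outer_degree hM fG cL GL.
(* [J] is the competitor $K_k+X$ drawn on the vertices of [G], with its clique on [L]. *)
have [J [JX JL Jh]] := hJ (X n).
have JH : isog J (H n) by apply: isog_trans JX _; exact: isog_sym.
have x0 u : 0 <= x u by have /andP[] := ev.1 u.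
have qJ : qform J x <= qform G x.
  have -> : qform G x = l * sqnorm x.
    by rewrite qform_adjop /sqnorm mulr_sumr; apply: eq_bigr => u _; rewrite ev.2; lra.
  apply: le_trans (rayleigh J x) _; apply: ler_wpM2r; first exact: sqnorm_ge0.
  by rewrite (isog_spectral_radius R JH).
have vJL : vol J L L = (k * k.-1)%N by rewrite vol_clique ?cL // => u v uL _; exact: JL.
have GJL u v : u \in L -> v \in L -> G u v -> J u v.
  by move=> uL _ uv; apply: JL => //; apply: contraTneq uv => ->; rewrite adj_irr.
have vGL : (vol G L L <= k * k.-1)%N by rewrite -vJL; exact: vol_le.
have dL : [disjoint L & ~: L] by rewrite -finset.setI_eq0 finset.setICr.
have volsplit (Z : sgraph 'I_n) : vol Z [set: _] [set: _] =
    (vol Z L L + vol Z (~: L) (~: L) + 2 * vol Z L (~: L))%N.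
  rewrite -(finset.setUCr L) volUl // !volUr // (volC _ (~: L) L).
  by rewrite mul2n -addnn [RHS]addnACA [in RHS](addnC (vol Z (~: L) (~: L))).
set vX := vol (X n) _ _; set vY := vol Y [set: _] [set: _].
have JLC u v : u \in L -> v \notin L -> J u v.
  by move=> uL vL; apply: JL => //; apply: contraNneq vL => <-.
have vols : (vY + vol G L L <= vX + k * k.-1)%N.
  have : (nb_edges G <= nb_edges (H n))%N.
    by apply: maxH => //; apply: contains_biclique GL => //; exact: card_ord.
  rewrite -(leq_pmul2l (isT : (0 < 2)%N)) -!handshake -(isog_vol JH) !volsplit.
  rewrite (volE _ _ Jh) (volE Y G) // vJL -/vX -/vY.
  have -> : vol J L (~: L) = vol G L (~: L).
    rewrite !vol_biclique //; by move=> u v uL; rewrite inE; (exact: GL || exact: JLC).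
  by rewrite leq_add2r (addnC vY) (addnC vX).
pose s : R := (k * k.-1)%:R - (vol G L L)%:R.
have s0 : 0 <= s by rewrite subr_ge0 ler_nat.
pose sg : R := \sum_(u in L) x u.
have sgk : 0 <= sg <= k%:R.
  rewrite sumr_ge0 //= -cL -natr_card; apply: ler_sum => u _.
  by have /andP[] := ev.1 u.
have sg0 : 0 < sg.
  apply: lt_le_trans (_ : 3 / 4 * k%:R <= _); first by lra.
  by rewrite -cL -natr_card mulr_sumr; apply: ler_sum => u uL; rewrite mulr1; exact: xL.
have Mk0 : 0 <= 48 * M%:R ^+ 2 * k%:R ^+ 2 :> R by rewrite !mulr_ge0 ?sqr_ge0.
have M0 : 0 <= M%:R :> R by [].
have lM : 0 < l - M%:R by lra.
have lp : 0 < l by lra.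
pose a := sg / l; pose b := sg / (l - M%:R).
have la : l * a = sg by rewrite mulrC mulfVK // gt_eqF.
have lb : (l - M%:R) * b = sg by rewrite mulrC mulfVK // gt_eqF.
have xab v : v \notin L -> a <= x v <= b.
  move=> vL; have [[h1 h2]|] := outer_weight_bounds ev GL odeg vL; last by lra.
  by rewrite /a /b ler_pdivrMr // ler_pdivlMr // mulrC -/sg h1 mulrC.
have a0 : 0 <= a by rewrite divr_ge0 // ltW.
have hLL : qsum G x L L + 9 / 16 * s <= qsum J x L L.
  rewrite /s -vJL; apply: qsum_deficit_ge => // u v uL vL.
  by have := xL u uL; have := xL v vL; nra.
have hX' : vX%:R * a ^+ 2 <= qsum J x (~: L) (~: L).
  rewrite /vX -(volE _ _ Jh) -natr_sum_adj mulr_suml; apply: ler_sum => u.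
  rewrite inE => uL; rewrite mulr_suml; apply: ler_sum => v; rewrite inE => vL.
  have := xab u uL; have := xab v vL => /andP[av _] /andP[au _].
  by apply: ler_wpM2l => //; rewrite expr2; exact: ler_pM.
have hY' : qsum G x (~: L) (~: L) <= vY%:R * b ^+ 2.
  rewrite /vY -(volE Y G) // -natr_sum_adj mulr_suml; apply: ler_sum => u.
  rewrite inE => uL; rewrite mulr_suml; apply: ler_sum => v; rewrite inE => vL.
  have := xab u uL; have := xab v vL => /andP[_ bv] /andP[_ bu].
  by apply: ler_wpM2l => //; rewrite expr2; exact: ler_pM.
have main : 9 / 16 * s + vX%:R * a ^+ 2 <= vY%:R * b ^+ 2.
  move: qJ; rewrite !(qsum_split _ _ L).
  have -> : qsum J x L (~: L) = qsum G x L (~: L).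
    by apply: eq_qsum => u v uL; rewrite inE => vL; rewrite GL // JLC.
  lra.
have vYM : 0 <= (vY%:R : R) <= M%:R * n%:R.
  rewrite ler0n -natrM ler_nat /vY -(volE Y G) // -[n in (_ <= _ * n)%N]card_ord.
  by apply: vol_join_bound => v; rewrite inE; exact: odeg.
have vYs : vY%:R <= vX%:R + s :> R.
  by rewrite /s addrA lerBrDr -!natrD ler_nat.
have := @join_compare_arith R M%:R k%:R n%:R s l a b sg vX%:R vY%:R M0 k1; rewrite -KE.
move=> /(_ Kl n0 nl s0 sgk la lb main vYM vYs sg0)[slt1 hs0].
(* [s] counts ordered pairs, so $s<1$ means that [L] is a clique. *)
have vkk : vol G L L = (k * k.-1)%N.
  apply/eqP; rewrite eqn_leq vGL /= -ltnS -(ltr_nat R) -natr1; move: slt1; rewrite /s; lra.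
have s00 : s = 0 by rewrite /s vkk subrr.
have GLJ u v : u \in L -> u != v -> G u v.
  move=> uL uv; have [vL|vL] := boolP (v \in L); last exact: GL.
  apply: contraT => nG.
  by have := vol_lt GJL uL vL (JL _ _ uL uv) nG; rewrite vJL vkk ltnn.
exists Y; split.
- have [J' [J'Y J'L J'h]] := hJ Y.
  apply: isog_trans J'Y; apply: isog_eq => u v.
  have [uL|uL] := boolP (u \in L).
    have [->|uv] := eqVneq u v; first by rewrite !adj_irr.
    by rewrite GLJ // J'L.
  have [vL|vL] := boolP (v \in L).
    have vu : v != u by apply: contraNneq uL => <-.
    by rewrite adj_sym [RHS]adj_sym GLJ // J'L.
  by have [i ->] := hs u uL; have [j ->] := hs v vL; rewrite J'h.
- apply/bigmax_leqP => i _; rewrite degreeE.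
  apply: leq_trans (odeg (h i) (hL _)); rewrite vol_set1l -imh.
  rewrite big_imset /=; last by move=> ? ? _ _; exact: hi.
  rewrite big_mkcond /= [leqRHS]big_mkcond /=.
  by apply: leq_sum => j _; rewrite finset.in_setT.
(* The loss is at most $6M^2n/l$, and $\sqrt n\le 2l$ turns it into $12M^2\sqrt n$. *)
- have h1 := hs0 s00.
  set r := Num.sqrt n%:R; have r0 : 0 < r by rewrite sqrtr_gt0.
  have r2 : r ^+ 2 = n%:R by rewrite sqr_sqrtr // ltW.
  have rl : r <= 2 * l.
    rewrite -ler_sqr ?nnegrE ?(ltW r0) ?mulr_ge0 // r2 exprMn.
    have : 0 <= l ^+ 2 by exact: sqr_ge0.
    lra.
  rewrite lerBlDr -lerBlDl.
  have : (vX%:R - vY%:R) * l <= (12 * M%:R ^+ 2 * r) * l.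
    apply: le_trans h1 _; rewrite -r2.
    have : 0 <= M%:R ^+ 2 * (r * (2 * l - r)) :> R.
      by rewrite !mulr_ge0 ?sqr_ge0 ?(ltW r0) ?subr_ge0.
    lra.
  by rewrite ler_pM2r.
Qed.

(** * The radius of a join through two-step walks *)

(* The number of walks of length two starting at [v]. *)
Definition deg2 (T : finType) (G : sgraph T) (v : T) : nat :=
  (\sum_u G v u * degree G u)%N.

Lemma deg2_le (M : nat) (T : finType) (G : sgraph T) (v : T) :
  (forall u, degree G u <= M)%N -> (deg2 G v <= M ^ 2)%N.
Proof.
move=> hM; apply: (@leq_trans (\sum_u G v u * M)).
  by apply: leq_sum => u _; rewrite leq_mul2l hM orbT.
by rewrite -big_distrl /= -degreeE leq_mul2r hM orbT.
Qed.

(** Symmetry moves $A^2$ onto the constant vector 1, and $A^2 1$ is [deg2]. *)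
Lemma adjop2_sum (R : realType) (T : finType) (G : sgraph T) (x : T -> R) :
  \sum_v adjop G (adjop G x) v = \sum_v (deg2 G v)%:R * x v.
Proof.
have e1 (y : T -> R) : \sum_v adjop G y v = \sum_v (degree G v)%:R * y v.
  rewrite /adjop exchange_big /=; apply: eq_bigr => v _.
  by rewrite -mulr_suml -natr_degree; congr (_ * _); apply: eq_bigr => u _; rewrite adj_sym.
rewrite e1 (adjop_sym G (fun v => (degree G v)%:R)) [LHS](eq_bigr (fun v => (deg2 G v)%:R * x v)) // => v _.
rewrite mulrC; congr (_ * _); rewrite /adjop /deg2 natr_sum; apply: eq_bigr => u _.
by rewrite natrM.
Qed.

Lemma sum_adjop1 (R : realType) (T : finType) (G : sgraph T) :
  \sum_v adjop G (fun _ => 1 : R) v = (vol G [set: T] [set: T])%:R.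
Proof.
rewrite volTE natr_sum; apply: eq_bigr => v _; rewrite natr_sum.
by apply: eq_bigr => u _; rewrite mulr1.
Qed.

Lemma adjop_lin (R : realType) (T : finType) (G : sgraph T) (x y : T -> R) (a b : R) u :
  adjop G (fun v => a * x v + b * y v) u = a * adjop G x u + b * adjop G y u.
Proof. by rewrite /adjop !mulr_sumr -big_split /=; apply: eq_bigr => v _; lra. Qed.

(** Rayleigh test with 1 on the clique and $u=c(l+A)1$ outside. Because $(l-A)u=c(l^2-A^2)1$, this
    solves $(l-A)u=k$ wherever [deg2] equals [q]. A larger [deg2] only helps, and the at most [B]
    vertices where it is smaller give the right-hand side. *)
Lemma join_radius_ge (R : realType) (k M B q : nat) (T : finType) (X : sgraph T) (l : R) :
  (forall u, degree X u <= M)%N -> (#|[set v | (deg2 X v < q)%N]| <= B)%N ->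
  q%:R < l ^+ 2 -> 0 < l -> (0 < k)%N ->
  (forall y : 'I_k + T -> R, qform (gjoin (complete 'I_k) X) y <= l * sqnorm y) ->
  forall c : R, c = k%:R / (l ^+ 2 - q%:R) ->
  k%:R - 1 - l + c * (l * #|T|%:R + (vol X [set: T] [set: T])%:R) <=
  c * (c / k%:R) * (B * q)%:R * (l + M%:R).
Proof.
move=> hM hB ql l0 k0 ray c ec.
have k1 : 0 < k%:R :> R by rewrite ltr0n.
have lq : 0 < l ^+ 2 - q%:R by rewrite subr_gt0.
have c0 : 0 <= c by rewrite ec divr_ge0 // ltW.
have cq : c * (l ^+ 2 - q%:R) = k%:R by rewrite ec mulfVK // gt_eqF.
pose one : T -> R := fun _ => 1.
pose u (v : T) : R := c * l * one v + c * adjop X one v.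
have d1 v : adjop X one v = (degree X v)%:R.
  by rewrite -natr_degree; apply: eq_bigr => w _; rewrite mulr1.
have d2 v : adjop X (adjop X one) v = (deg2 X v)%:R.
  by rewrite /deg2 natr_sum; apply: eq_bigr => w _; rewrite d1 natrM.
have uE v : u v = c * (l + (degree X v)%:R) by rewrite /u d1 /one; lra.
have u0 v : 0 <= u v by rewrite uE mulr_ge0 // addr_ge0 // ltW.
have uM v : u v <= c * (l + M%:R).
  by rewrite uE; apply: ler_wpM2l => //; rewrite lerD2l ler_nat.
have lu v : l * u v - adjop X u v = k%:R + c * (q%:R - (deg2 X v)%:R).
  rewrite -cq /u adjop_lin d2 d1 /one; lra.
pose S := \sum_v u v.
have SE : S = c * (l * #|T|%:R + (vol X [set: T] [set: T])%:R).
  rewrite /S /u big_split /= -!mulr_sumr sum_adjop1 /one sumr_const; lra.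
have hu : \sum_v u v * (l * u v - adjop X u v) <= k%:R * S + c * ((B * q)%:R * (c * (l + M%:R))).
  rewrite /S mulr_sumr.
  apply: le_trans (_ : \sum_v (k%:R * u v +
    c * (if (deg2 X v < q)%N then q%:R * (c * (l + M%:R)) else 0)) <= _).
    apply: ler_sum => v _; rewrite lu mulrDr mulrC lerD2l mulrCA; apply: ler_wpM2l => //.
    case: ltnP => hv.
      apply: le_trans (_ : u v * q%:R <= _).
        by apply: ler_wpM2l => //; rewrite lerBlDr lerDl.
      by rewrite mulrC; apply: ler_wpM2l.
    by apply: mulr_ge0_le0 => //; rewrite subr_le0 ler_nat.
  rewrite big_split /= lerD2l -mulr_sumr; apply: ler_wpM2l => //.
  rewrite -big_mkcond sumr_const; set t := q%:R * _.
  have t0 : 0 <= t by rewrite !mulr_ge0 // addr_ge0 // ltW.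
  have -> : (B * q)%:R * (c * (l + M%:R)) = B%:R * t by rewrite natrM /t; lra.
  rewrite -[t *+ _]mulr_natl; apply: ler_wpM2r => //.
  by rewrite ler_nat; apply: leq_trans hB; rewrite cardsE.
pose y (s : 'I_k + T) : R := if s is inr v then u v else 1.
have := ray y.
have -> : sqnorm y = k%:R + sqnorm u.
  rewrite /sqnorm big_sumType /=; congr (_ + _).
  by rewrite (eq_bigr (fun _ => 1)) ?sumr_const ?card_ord // => i _; rewrite expr1n.
have -> : qform (gjoin (complete 'I_k) X) y = k%:R * (k%:R - 1) + 2 * (k%:R * S) + qform X u.
  have sk (a : R) : \sum_(i < k) a = k%:R * a by rewrite sumr_const card_ord mulr_natl.
  rewrite /qform big_sumType /=.
  have -> : \sum_(i < k) \sum_(t : 'I_k + T) (gjoin_rel (complete 'I_k) X (inl i) t)%:R * (1 * y t)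
      = k%:R * (k%:R - 1 + S).
    rewrite -sk; apply: eq_bigr => i _; rewrite big_sumType /=; congr (_ + _).
      rewrite (bigD1 i) //= /complete_rel eqxx mul0r add0r.
      rewrite (eq_bigr (fun _ => 1)) => [|j ji]; last by rewrite eq_sym ji !mul1r.
      apply/eqP; rewrite eq_sym subr_eq eq_sym; apply/eqP.
      have := sk 1; rewrite mulr1 => <-; rewrite [RHS](bigD1 i) //= addrC.
      by congr (_ + _); apply: eq_bigl.
    by apply: eq_bigr => v _; rewrite !mul1r.
  have -> : \sum_v \sum_(t : 'I_k + T) (gjoin_rel (complete 'I_k) X (inr v) t)%:R * (u v * y t)
      = k%:R * S + qform X u.
    rewrite /S mulr_sumr -big_split /=; apply: eq_bigr => v _; rewrite big_sumType /=.
    by congr (_ + _); rewrite -sk; apply: eq_bigr => i _; rewrite mul1r mulr1.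
  rewrite -/(qform X u); lra.
have -> : qform X u = l * sqnorm u - \sum_v u v * (l * u v - adjop X u v).
  rewrite qform_adjop /sqnorm mulr_sumr -sumrB; apply: eq_bigr => v _; lra.
move=> h; rewrite -SE.
have h2 : k%:R * (k%:R - 1 - l + S) <= k%:R * (c * (c / k%:R) * (B * q)%:R * (l + M%:R)).
  have -> : k%:R * (c * (c / k%:R) * (B * q)%:R * (l + M%:R)) = c * ((B * q)%:R * (c * (l + M%:R))).
    have : k%:R * (c / k%:R) = c by rewrite mulrC mulfVK // gt_eqF.
    move=> e; transitivity (c * (k%:R * (c / k%:R)) * (B * q)%:R * (l + M%:R)); first lra.
    by rewrite e; lra.
  lra.
by rewrite ler_pM2l in h2.
Qed.

(** Iterating $ly=k+Ay$ gives $l^2y=lk+kA1+A^2y$. Summed over all vertices, the last term is the sum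
    of [deg2] times [y], which is at most [q] times the sum of [y] up to [B] exceptional terms. *)
Lemma join_radius_le (R : realType) (k M B q : nat) (T : finType) (Y : sgraph T) (l : R)
    (y : T -> R) :
  (forall u, degree Y u <= M)%N -> (#|[set v | (q < deg2 Y v)%N]| <= B)%N ->
  2 * M%:R <= l -> 0 < l -> (forall v, 0 <= y v) ->
  (forall v, l * y v = k%:R + adjop Y y v) -> l = k%:R - 1 + \sum_v y v ->
  (l ^+ 2 - q%:R) * (l - k%:R + 1) <=
  k%:R * (l * #|T|%:R + (vol Y [set: T] [set: T])%:R + 2 * (B * M ^ 2)%:R / l).
Proof.
move=> hM hB lM l0 y0 ey el.
(* At the largest entry $Ay\le My\le ly/2$, so the equation leaves $ly/2\le k$. *)
have yb v : y v <= 2 * k%:R / l.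
  pose P : pred T := predT.
  have [z _ hz] := Order.TotalTheory.arg_maxP y (isT : P v).
  apply: le_trans (hz v isT) _; rewrite ler_pdivlMr // mulrC.
  have : adjop Y y z <= M%:R * y z.
    apply: le_trans (_ : (degree Y z)%:R * y z <= _); last first.
      by apply: ler_wpM2r => //; rewrite ler_nat.
    rewrite -natr_degree mulr_suml; apply: ler_sum => w _; apply: ler_wpM2l => //.
    exact: hz.
  have := ey z; have : 0 <= (l - 2 * M%:R) * y z by rewrite mulr_ge0 // subr_ge0.
  lra.
pose S := \sum_v y v; have lS : l - k%:R + 1 = S by rewrite el /S; lra.
have e2 : l ^+ 2 * S = k%:R * (l * #|T|%:R + (vol Y [set: T] [set: T])%:R) +
    \sum_v (deg2 Y v)%:R * y v.
  rewrite -adjop2_sum -sum_adjop1 /S.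
  have -> : l ^+ 2 * (\sum_v y v) = \sum_v (l * k%:R + k%:R * adjop Y (fun=> 1) v + adjop Y (adjop Y y) v).
    rewrite mulr_sumr; apply: eq_bigr => v _.
    rewrite expr2 -mulrA ey mulrDr -addrA; congr (_ + _).
    have -> : l * adjop Y y v = adjop Y (fun w => l * y w) v.
      by rewrite /adjop mulr_sumr; apply: eq_bigr => w _; lra.
    rewrite /adjop mulr_sumr -big_split /=; apply: eq_bigr => w _; rewrite ey /adjop; lra.
  rewrite !big_split /= sumr_const -mulr_sumr -mulr_natl; lra.
have hd : \sum_v (deg2 Y v)%:R * y v <= q%:R * S + (B * M ^ 2)%:R * (2 * k%:R / l).
  rewrite /S mulr_sumr.
  apply: le_trans (_ : \sum_v (q%:R * y v +
    (if (q < deg2 Y v)%N then (M ^ 2)%:R * (2 * k%:R / l) else 0)) <= _).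
    apply: ler_sum => v _; case: ltnP => hv.
      apply: le_trans (_ : (M ^ 2)%:R * (2 * k%:R / l) <= _).
        by apply: ler_pM => //; rewrite ler_nat deg2_le.
      by rewrite lerDr mulr_ge0.
    by rewrite addr0; apply: ler_wpM2r => //; rewrite ler_nat.
  rewrite big_split /= lerD2l -big_mkcond sumr_const; set t := (M ^ 2)%:R * _.
  have t0 : 0 <= t by rewrite mulr_ge0 // divr_ge0 ?mulr_ge0 // ltW.
  have -> : (B * M ^ 2)%:R * (2 * k%:R / l) = B%:R * t by rewrite natrM /t; lra.
  rewrite -[t *+ _]mulr_natl; apply: ler_wpM2r => //.
  by rewrite ler_nat; apply: leq_trans hB; rewrite cardsE.
rewrite lS; lra.
Qed.

(* With [A] the adjacency matrix, [(l - A)^-1 = (l + A)(l^2 - A^2)^-1] and [A^2 1 = q 1] up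
   to boundedly many rows, so the number of edges decides which join has larger radius. *)
Lemma join_compare (R : realType) (k M B q : nat) (T T' : finType) (X : sgraph T)
    (Y : sgraph T') (l : R) (y : T' -> R) :
  #|T| = #|T'| -> (0 < k)%N -> (2 * M + 2 * B * M ^ 2 + 2 * B * q + q + k + 1)%:R <= l ->
  (forall u, degree X u <= M)%N -> (#|[set v | (deg2 X v < q)%N]| <= B)%N ->
  (forall u, degree Y u <= M)%N -> (#|[set v | (q < deg2 Y v)%N]| <= B)%N ->
  (forall z : 'I_k + T -> R, qform (gjoin (complete 'I_k) X) z <= l * sqnorm z) ->
  (forall v, 0 <= y v) ->
  (forall v, l * y v = k%:R + adjop Y y v) -> l = k%:R - 1 + \sum_v y v ->
  (vol X [set: T] [set: T] < (vol Y [set: T'] [set: T']).+2)%N.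
Proof.
move=> cT k0 hl hMX hBX hMY hBY ray y0 ey el.
rewrite !natrD !natrM in hl.
have k1 : 1 <= k%:R :> R by rewrite ler1n.
have M0 : 0 <= M%:R :> R by [].
have B0 : 0 <= B%:R :> R by [].
have q0 : 0 <= q%:R :> R by [].
have BM0 : 0 <= B%:R * M%:R ^+ 2 :> R by rewrite mulr_ge0 ?sqr_ge0.
have Bq0 : 0 <= B%:R * q%:R :> R by rewrite mulr_ge0.
have l0 : 0 < l by lra.
have lqq : l * q%:R <= l * (l - 1) by rewrite ler_pM2l //; lra.
have ql : q%:R < l ^+ 2 by nra.
have h1 := join_radius_ge hMX hBX ql l0 k0 ray (erefl _).
have lM : 2 * M%:R <= l by lra.
have h2 := join_radius_le hMY hBY lM l0 y0 ey el.
set c := k%:R / (l ^+ 2 - q%:R) in h1.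
have lq : 0 < l ^+ 2 - q%:R by rewrite subr_gt0.
have c0 : 0 < c by rewrite divr_gt0 // ltr0n.
have cq : c * (l ^+ 2 - q%:R) = k%:R by rewrite mulfVK // gt_eqF.
(* [e] and [f] are the errors due to the exceptional vertices of [Y] and of [X]. Each is below 1, so
   the volumes satisfy $v_X<v_Y+2$; both being even, this compares the numbers of edges exactly. *)
set e := 2 * (B * M ^ 2)%:R / l in h2.
have el1 : e < 1.
  by rewrite /e ltr_pdivrMr // mul1r natrM natrX; lra.
set f := c / k%:R * (B * q)%:R * (l + M%:R).
have f1 : f < 1.
  have ck : c / k%:R * (l ^+ 2 - q%:R) = 1.
    by rewrite mulrAC cq divff // pnatr_eq0 -lt0n.
  have hh : (B * q)%:R * (l + M%:R) < l ^+ 2 - q%:R by rewrite natrM; nra.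
  have ck0 : 0 < c / k%:R by rewrite divr_gt0 // ltr0n.
  by rewrite /f -mulrA; apply: lt_le_trans (_ : c / k%:R * (l ^+ 2 - q%:R) <= _); rewrite ?ltr_pM2l ?ck.
set N : R := #|T'|%:R in h2; rewrite cT -/N in h1.
set vX : R := (vol X _ _)%:R in h1; set vY : R := (vol Y _ _)%:R in h2.
have h3 : l - k%:R + 1 <= c * (l * N + vY + e).
  have h : (l ^+ 2 - q%:R) * (l - k%:R + 1) <= (l ^+ 2 - q%:R) * (c * (l * N + vY + e)).
    by apply: le_trans h2 _; rewrite -cq; lra.
  by rewrite ler_pM2l in h.
have h4 : c * (vX - vY - e - f) <= 0.
  have : c * f = c * (c / k%:R) * (B * q)%:R * (l + M%:R) by rewrite /f; lra.
  lra.
have h5 : vX - vY - e - f <= 0 by rewrite -(pmulr_rle0 _ c0).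
by rewrite -(ltr_nat R) -2!natr1 -/vX -/vY; lra.
Qed.

(** * Excluded disjoint copies and the vertices near a copy *)

(** Compactness: an excluded graph is finite, so its embedding into the infinite join meets only
    finitely many copies, and those can be renumbered inside ['I_m]. *)
Lemma no_many_copies (F : graph_family) (k : nat) (U : Type) (T : sgraph U) :
  ~ family_free F (gjoin (complete 'I_k) (copies nat T)) ->
  exists m : nat, forall (V : Type) (Y : sgraph V),
    family_free F (gjoin (complete 'I_k) Y) -> ~ contains Y (copies 'I_m T).
Proof.
move=> nfree.
have [A [FA [f fi fh]]] : exists A, F A /\ contains (gjoin (complete 'I_k) (copies nat T)) (projT2 A).
  by apply: contrapT => h; apply: nfree => A FA cA; apply: h; exists A.
pose b i : nat := if f i is inr p then p.1 else 0%N.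
exists (\max_i b i).+1 => V Y fY [c ci ch]; apply: (fY A FA).
pose m := (\max_i b i)%N.
pose g (s : 'I_k + nat * U) : 'I_k + V :=
  match s with inl a => inl a | inr p => inr (c (inord p.1, p.2)) end.
have bm i p : f i = inr p -> (p.1 < m.+1)%N.
  by move=> fip; have := leq_bigmax (F := b) i; rewrite /b fip ltnS.
have inord_inj i j p q : f i = inr p -> f j = inr q -> inord p.1 = inord q.1 :> 'I_m.+1 -> p.1 = q.1.
  by move=> /bm hp /bm hq /(congr1 val); rewrite /= !inordK.
exists (g \o f).
  move=> i j /=; case fiE: (f i) => [a|p]; case fjE: (f j) => [a'|p'] //=.
    by move=> [aa]; apply: fi; rewrite fiE fjE aa.
  move=> [/ci [e1 e2]]; apply: fi; rewrite fiE fjE; congr inr.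
  have e1' := inord_inj _ _ _ _ fiE fjE e1.
  by rewrite [p]surjective_pairing [p']surjective_pairing e1' e2.
move=> i j /fh; rewrite /=; case fiE: (f i) => [a|p]; case fjE: (f j) => [a'|p'] //=.
rewrite /copies_rel => /andP[/eqP e Tp]; apply: ch.
by rewrite /= /copies_rel /= e eqxx.
Qed.

(** Greedy packing: either some copy avoids the image of those already found and can be added, or
    that image meets every copy. *)
Lemma copies_or_hitting (U V : finType) (T : sgraph U) (Y : sgraph V) (m : nat) :
  contains Y (copies 'I_m T) \/
  exists S : {set V}, (#|S| <= m * #|U|)%N /\
    forall h : U -> V, injective h -> (forall x y, T x y -> Y (h x) (h y)) ->
      exists u, h u \in S.
Proof.
elim: m => [|m [[f fi fh]|[S [cS hS]]]].
- by left; exists (fun p : 'I_0 * U => match p.1 with Ordinal _ h => False_rect _ (notF h) end);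
    case=> -[].
- pose S := f @: [set: 'I_m * U].
  have [[h [hi hh hS]]|nh] := pselect (exists h : U -> V, [/\ injective h,
      forall x y, T x y -> Y (h x) (h y) & forall u, h u \notin S]).
    left; pose g (p : 'I_m.+1 * U) : V :=
      if unlift ord_max p.1 is Some j then f (j, p.2) else h p.2.
    have fS p : f p \in S by apply: imset_f; rewrite finset.in_setT.
    exists g.
      move=> [i u] [j v]; rewrite /g /=.
      case: unliftP => [i' ->|->]; case: unliftP => [j' ->|->].
      + by move=> /fi [-> ->].
      + by move=> E; have := hS v; rewrite -E fS.
      + by move=> E; have := hS u; rewrite E fS.
      + by move=> /hi ->.
    move=> [i u] [j v] /= /andP[/= /eqP -> Tuv]; rewrite /g /=.
    case: unliftP => [j' _|_]; last exact: hh.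
    by apply: fh; rewrite /= /copies_rel /= eqxx.
  right; exists S; split.
    apply: leq_trans (leq_imset_card _ _) _.
    by rewrite cardsT card_prod card_ord leq_mul2r leqnSn orbT.
  move=> h hi hh; apply: contrapT => nS; apply: nh; exists h; split=> // u.
  by apply/negP => uS; apply: nS; exists u.
- right; exists S; split=> //; apply: leq_trans cS _; by rewrite leq_mul2r leqnSn orbT.
Qed.

Definition closed_nbhd (V : finType) (Y : sgraph V) (S : {set V}) : {set V} :=
  [set v | [exists u in S, (u == v) || Y u v]].

Lemma closed_nbhdP (V : finType) (Y : sgraph V) (S : {set V}) (v : V) :
  reflect (exists2 u, u \in S & u = v \/ Y u v) (v \in closed_nbhd Y S).
Proof.
rewrite inE; apply: (iffP exists_inP) => -[u uS h]; exists u => //.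
  by case/orP: h => [/eqP|]; [left | right].
by case: h => [->|->]; rewrite ?eqxx ?orbT.
Qed.

Lemma closed_nbhd_card (M : nat) (V : finType) (Y : sgraph V) (S : {set V}) :
  (forall u, degree Y u <= M)%N -> (#|closed_nbhd Y S| <= #|S| * M.+1)%N.
Proof.
move=> hM; apply: (@leq_trans #|\bigcup_(u in S) (u |: [set v | Y u v])|).
  apply/subset_leq_card/fintype.subsetP => v /closed_nbhdP[u uS h].
  apply/bigcupP; exists u => //; rewrite !finset.inE.
  by case: h => [->|->]; rewrite ?eqxx ?orbT.
rewrite -sum_nat_const; elim/big_rec2: _ => [|u a B _ le]; first by rewrite cards0.
apply: leq_trans (leq_card_setU _ _) _; apply: leq_add => //.
by rewrite cardsU1; apply: leq_add (leq_b1 _) (hM u).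
Qed.

(** The copy lies within distance two of [v] but need not contain [v]: a large [deg2] at [v] may be
    caused by the degree of a neighbour. *)
Definition near_copy (U V : finType) (T : sgraph U) (Y : sgraph V) (v : V) : Prop :=
  exists h : U -> V, [/\ injective h, forall x y, T x y -> Y (h x) (h y) &
    forall u, h u \in closed_nbhd Y (closed_nbhd Y [set v])].

(** Every such vertex is within distance two of a hitting set of at most $m|U|$ vertices, and each
    step of distance multiplies the size by at most $M+1$. *)
Lemma near_copy_card (M m : nat) (U V : finType) (T : sgraph U) (Y : sgraph V) (S : {set V}) :
  (forall u, degree Y u <= M)%N -> ~ contains Y (copies 'I_m T) ->
  (forall v, v \in S -> near_copy T Y v) -> (#|S| <= m * #|U| * M.+1 * M.+1)%N.
Proof.
move=> hM nc hS; have [//|[H [cH hH]]] := copies_or_hitting T Y m.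
apply: (@leq_trans #|closed_nbhd Y (closed_nbhd Y H)|).
  apply/subset_leq_card/fintype.subsetP => v /hS[h [hi hh hn]].
  have [u uH] := hH h hi hh.
  have /closed_nbhdP[w /closed_nbhdP[z zv hz] hw] := hn u.
  move: zv; rewrite finset.in_set1 => /eqP ez; subst z.
  apply/closed_nbhdP; exists w.
    apply/closed_nbhdP; exists (h u) => //.
    by case: hw => [->|?]; [left | right; rewrite adj_sym].
  by case: hz => [->|?]; [left | right; rewrite adj_sym].
apply: leq_trans (closed_nbhd_card _ hM) _; rewrite leq_mul2r; apply/orP; right.
by apply: leq_trans (closed_nbhd_card _ hM) _; rewrite leq_mul2r cH orbT.
Qed.

Lemma star_copy (d : nat) (V : finType) (Y : sgraph V) (c : V) : (d <= degree Y c)%N ->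
  exists h : 'I_1 + 'I_d -> V, [/\ injective h,
    forall x y, bipartite 'I_1 'I_d x y -> Y (h x) (h y) & forall s, c = h s \/ Y c (h s)].
Proof.
move=> hd; pose N := [set v | Y c v].
pose h (s : 'I_1 + 'I_d) : V := if s is inr i then nth c (enum N) i else c.
have lt (i : 'I_d) : (i < size (enum N))%N by rewrite -cardE; exact: leq_trans (ltn_ord i) hd.
have hN i : Y c (h (inr i)) by have := mem_nth c (lt i); rewrite mem_enum inE.
exists h; split.
- move=> [a|i] [b|j]; first by rewrite (ord1 a) (ord1 b).
  + by move=> E; have := hN j; rewrite -E /= adj_irr.
  + by move=> E; have := hN i; rewrite E /= adj_irr.
  + by move=> /eqP; rewrite /h nth_uniq ?enum_uniq // => /eqP/val_inj ->.
- by move=> [a|i] [b|j] //= _; [exact: hN | rewrite adj_sym; exact: hN].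
- by move=> [a|i]; [left | right; exact: hN].
Qed.

Lemma star_near_copy (d : nat) (V : finType) (Y : sgraph V) (v c : V) :
  v = c \/ Y v c -> (d <= degree Y c)%N -> near_copy (bipartite 'I_1 'I_d) Y v.
Proof.
move=> vc hd; have [h [hi hh hn]] := star_copy hd; exists h; split=> // s.
apply/closed_nbhdP; exists c; last exact: hn.
by apply/closed_nbhdP; exists v => //; rewrite finset.in_set1.
Qed.

(** If [v] and its neighbours all have degree at most [d], there are at most $d^2$ two-step walks
    from [v]. *)
Lemma deg2_star (d : nat) (V : finType) (Y : sgraph V) (v : V) :
  (d ^ 2 < deg2 Y v)%N -> near_copy (bipartite 'I_1 'I_d.+1) Y v.
Proof.
move=> h; apply: contrapT => nc.
have hd c : v = c \/ Y v c -> (degree Y c <= d)%N.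
  by move=> vc; rewrite leqNgt; apply/negP => /(star_near_copy vc).
move: h; rewrite ltnNge => /negP[]; apply: (@leq_trans (\sum_u Y v u * d)).
  apply: leq_sum => u _; case E: (Y v u) => //; rewrite leq_mul2l /=.
  by apply: hd; right.
by rewrite -big_distrl /= -degreeE leq_mul2r hd ?orbT //; left.
Qed.

Definition path4_rel : rel 'I_4 := fun i j => (i.+1 == j :> nat) || (j.+1 == i :> nat).

Lemma path4_sym : symmetric path4_rel.
Proof. by move=> i j; rewrite /path4_rel orbC. Qed.

Lemma path4_irr : irreflexive path4_rel.
Proof. by move=> i; rewrite /path4_rel; lia. Qed.

Definition path4 : sgraph 'I_4 := SGraph path4_sym path4_irr.

Lemma degree_gt1 (V : finType) (Y : sgraph V) (u w : V) :
  (1 < degree Y u)%N -> exists2 t, Y u t & t != w.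
Proof.
rewrite /degree (cardsD1 w) => h; have : (0 < #|[set y | Y u y] :\ w|)%N.
  by move: h; case: (w \in _); rewrite ?add0n ?add1n // => /ltnW.
by move=> /card_gt0P[t]; rewrite !finset.inE => /andP[tw ut]; exists t.
Qed.

(** Without a near star $K_{1,3}$, degrees at [v] and its neighbours are at most 2, so [v] has two
    neighbours [u] and [t], and [u] has a second neighbour [w]. If $t=w$ this is a triangle,
    otherwise [t], [v], [u], [w] form a path. *)
Lemma deg2_gt2 (V : finType) (Y : sgraph V) (v : V) : (2 < deg2 Y v)%N ->
  [\/ near_copy (bipartite 'I_1 'I_3) Y v, near_copy (complete 'I_3) Y v |
      near_copy path4 Y v].
Proof.
move=> h; have [|n13] := pselect (near_copy (bipartite 'I_1 'I_3) Y v); first by constructor 1.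
have hd c : v = c \/ Y v c -> (degree Y c <= 2)%N.
  by move=> vc; rewrite leqNgt; apply/negP => /(star_near_copy vc).
have dv : (1 < degree Y v)%N.
  rewrite ltnNge; apply/negP => le1; move: h; rewrite ltnNge => /negP[].
  apply: (@leq_trans (\sum_u Y v u * 2)).
    by apply: leq_sum => u _; case E: (Y v u) => //; rewrite leq_mul2l /= hd //; right.
  by rewrite -big_distrl /= -degreeE -[X in (_ <= X)%N]mul1n leq_mul2r le1.
have [u vu du] : exists2 u, Y v u & (1 < degree Y u)%N.
  apply: contrapT => nu; move: h; rewrite ltnNge => /negP[].
  apply: (@leq_trans (\sum_u Y v u)); last by rewrite -degreeE hd //; left.
  apply: leq_sum => u _; case E: (Y v u) => //; rewrite mul1n leqNgt; apply/negP => du.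
  by apply: nu; exists u.
have [t vt tu] := degree_gt1 u dv.
have [w uw wv] := degree_gt1 v du.
have nvu : v != u by apply: contraTneq vu => ->; rewrite adj_irr.
have nvt : v != t by apply: contraTneq vt => ->; rewrite adj_irr.
have nuw : u != w by apply: contraTneq uw => ->; rewrite adj_irr.
have ball c z : v = c \/ Y v c -> c = z \/ Y c z -> z \in closed_nbhd Y (closed_nbhd Y [set v]).
  move=> vc cz; apply/closed_nbhdP; exists c => //.
  by apply/closed_nbhdP; exists v => //; rewrite finset.in_set1.
have bv : v \in closed_nbhd Y (closed_nbhd Y [set v]) by apply: (@ball v); left.
have bu : u \in closed_nbhd Y (closed_nbhd Y [set v]) by apply: (@ball v); [left | right].
have bt : t \in closed_nbhd Y (closed_nbhd Y [set v]) by apply: (@ball v); [left | right].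
have bw : w \in closed_nbhd Y (closed_nbhd Y [set v]) by apply: (@ball u); right.
have nthi (s : seq V) m : uniq s -> size s = m -> injective (fun i : 'I_m => nth v s i).
  move=> us ss i j /eqP; rewrite nth_uniq ?ss ?ltn_ord // => /eqP; exact: val_inj.
have [tw|ntw] := eqVneq t w.
  constructor 2; exists (fun i : 'I_3 => nth v [:: v; u; t] i); split.
  - by apply: nthi => //=; rewrite !inE negb_or nvu nvt eq_sym tu.
  - have ut : Y u t by rewrite tw.
    move=> [[|[|[|//]]] p] [[|[|[|//]]] q] //= _; rewrite ?vu ?vt ?ut //.
    + by rewrite adj_sym.
    + by rewrite adj_sym.
    + by rewrite adj_sym.
  - by move=> [[|[|[|//]]] p].
constructor 3; exists (fun i : 'I_4 => nth v [:: t; v; u; w] i); split.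
- apply: nthi => //=; rewrite !inE !negb_or (eq_sym t v) nvt tu ntw nvu nuw.
  by rewrite (eq_sym v w) wv.
- move=> [[|[|[|[|//]]]] p] [[|[|[|[|//]]]] q] //= _; rewrite ?vu ?vt ?uw //.
  + by rewrite adj_sym.
  + by rewrite adj_sym.
  + by rewrite adj_sym.
- by move=> [[|[|[|[|//]]]] p].
Qed.

Lemma contains_vol (S T : finType) (G : sgraph S) (H : sgraph T) :
  contains G H -> (vol H [set: T] [set: T] <= vol G [set: S] [set: S])%N.
Proof.
move=> [f fi fh]; apply: (@leq_trans (vol (pullback f G) [set: T] [set: T])).
  by apply: vol_le => u v _ _; exact: fh.
by rewrite vol_pullback // volS // finset.subsetT.
Qed.

Lemma vol_copies_ge (r : nat) (U : finType) (T : sgraph U) :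
  (r * vol T [set: U] [set: U] <= vol (copies 'I_r T) [set: 'I_r * U] [set: 'I_r * U])%N.
Proof.
rewrite !volTE -(pair_bigA _ (fun i u => \sum_q copies 'I_r T (i, u) q)%N) /=.
rewrite -[X in (X * _ <= _)%N](card_ord r) -sum_nat_const; apply: leq_sum => i _.
apply: leq_sum => u _; rewrite -(pair_bigA _ (fun j v => @copies_rel 'I_r U T (i, u) (j, v) : nat)) /=.
rewrite [leqRHS](bigD1 i) //=; apply: leq_trans (leq_addr _ _); apply: leq_sum => v _.
by rewrite /copies_rel /= eqxx.
Qed.

(** When arbitrarily many copies of [T] are allowed, filling the outer vertices with them gives a
    competitor of [H], so [X] has at least as many edges as the complete copies that fit. *)
Lemma copies_bound (F : graph_family) (k n : nat) (U : finType) (T : sgraph U)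
    (H : sgraph 'I_n) (X : sgraph 'I_(n - k)) :
  (0 < #|U|)%N -> (k <= n)%N -> family_free F (gjoin (complete 'I_k) (copies nat T)) ->
  EX (bipartite 'I_k 'I_(n - k)) n F H -> isog H (gjoin (complete 'I_k) X) ->
  (((n - k) %/ #|U|) * vol T [set: U] [set: U] <= vol X [set: _] [set: _])%N.
Proof.
move=> U0 kn fT [_ _ maxH] HX; set t := #|U| in U0 *; set N := (n - k)%N in X HX maxH *.
pose L : {set 'I_n} := (fun i : 'I_k => widen_ord kn i) @: [set: 'I_k].
have cL : #|L| = k.
  by rewrite card_imset ?cardsT ?card_ord // => i j /(congr1 val) /= /val_inj.
(* Vertex [j] takes position [j %% t] in copy [j %/ t]. The last copy may be truncated, which the
   pullback along [p] accommodates. *)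
pose p (j : 'I_N) : nat * U := ((j %/ t)%N, enum_val (Ordinal (ltn_pmod j U0))).
have pi : injective p.
  move=> i j [e1 /enum_val_inj /(congr1 val) /= e2]; apply: val_inj => /=.
  by rewrite (divn_eq i t) (divn_eq j t) e1 e2.
pose Z := pullback p (copies nat T).
have fZ : family_free F (gjoin (complete 'I_k) Z).
  apply: family_free_sub fT; exists (fun s => match s with inl a => inl a | inr j => inr (p j) end).
    move=> [a|i] [b|j] //= E; first by case: E => ->.
    by have /= /pi -> := congr1 (fun s => if s is inr q then q else p i) E.
  by move=> [a|i] [b|j].
have [h [hi hL hs hJ]] := join_model (card_ord n) cL.
have [J [JZ JL _]] := hJ Z.
have fJ : family_free F J := isog_family_free JZ fZ.
have JLC u v : u \in L -> v \notin L -> J u v.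
  by move=> uL vL; apply: JL => //; apply: contraNneq vL => <-.
have : (nb_edges J <= nb_edges H)%N.
  by apply: maxH => //; apply: contains_biclique JLC => //; exact: card_ord.
rewrite -(leq_pmul2l (isT : (0 < 2)%N)) -!handshake (isog_vol JZ) (isog_vol HX).
rewrite !vol_gjoin leq_add2r leq_add2l; apply: leq_trans.
apply: leq_trans (vol_copies_ge _ _) _; apply: contains_vol.
have lt (q : 'I_(N %/ t) * U) : (q.1 * t + enum_rank q.2 < N)%N.
  apply: leq_trans (_ : (q.1.+1 * t <= N)%N).
    by rewrite mulSn addnC ltn_add2r ltn_ord.
  by rewrite -leq_divRL.
have dv (i : nat) (w : U) : ((i * t + enum_rank w) %/ t = i)%N.
  by rewrite divnMDl // divn_small ?addn0.
have md (i : nat) (w : U) : ((i * t + enum_rank w) %% t = enum_rank w)%N.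
  by rewrite modnMDl modn_small.
exists (fun q => Ordinal (lt q)).
  move=> [i u] [j v] /(congr1 val) /= e.
  have e1 := congr1 (fun z => (z %/ t)%N) e; have e2 := congr1 (fun z => (z %% t)%N) e.
  move: e1 e2; rewrite /= !dv !md.
  by move=> /val_inj -> /val_inj /enum_rank_inj ->.
move=> [i u] [j v]; rewrite /= /copies_rel /= => /andP[/eqP -> Tuv].
rewrite !dv eqxx /=.
have e (w : U) (l : (((j * t + enum_rank w) %% t) < t)%N) : enum_val (Ordinal l) = w.
  rewrite -[RHS]enum_rankK; congr enum_val; apply: val_inj => /=.
  exact: md.
by rewrite !e.
Qed.

Lemma sum_deg2 (T : finType) (G : sgraph T) : (\sum_v deg2 G v = \sum_v degree G v ^ 2)%N.
Proof.
rewrite /deg2 exchange_big /=; apply: eq_bigr => v _.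
by rewrite -big_distrl /= -mulnn; congr (_ * _)%N; rewrite degreeE; apply: eq_bigr => u _; rewrite adj_sym.
Qed.

(* [deg2 - degree^2] sums to zero, and adding it to [(q+1) degree - 2q] gives a quantity that
   is at most [(1 - degree) (degree - q) <= 0], strictly negative where [deg2 < q <= 2]. *)
Lemma deg2_deficit (M B q : nat) (T : finType) (X : sgraph T) : (q <= 2)%N ->
  (forall v, degree X v <= M)%N -> (#|[set v | (q < deg2 X v)%N]| <= B)%N ->
  (2 * q * #|T| <= q.+1 * vol X [set: T] [set: T] + 2 * q ^ 2)%N ->
  (#|[set v | (deg2 X v < q)%N]| <= 2 * q ^ 2 + B * (M ^ 2 + 3 * M))%N.
Proof.
move=> q2 hM hB hv.
have pw v : (q.+1 * degree X v + deg2 X v + (deg2 X v < q) <=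
    2 * q + degree X v ^ 2 + (q < deg2 X v) * (M ^ 2 + 3 * M))%N.
  have := deg2_le v hM; have := hM v; set d := degree X v; set w := deg2 X v => dM wM.
  have [lt|le] := ltnP q w.
    have -> : (w < q)%N = false by lia.
    have : (q.+1 * d <= 3 * M)%N by apply: leq_mul.
    rewrite mul1n; lia.
  have : (w + (w < q) <= q)%N by case: ltnP => /=; lia.
  have : (q.+1 * d + q <= 2 * q + d ^ 2)%N.
    clearbody d; case: q q2 {hB hv le} => [|[|[|//]]] _; rewrite -mulnn;
      by case: d {dM} => [|[|d]] //; nia.
  lia.
have : (\sum_v (q.+1 * degree X v + deg2 X v + (deg2 X v < q)) <=
    \sum_v (2 * q + degree X v ^ 2 + (q < deg2 X v) * (M ^ 2 + 3 * M)))%N.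
  by apply: leq_sum => v _; exact: pw.
have cnt (P : pred T) : (\sum_v (P v : nat) = #|[set v | P v]|)%N.
  rewrite -sum1_card [RHS]big_mkcond; apply: eq_bigr => v _; rewrite inE.
  by case: (P v).
rewrite !big_split /= -!big_distrr /= -big_distrl /= !cnt -volT_degree sum_deg2 sum_nat_constT.
have := leq_mul hB (leqnn (M ^ 2 + 3 * M)).
set a := #|[set v | _]|; set b := #|[set v | _]|; set s := (\sum_v _)%N.
set V := vol _ _ _ in hv *; set N := #|T| in hv *.
set c := (a * _)%N; set c' := (B * _)%N.
rewrite big1_eq; clear cnt pw hM hB; clearbody a b s V N c c'; nia.
Qed.

(** * Edge-extremality in cases (d) and (f) *)

Lemma join_degree (F : graph_family) (k M : nat) (V : finType) (Y : sgraph V) :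
  few_common F k M -> family_free F (gjoin (complete 'I_k) Y) ->
  forall v, (degree Y v <= M)%N.
Proof.
move=> hM fY v; pose L : {set 'I_k + V} := inl @: [set: 'I_k].
have inl_inj (A B : Type) : injective (@inl A B) by move=> a b [].
have inr_inj : injective (@inr 'I_k V) by move=> a b [].
have cL : #|L| = k by rewrite card_imset ?cardsT ?card_ord //; exact: inl_inj.
have vL w : inr w \notin L by apply/imsetP => -[].
have := hM _ _ fY (inr v |: L); rewrite cardsU1 vL cL add1n ltnSn => /(_ isT) /ltnW.
apply: leq_trans; rewrite /degree -(card_imset _ (inr_inj)).
apply/subset_leq_card/fintype.subsetP => _ /imsetP[w + ->]; rewrite inE => vw.
by apply/common_nbrsP => u; rewrite finset.in_setU1 => /orP[/eqP->//|/imsetP[i _ ->]].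
Qed.

(** On the clique $(l+1)x_i$ is the total weight, the same for all [i], so the vector can be scaled
    to be 1 there; [y] is its restriction to [Y]. *)
Lemma join_perron (R : realType) (n k : nat) (V : finType) (G : sgraph 'I_n) (Y : sgraph V) :
  (0 < k)%N -> (0 < n)%N -> isog G (gjoin (complete 'I_k) Y) -> 0 <= spectral_radius R G ->
  exists y : V -> R, [/\ forall v, 0 <= y v,
    forall v, spectral_radius R G * y v = k%:R + adjop Y y v &
    spectral_radius R G = k%:R - 1 + \sum_v y v].
Proof.
move=> k0 n0 [f [g fK gK] fh] l0; set l := spectral_radius R G in l0 *.
have [x [x01 [z xz] ex]] := perron R G n0; rewrite -/l in ex.
pose w := x \o g; have gb : bijective g by exists f.
have w0 s : 0 <= w s by have /andP[] := x01 (g s).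
pose K := gjoin (complete 'I_k) Y.
have ew s : adjop K w s = l * w s.
  rewrite /w /= -ex /adjop [RHS](reindex g) /=; last exact: onW_bij.
  by apply: eq_bigr => t _; rewrite fh !gK.
pose S := \sum_v w (inr v); pose P := \sum_(i < k) w (inl i).
have tot : 0 < P + S.
  have -> : P + S = \sum_s w s by rewrite big_sumType.
  rewrite (bigD1 (f z)) //= /w /= fK xz.
  by apply: ltr_pwDl => //; apply: sumr_ge0 => s _; exact: w0.
have e1 i : (l + 1) * w (inl i) = P + S.
  rewrite mulrDl mul1r -ew /adjop big_sumType /= addrAC; congr (_ + _); last first.
    by apply: eq_bigr => v _; rewrite mul1r.
  rewrite /P (bigD1 i) //= [RHS](bigD1 i) //= /complete_rel eqxx mul0r add0r addrC.
  by congr (_ + _); apply: eq_bigr => j ji; rewrite eq_sym ji mul1r.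
have l1 : 0 < l + 1 by lra.
pose t := (P + S) / (l + 1); have t0 : 0 < t by rewrite divr_gt0.
have wt i : w (inl i) = t by rewrite /t -(e1 i) mulrC mulKf // gt_eqF.
have Pt : P = k%:R * t.
  by rewrite /P (eq_bigr (fun _ => t)) // sumr_const card_ord mulr_natl.
have tn : t != 0 by rewrite gt_eqF.
exists (fun v => w (inr v) / t); split.
- by move=> v; rewrite divr_ge0 // ltW.
- move=> v; have := ew (inr v); rewrite /adjop big_sumType /=.
  have -> : \sum_(i < k) 1 * w (inl i) = k%:R * t by rewrite -Pt; apply: eq_bigr => i _; rewrite mul1r.
  rewrite mulrA => <-; rewrite mulrDl mulfK //; congr (_ + _).
  by rewrite mulr_suml; apply: eq_bigr => u _; rewrite mulrA.
- have := e1 (Ordinal k0); rewrite wt Pt -mulr_suml -/S => e.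
  have : l + 1 = (k%:R * t + S) / t by rewrite -e mulfK.
  by rewrite mulrDl mulfK //; lra.
Qed.

Lemma join_rayleigh (R : realType) (n k : nat) (V : finType) (G : sgraph 'I_n) (X : sgraph V)
    (y : 'I_k + V -> R) : isog G (gjoin (complete 'I_k) X) ->
  qform (gjoin (complete 'I_k) X) y <= spectral_radius R G * sqnorm y.
Proof.
move=> [f fb fh]; have := rayleigh G (y \o f); rewrite sqnorm_comp //; congr (_ <= _).
rewrite -(qform_pullback _ y fb); apply: eq_bigr => u _; apply: eq_bigr => v _.
by rewrite fh.
Qed.

(** Common end of (d) and (f): up to [B] vertices [deg2] is at least [q] in [X] and at most [q] in
    every admissible [Y], which are the directions that [join_compare] requires. *)
Lemma SPEX_extremal (R : realType) (F : graph_family) (M B q k : nat)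
    (H : forall n, sgraph 'I_n) (X : forall n, sgraph 'I_(n - k)) :
  (0 < k)%N -> finite_set F -> few_common F k M ->
  ((fun n : nat => (ex_number n F)%:R : R^o) =O_\oo (fun n : nat => n%:R : R^o))%classic ->
  ((\forall n \near \oo, EX (bipartite 'I_k 'I_(n - k)) n F (H n)))%classic ->
  ((\forall n \near \oo, isog (H n) (gjoin (complete 'I_k) (X n))))%classic ->
  (exists N, forall n, (N <= n)%N -> (#|[set v | (deg2 (X n) v < q)%N]| <= B)%N) ->
  (forall (V : finType) (Y : sgraph V), family_free F (gjoin (complete 'I_k) Y) ->
    (forall v, degree Y v <= M)%N -> (#|[set v | (q < deg2 Y v)%N]| <= B)%N) ->
  (\forall n \near \oo, SPEX R n F `<=`
     EX (gjoin (complete 'I_k) (gcompl (complete 'I_(n - k)))) n F)%classic.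
Proof.
move=> k0 fF hM hO hEX hX [N3 hB] hY.
have [N0 hN0] := core_eventually k0 hM hO hEX.
have [N1 hN1] := SPEX_join k0 fF hM hO hEX hX.
have [N2 hN2] := (near_natP _).1 hX.
(* [join_compare] asks for $l\ge K$; since $l^2\ge k(n-k)\ge n/2$ for $n\ge 2k$, orders from $2K^2$
   on suffice. *)
have [K eK] : exists K : nat, K = (2 * M + 2 * B * M ^ 2 + 2 * B * q + q + k + 1)%N by eexists.
apply/near_natP; exists (N0 + N1 + N2 + N3 + 2 * k + 2 * K ^ 2)%N => n len G GS.
have [Y [GY dY _]] := hN1 n ltac:(lia) G GS.
have [[fH cH maxH] kn l2 [l0 _]] := hN0 n ltac:(lia).
have HX := hN2 n ltac:(lia); have BX := hB n ltac:(lia).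
have [fG hmax] := GS.
have le := hmax _ fH; set l := spectral_radius R G in le.
have l0' : 0 <= l by exact: le_trans le.
have Kl : K%:R <= l.
  apply: le_trans le; rewrite -ler_sqr ?nnegrE //; apply: le_trans l2.
  have : (2 * K ^ 2)%:R <= n%:R :> R by rewrite ler_nat; lia.
  have : 2 * k%:R <= n%:R :> R by rewrite -natrM ler_nat; lia.
  have : 1 <= k%:R :> R by rewrite ler1n.
  rewrite natrM natrX => k1 kn2 Kn; nra.
have fY : family_free F (gjoin (complete 'I_k) Y) by exact: isog_family_free (isog_sym GY) fG.
have fX : family_free F (gjoin (complete 'I_k) (X n)) by exact: isog_family_free (isog_sym HX) fH.
have dX := join_degree hM fX; have dY' := join_degree hM fY.
have n0 : (0 < n)%N by lia.
have [y [y0 ey el]] := join_perron k0 n0 GY l0'.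
have ray (z : 'I_k + 'I_(n - k) -> R) :
    qform (gjoin (complete 'I_k) (X n)) z <= l * sqnorm z.
  apply: le_trans (join_rayleigh z HX) _; apply: ler_wpM2r => //; exact: sqnorm_ge0.
rewrite eK in Kl.
have volXY := join_compare erefl k0 Kl dX BX dY' (hY _ _ fY dY') ray y0 ey el.
have eXY : (nb_edges (X n) <= nb_edges Y)%N by move: volXY; rewrite !handshake; lia.
have eHG : (nb_edges (H n) <= nb_edges G)%N.
  rewrite -(leq_pmul2l (isT : (0 < 2)%N)) -!handshake (isog_vol GY) (isog_vol HX).
  by rewrite !vol_gjoin leq_add2r leq_add2l !handshake leq_pmul2l.
split=> //.
- apply: contains_trans (isog_contains (isog_sym GY)) _; exists id => //.
  by move=> [a|i] [b|j] //=; rewrite /gcompl_rel /= /complete_rel andbN.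
(* A graph containing the clique join also contains the biclique, so the maximality of [H n] bounds
   it. *)
- move=> G' fG' cG'; apply: leq_trans eHG; apply: maxH => //.
  by apply: contains_trans cG' _; exists id => // -[a|i] [b|j].
Qed.

Lemma deg2_star_bounded (F : graph_family) (M d k : nat) :
  ~ family_free F (gjoin (complete 'I_k) (copies nat (bipartite 'I_1 'I_d.+1))) ->
  exists B : nat, forall (V : finType) (Y : sgraph V),
    family_free F (gjoin (complete 'I_k) Y) -> (forall v, degree Y v <= M)%N ->
    (#|[set v | (d ^ 2 < deg2 Y v)%N]| <= B)%N.
Proof.
move=> /no_many_copies[m hm].
exists (m * #|{: 'I_1 + 'I_d.+1}| * M.+1 * M.+1)%N => V Y fY dY.
apply: (near_copy_card dY (hm _ _ fY)) => v; rewrite inE; exact: deg2_star.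
Qed.

(** [deg2] equals $d^2$ at a vertex whose closed neighbourhood has only degree [d]; the other
    vertices lie in the closed neighbourhood of the irregular ones. *)
Lemma deg2_regular_bounded (M B d : nat) (T : finType) (X : sgraph T) :
  (forall v, degree X v <= M)%N -> (#|[set v | degree X v != d]| <= B)%N ->
  (#|[set v | (deg2 X v < d ^ 2)%N]| <= B * M.+1)%N.
Proof.
move=> dX hB; pose S := [set v | degree X v != d].
apply: (@leq_trans #|closed_nbhd X S|); last first.
  by apply: leq_trans (closed_nbhd_card _ dX) _; rewrite leq_mul2r hB orbT.
apply/subset_leq_card/fintype.subsetP => v; rewrite inE; apply: contraTT => /closed_nbhdP nv.
have reg u : u = v \/ X u v -> degree X u = d.
  by move=> uv; apply/eqP; apply: contraT => nu; case: nv; exists u => //; rewrite inE.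
rewrite -leqNgt /deg2 -mulnn -{1}(reg v) ?degreeE ?big_distrl /=; last by left.
apply: leq_sum => u _; case E: (X v u) => //; rewrite reg //; right; by rewrite adj_sym.
Qed.

Lemma case_f_SPEX (R : realType) (F : graph_family) (M k : nat)
    (H : forall n, sgraph 'I_n) (X : forall n, sgraph 'I_(n - k)) :
  (0 < k)%N -> few_common F k M ->
  ((fun n : nat => (ex_number n F)%:R : R^o) =O_\oo (fun n : nat => n%:R : R^o))%classic ->
  ((\forall n \near \oo, EX (bipartite 'I_k 'I_(n - k)) n F (H n)))%classic ->
  case_f R F H X ->
  (\forall n \near \oo, SPEX R n F `<=`
     EX (gjoin (complete 'I_k) (gcompl (complete 'I_(n - k)))) n F)%classic.
Proof.
move=> k0 hM hO hEX [[fF [Q [_ [hX _]]]] [d [[B hB] nfree]]].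
have [B' hB'] := deg2_star_bounded M nfree.
have [N1 h1] := (near_natP _).1 hX; have [N2 h2] := (near_natP _).1 hEX.
have [N3 h3] := (near_natP _).1 hB.
apply: (@SPEX_extremal R F M (B * M.+1 + B')%N (d ^ 2)%N k H X k0 fF hM hO hEX hX).
  exists (N1 + N2 + N3)%N => n len; have [fH _ _] := h2 n ltac:(lia).
  have fX := isog_family_free (isog_sym (h1 n ltac:(lia))) fH.
  apply: leq_trans (deg2_regular_bounded (join_degree hM fX) (h3 n ltac:(lia))) _.
  exact: leq_addr.
by move=> V Y fY dY; apply: leq_trans (hB' V Y fY dY) (leq_addl _ _).
Qed.

Lemma vol_path4 : vol path4 [set: 'I_4] [set: 'I_4] = 6%N.
Proof. by rewrite volTE !big_ord_recl !big_ord0. Qed.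

(** Such a [T] has at least 3/4 edges per vertex, so allowing all its copies would give [X] at least
    $\frac34n-O(1)$ edges, against $Q<\frac34$. *)
Lemma dense_copies_not_free (R : realType) (F : graph_family) (k : nat) (U : finType)
    (T : sgraph U) (H : forall n, sgraph 'I_n) (X : forall n, sgraph 'I_(n - k)) (Q C : R) :
  (0 < #|U|)%N -> (3 * #|U| <= 2 * vol T [set: U] [set: U])%N ->
  ((\forall n \near \oo, EX (bipartite 'I_k 'I_(n - k)) n F (H n)))%classic ->
  ((\forall n \near \oo, isog (H n) (gjoin (complete 'I_k) (X n))))%classic ->
  Q < 3 / 4 ->
  ((\forall n \near \oo, (nb_edges (X n))%:R <= Q * n%:R + C))%classic ->
  ~ family_free F (gjoin (complete 'I_k) (copies nat T)).
Proof.
move=> U0 hT /near_natP[N1 h1] /near_natP[N2 h2] Q34 /near_natP[N3 h3] fT.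
set t := #|U| in U0 hT.
(* Beyond [b] the inequality $3(n-k)\le 4(Qn+C)+3t$ fails. *)
pose b : R := (4 * C + 3 * k%:R + 3 * t%:R) / (3 - 4 * Q).
pose n := (N1 + N2 + N3 + k + Num.bound `|b|)%N.
have kn : (k <= n)%N by lia.
have bound := copies_bound U0 kn fT (h1 n ltac:(lia)) (h2 n ltac:(lia)).
have e := h3 n ltac:(lia); rewrite (handshake (X n)) -/t in bound.
have ht : (n - k < (n - k) %/ t * t + t)%N.
  by rewrite {1}(divn_eq (n - k) t) ltn_add2l ltn_pmod.
have key : (3 * (n - k) <= 4 * nb_edges (X n) + 3 * t)%N.
  have := leq_mul (leqnn ((n - k) %/ t)) hT.
  rewrite (mulnCA _ 3%N) (mulnCA _ 2%N) => h.
  have {bound} bound := leq_trans h (leq_mul (leqnn 2%N) bound).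
  rewrite (_ : 2 * (2 * nb_edges (X n)) = 4 * nb_edges (X n))%N in bound; last by rewrite mulnA.
  have ht3 := leq_mul (leqnn 3%N) (ltnW ht); rewrite mulnDr in ht3.
  by apply: leq_trans ht3 _; rewrite leq_add2r.
have key' : 3 * (n%:R - k%:R) <= 4 * (nb_edges (X n))%:R + 3 * t%:R :> R.
  by rewrite -natrB ?leq_addl // -?natrM -?natrD ?ler_nat //; lia.
have : n%:R <= b by rewrite /b ler_pdivlMr; lra.
have : b < n%:R.
  apply: lt_le_trans (_ : (Num.bound `|b|)%:R <= _); last by rewrite ler_nat leq_addl.
  by apply: le_lt_trans (ler_norm _) _; exact: archi_boundP.
lra.
Qed.

Lemma case_d_SPEX (R : realType) (F : graph_family) (M k : nat)
    (H : forall n, sgraph 'I_n) (X : forall n, sgraph 'I_(n - k)) :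
  (0 < k)%N -> few_common F k M ->
  ((fun n : nat => (ex_number n F)%:R : R^o) =O_\oo (fun n : nat => n%:R : R^o))%classic ->
  ((\forall n \near \oo, EX (bipartite 'I_k 'I_(n - k)) n F (H n)))%classic ->
  case_d R F H X ->
  (\forall n \near \oo, SPEX R n F `<=`
     EX (gjoin (complete 'I_k) (gcompl (complete 'I_(n - k)))) n F)%classic.
Proof.
move=> k0 hM hO hEX [fF [Q [_ Q34 [hX [C hC]]]]].
have star_vol d : vol (bipartite 'I_1 'I_d) [set: _] [set: _] = (2 * d)%N.
  by rewrite vol_bipartite !card_ord mul1n.
have star_card d : #|{: 'I_1 + 'I_d}| = d.+1 by rewrite card_sum !card_ord.
have dense (U : finType) (T : sgraph U) := @dense_copies_not_free R F k U T H X Q C.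
have [m1 hm1] := no_many_copies (@dense _ (bipartite 'I_1 'I_3) ltac:(by rewrite star_card)
  ltac:(by rewrite star_card star_vol) hEX hX Q34 hC).
have [m2 hm2] := no_many_copies (@dense _ (complete 'I_3) ltac:(by rewrite card_ord)
  ltac:(by rewrite vol_complete card_ord) hEX hX Q34 hC).
have [m3 hm3] := no_many_copies (@dense _ path4 ltac:(by rewrite card_ord)
  ltac:(by rewrite vol_path4 card_ord) hEX hX Q34 hC).
pose star_free d := family_free F (gjoin (complete 'I_k) (copies nat (bipartite 'I_1 'I_d))).
(* [q] is the largest size up to 2 of a star that may be repeated without limit, or 0 if there is
   none. For $q\le 1$, excluding $K_{1,q+1}$ bounds the vertices with [deg2] above $q^2=q$. For
   $q=2$ stars alone would only give $q^2=4$, so triangles and paths on four vertices are excluded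
   too. *)
have [q [q2 [sq [B hB]]]] : exists q : nat, (q <= 2)%N /\ ((q = 0)%N \/ star_free q) /\
    exists B : nat, forall (V : finType) (Y : sgraph V),
    family_free F (gjoin (complete 'I_k) Y) -> (forall v, degree Y v <= M)%N ->
    (#|[set v | (q < deg2 Y v)%N]| <= B)%N.
  have [s2|/(deg2_star_bounded M)[B hB]] := pselect (star_free 2).
    exists 2; split=> //; split; first by right.
    eexists => V Y fY dY.
    pose A1 := [set v | `[< near_copy (bipartite 'I_1 'I_3) Y v >]].
    pose A2 := [set v | `[< near_copy (complete 'I_3) Y v >]].
    pose A3 := [set v | `[< near_copy path4 Y v >]].
    have c1 : (#|A1| <= m1 * #|{: 'I_1 + 'I_3}| * M.+1 * M.+1)%N.
      by apply: (near_copy_card dY (hm1 _ _ fY)) => v; rewrite inE => /asboolP.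
    have c2 : (#|A2| <= m2 * #|'I_3| * M.+1 * M.+1)%N.
      by apply: (near_copy_card dY (hm2 _ _ fY)) => v; rewrite inE => /asboolP.
    have c3 : (#|A3| <= m3 * #|'I_4| * M.+1 * M.+1)%N.
      by apply: (near_copy_card dY (hm3 _ _ fY)) => v; rewrite inE => /asboolP.
    apply: (@leq_trans #|A1 :|: A2 :|: A3|).
      apply/subset_leq_card/fintype.subsetP => v; rewrite inE => /deg2_gt2.
      rewrite !finset.in_setU; case=> h; apply/orP; [left; apply/orP; left | left; apply/orP; right | right].
      - by rewrite finset.in_set; apply/asboolP.
      - by rewrite finset.in_set; apply/asboolP.
      - by rewrite finset.in_set; apply/asboolP.
    apply: leq_trans (leq_card_setU _ _) _; apply: leq_add c3.
    by apply: leq_trans (leq_card_setU _ _) _; exact: leq_add c1 c2.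
  have [s1|/(deg2_star_bounded M)[B' hB']] := pselect (star_free 1%N).
    by exists 1%N; split=> //; split; [right | exists B].
  by exists 0%N; split=> //; split; [left | exists B'].
have [N1 h1] := (near_natP _).1 hX; have [N2 h2] := (near_natP _).1 hEX.
pose B' := (B + (2 * q ^ 2 + B * (M ^ 2 + 3 * M)))%N.
apply: (@SPEX_extremal R F M B' q k H X k0 fF hM hO hEX hX).
  exists (N1 + N2 + k)%N => n len; have EXn := h2 n ltac:(lia); have [fH _ _] := EXn.
  have HX := h1 n ltac:(lia).
  have fX := isog_family_free (isog_sym HX) fH.
  have dX := join_degree hM fX.
  apply: leq_trans (deg2_deficit q2 dX (hB _ _ fX dX) _) (leq_addl _ _).
  case: sq => [->//|fs].
  have kn : (k <= n)%N by lia.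
  have s0 : (0 < #|{: 'I_1 + 'I_q}|)%N by rewrite star_card.
  have := copies_bound s0 kn fs EXn HX.
  rewrite star_vol star_card card_ord.
  (* [X] has at least the edges of the [a] stars $K_{1,q}$ that fit. The remainder [r] is at most
     [q], which costs at most $2q^2$ in the hypothesis of [deg2_deficit]. *)
  have := divn_eq (n - k) q.+1; have := ltn_pmod (n - k) (ltn0Sn q).
  set V := vol _ _ _; set N := (n - k)%N; set a := (N %/ q.+1)%N; set r := (N %% q.+1)%N.
  clearbody V N a r; clear -q2; case: q q2 => [|[|[|//]]] _; nia.
by move=> V Y fY dY; apply: leq_trans (hB V Y fY dY) (leq_addr _ _).
Qed.

Local Close Scope set_scope.
Local Open Scope classical_set_scope.

Theorem theorem1p1 (R : realType) (F : graph_family) :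
  exists D : nat,
  forall (k : nat) (H : forall n : nat, sgraph 'I_n)
         (X : forall n : nat, sgraph 'I_(n - k)),
  (1 <= k)%N ->
  (fun n : nat => (ex_number n F)%:R : R^o) =O_\oo
    (fun n : nat => n%:R : R^o) ->
  ~ family_free F (bipartite 'I_k.+1 nat) ->
  (\forall n \near \oo, EX (bipartite 'I_k 'I_(n - k)) n F (H n)) ->
  case_a k H \/ case_b k H \/ case_c k H \/
    case_d R F H X \/ case_e R F H X \/ case_f R F H X ->
  [/\ (case_a k H \/ case_b k H \/ case_c k H ->
         \forall n \near \oo, forall G : sgraph 'I_n,
           SPEX R n F G <-> isog G (H n)),
      (case_d R F H X \/ case_f R F H X ->
         \forall n \near \oo,
           SPEX R n F `<=`
             EX (gjoin (complete 'I_k) (gcompl (complete 'I_(n - k)))) n F)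
    & (case_e R F H X ->
         exists C : R, \forall n \near \oo, forall G : sgraph 'I_n,
           SPEX R n F G ->
           exists Y : sgraph 'I_(n - k),
             [/\ isog G (gjoin (complete 'I_k) Y),
                 (nb_edges (X n))%:R - C * Num.sqrt n%:R
                   <= (nb_edges Y)%:R :> R
               & (max_degree Y <= D)%N])].
Proof.
(* [M] is obtained before [k] is introduced, so the degree bound depends on the family alone. *)
have [M hM] := few_common_nbrs F.
exists M => k H X k0 hO hK hEX _.
have hF : few_common F k M by exact: hM.
split.
- exact: (case_abc_SPEX k0 hF hO hEX).
- case=> [hd|hf]; first exact: (case_d_SPEX k0 hF hO hEX hd).
  exact: (case_f_SPEX k0 hF hO hEX hf).
(* Half of the constant 12 of [SPEX_join], where edges are counted twice. *)
- move=> [fF [Q [_ [hX _]]]]; exists (6 * M%:R ^+ 2).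
  have [N hN] := SPEX_join k0 fF hF hO hEX hX.
  apply/near_natP; exists N => n len G GS.
  have [Y [GY dY hY]] := hN n len G GS; exists Y; split=> //.
  by move: hY; rewrite !handshake !natrM; lra.
Qed.
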